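(* Let $X$ be a real quasireflexive separable Banach space, let $n\ge 1$ and $m\ge 2$ be integers, and let $A_{pj}: X\to X$, $p=1,\dots,m$, $j=1,\dots,n$, be continuous linear operators such that $\operatorname{Ker} A_{pj}=\{0\}$ for all $p,j$. Put $$G_i=\{(A_{1i}x,\dots,A_{mi}x)\in X^m : x\in X\},\quad i=1,\dots,n,$$ and suppose that $$\overline{G_i}\cap\overline{G_j}=\{0\}\quad\text{for all } i,j\in\{1,\dots,n\},\ i\neq j,$$ where the bar denotes closure in $X^m$ in the norm topology. Let $\xi_1,\dots,\xi_n$ be independent random variables with values in $X$ whose characteristic functionals do not vanish at any point of $X^*$. Consider the linear forms $L_j=A_{j1}\xi_1+\cdots+A_{jn}\xi_n$, $j=1,\dots,m$. If the distribution of the random vector $\mathbf{L}=(L_1,\dots,L_m)$ belongs to the class $\mathcal{D}_{m,m-1}$, then all $\xi_i$, $i=1,\dots,n$, are Gaussian random variables.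
   Context: $X^*$ is the dual space of $X$, and $\langle x,f\rangle$ is the value of $f\in X^*$ at $x\in X$. Topological notions (continuity, closure) refer to the norm topology. Quasireflexive: a Banach space $X$ is quasireflexive if (the canonical image of) $X$ has finite codimension in its second dual $X^{**}$. Gaussian: a random variable $\xi$ with values in $X$ is called Gaussian if for every $f\in X^*$ the real random variable $\langle \xi,f\rangle$ is Gaussian, i.e. there exist real numbers $m_f$ and $\sigma_f\ge 0$ such that its characteristic function is $e^{\mathrm{i}m_f t-\frac12\sigma_f t^2}$, $t\in\mathbb{R}$ (degenerate distributions are allowed). Characteristic functional: for a random variable $\xi$ with values in $X$, the characteristic functional of its distribution is $f\mapsto\mathbb{E}[e^{\mathrm{i}\langle\xi,f\rangle}]$, $f\in X^*$. Class $\mathcal{D}_{m,k}$, $1\le k\le m$: the distribution of a random vector $\boldsymbol{\zeta}=(\zeta_1,\dots,\zeta_m)$ with values in $X^m$ belongs to $\mathcal{D}_{m,k}$ if its characteristic functional admits a factorization $$\mathbb{E}\big[e^{\mathrm{i}(\langle\zeta_1,f_1\rangle+\cdots+\langle\zeta_m,f_m\rangle)}\big]=\prod_{1\le i_1<\dots<i_k\le m}R_{i_1,\dots,i_k}(f_{i_1},\dots,f_{i_k}),\quad f_1,\dots,f_m\in X^*,$$ where the $R_{i_1,\dots,i_k}$ are continuous (complex-valued) functions on $(X^* )^k$ with $R_{i_1,\dots,i_k}(0,\dots,0)=1$. *)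

(* Defs.v *)
From HB Require Import structures.
From mathcomp Require Import all_boot all_order all_algebra.
From mathcomp Require Import complex.
From mathcomp Require Import all_classical all_reals all_analysis.

Set Implicit Arguments.
Unset Strict Implicit.
Unset Printing Implicit Defensive.

Import Order.TTheory GRing.Theory Num.Theory.
Import numFieldNormedType.Exports.

Local Open Scope classical_set_scope.
Local Open Scope ring_scope.

Section dual_predicate.
Context {R : realType} {X : normedModType R}.

Definition dual_pred : {pred X -> R^o} :=
  [pred f : X -> R^o | `[< linear f /\ continuous f >]].

Lemma dual_predP (f : X -> R^o) : f \in dual_pred <-> linear f /\ continuous f.
Proof. by split; [move/asboolP | move=> h; apply/asboolP]. Qed.

Lemma dual_pred_submod : submod_closed dual_pred.
Proof.
split.
  apply/dual_predP; split=> [a x y | x]; last exact: cvg_cst.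
  by rewrite /= scaler0 addr0.
move=> a f g /dual_predP[lf cf] /dual_predP[lg cg]; apply/dual_predP; split.
  move=> b x y.
  rewrite [LHS]/(a *: f (b *: x + y) + g (b *: x + y)) lf lg.
  rewrite [RHS]/(b *: (a *: f x + g x) + (a *: f y + g y)).
  by rewrite !scalerDr !scalerA [a * b]mulrC; exact: addrACA.
by move=> x; apply: cvgD; [apply: cvgZr; exact: cf | exact: cg].
Qed.

HB.instance Definition _ :=
  GRing.isSubmodClosed.Build R (X -> R^o) dual_pred dual_pred_submod.

End dual_predicate.

Section dual_type.
Context {R : realType} (X : normedModType R).

(* The dual space X^*; as it carries the operator norm below, the bidual is
   [dual (dual X)]. *)
Record dual := Dual { dual_fun :> X -> R^o ; dual_funP : dual_fun \in dual_pred }.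

HB.instance Definition _ := [isSub for dual_fun].
HB.instance Definition _ := [Choice of dual by <:].
HB.instance Definition _ := [SubChoice_isSubLmodule of dual by <:].

End dual_type.

Section dual_norm.
Context {R : realType} {X : normedModType R}.
Implicit Types f g : dual X.

Lemma dual_linear f : linear f.
Proof. by have /dual_predP[] := dual_funP f. Qed.

HB.instance Definition _ f := GRing.isLinear.Build R X R^o _ f (dual_linear f).

Lemma dual_continuous f : continuous f.
Proof. by have /dual_predP[] := dual_funP f. Qed.

Lemma dualP f g : (forall x, f x = g x) -> f = g.
Proof. by move=> fg; apply/val_inj/funext. Qed.

Lemma dualD f g x : (f + g) x = f x + g x. Proof. by []. Qed.

Lemma dualZ a f x : (a *: f) x = a * f x. Proof. by []. Qed.

Definition dual_norm f : R := sup [set `|f x| | x in [set x : X | `|x| <= 1]].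

Lemma dual_has_sup f : has_sup [set `|f x| | x in [set x : X | `|x| <= 1]].
Proof.
split; first by exists `|f 0|, 0 => //=; rewrite normr0.
have /linear_bounded_continuous/bounded_funP/(_ 1)[M fM] := @dual_continuous f.
by exists M => _ [x x1 <-]; exact: fM.
Qed.

Lemma dual_norm_ub f x : `|x| <= 1 -> `|f x| <= dual_norm f.
Proof.
by move=> x1; apply: ub_le_sup; [case: (dual_has_sup f) | exists x].
Qed.

Lemma dual_norm_le f M :
  (forall x, `|x| <= 1 -> `|f x| <= M) -> dual_norm f <= M.
Proof.
move=> fM; apply: ge_sup; first by case: (dual_has_sup f).
by move=> _ [x x1 <-]; exact: fM.
Qed.

Lemma dual_norm_ge0 f : 0 <= dual_norm f.
Proof. by apply: le_trans (dual_norm_ub f (x := 0) _); rewrite ?normr0. Qed.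

Lemma dual_normP f x : `|f x| <= dual_norm f * `|x|.
Proof.
have [->|x0] := eqVneq x 0; first by rewrite linear0 !normr0 mulr0.
have nx : 0 < `|x| by rewrite normr_gt0.
rewrite -ler_pdivrMr//.
have := @dual_norm_ub f (`|x|^-1 *: x).
rewrite normrZ normfV normr_id mulVf ?gt_eqF// => /(_ (lexx _)).
by rewrite linearZ/= normrZ normfV normr_id mulrC.
Qed.

Lemma dual_normD f g : dual_norm (f + g) <= dual_norm f + dual_norm g.
Proof.
apply: dual_norm_le => x x1; rewrite dualD (le_trans (ler_normD _ _))//.
by rewrite lerD// dual_norm_ub.
Qed.

Lemma dual_normZ_le a f : dual_norm (a *: f) <= `|a| * dual_norm f.
Proof.
apply: dual_norm_le => x x1.
by rewrite dualZ normrM ler_wpM2l// dual_norm_ub.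
Qed.

Lemma dual_normZ a f : dual_norm (a *: f) = `|a| * dual_norm f.
Proof.
apply/le_anti; rewrite dual_normZ_le/=.
have [->|a0] := eqVneq a 0; first by rewrite normr0 mul0r dual_norm_ge0.
have na : 0 < `|a| by rewrite normr_gt0.
rewrite -ler_pdivlMl// -normfV; apply: le_trans (dual_normZ_le _ _).
by rewrite scalerA mulVf// scale1r.
Qed.

Lemma dual_norm_eq0 f : dual_norm f = 0 -> f = 0.
Proof.
move=> f0; apply: dualP => x; apply/eqP; rewrite -normr_le0.
by rewrite (le_trans (dual_normP f x))// f0 mul0r.
Qed.

HB.instance Definition _ := Lmodule_isNormed.Build R (dual X)
  dual_normD dual_normZ dual_norm_eq0.

Lemma dual_normE f : `|f| = dual_norm f. Proof. by []. Qed.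

End dual_norm.

Section bidual.
Context {R : realType} {X : normedModType R}.

Definition bidual_eval (x : X) : dual X -> R^o := fun f => f x.

Let bidual_eval_linear x : linear (bidual_eval x).
Proof. by []. Qed.

HB.instance Definition _ x :=
  GRing.isLinear.Build R (dual X) R^o _ (bidual_eval x) (bidual_eval_linear x).

Lemma bidual_eval_continuous x : continuous (bidual_eval x).
Proof.
apply/linear_bounded_continuous/bounded_funP => r; exists (r * `|x|) => f fr.
by apply: le_trans (dual_normP f x) _; rewrite ler_wpM2r.
Qed.

Lemma bidual_evalP x : bidual_eval x \in dual_pred.
Proof.
by apply/dual_predP; split; [exact: linearP | exact: bidual_eval_continuous].
Qed.

Definition canonical_embedding (x : X) : dual (dual X) :=
  Dual (bidual_evalP x).

End bidual.

Definition separable (T : topologicalType) : Prop :=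
  exists2 D : set T, countable D & dense D.

(* The quotient of the bidual by the canonical image of [X] is spanned by the
   classes of finitely many elements. *)
Definition quasireflexive {R : realType} (X : normedModType R) : Prop :=
  exists (N : nat) (e : 'I_N -> dual (dual X)),
    forall F : dual (dual X), exists (x : X) (c : 'I_N -> R),
      F = canonical_embedding x + \sum_(i < N) c i *: e i.

Definition borel (T : ptopologicalType) := g_sigma_algebraType (@open T).

Section complex_valued.
Context {R : realType}.

Definition cexp (z : R[i]) : R[i] :=
  let: (x +i* y)%C := z in ((expR x * cos y) +i* (expR x * sin y))%C.

Definition cexpectation d (T : measurableType d) (P : probability T R)
    (g : T -> R[i]) : R[i] :=
  ((\int[P]_w complex.Re (g w)) +i* (\int[P]_w complex.Im (g w)))%C.

End complex_valued.

Section random_elements.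
Context d (T : measurableType d) {R : realType} (P : probability T R).

Definition charfun (X : normedModType R) (xi : T -> X) (f : dual X) : R[i] :=
  cexpectation P (fun w => cexp ('i%C * (f (xi w))%:C)%C).

(* [(X^m)^*] is identified with [(X^* )^m]. *)
Definition charfun_vec (X : normedModType R) m (zeta : T -> 'rV[X]_m)
    (f : 'rV[dual X]_m) : R[i] :=
  cexpectation P
    (fun w => cexp ('i%C * (\sum_(p < m) f ord0 p (zeta w ord0 p))%:C)%C).

Definition gaussian_real (Y : T -> R) : Prop :=
  exists mY sigmaY : R, 0 <= sigmaY /\
    forall t : R,
      cexpectation P (fun w => cexp ('i%C * (t * Y w)%:C)%C) =
      cexp ('i%C * (mY * t)%:C - (sigmaY * t ^+ 2 / 2)%:C)%C.

Definition gaussian (X : normedModType R) (xi : T -> X) : Prop :=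
  forall f : dual X, gaussian_real (fun w => f (xi w)).

Definition mutually_independent d' (T' : measurableType d') n
    (xi : 'I_n -> {RV P >-> T'}) : Prop :=
  forall (J : {set 'I_n}) (B : 'I_n -> set T'),
    (forall i, measurable (B i)) ->
    P (\bigcap_(i in [set` J]) (xi i @^-1` B i)) =
    (\prod_(i in J) P (xi i @^-1` B i))%E.

(* Index sets i_1 < ... < i_k are the strictly increasing k-tuples over 'I_m.
   For a topological type [S], ['rV[S]_k] carries the product topology, here
   that of the max-norm; [R[i]^o] is [R[i]] with its usual topology. *)
Definition class_D (X : normedModType R) (m k : nat) (zeta : T -> 'rV[X]_m) :
    Prop :=
  exists Rf : k.-tuple 'I_m -> 'rV[dual X]_k -> R[i]^o,
    [/\ forall s : k.-tuple 'I_m, sorted ltn (map val s) -> continuous (Rf s),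
        forall s : k.-tuple 'I_m, sorted ltn (map val s) -> Rf s 0 = 1
      & forall f : 'rV[dual X]_m,
          charfun_vec zeta f =
          \prod_(s : k.-tuple 'I_m | sorted ltn (map val s))
            Rf s (\row_(l < k) f ord0 (tnth s l))].

End random_elements.

(* Main.v *)
Require Import Defs.
From HB Require Import structures.
From mathcomp Require Import all_boot all_order all_algebra.
From mathcomp Require Import complex.
From mathcomp Require Import all_classical all_reals all_analysis.
From mathcomp Require Import measurable_realfun.
From mathcomp Require Import ring lra zify.
Import Order.TTheory GRing.Theory Num.Theory.
Import numFieldNormedType.Exports.
Set Implicit Arguments.
Unset Strict Implicit.
Unset Printing Implicit Defensive.
Local Open Scope classical_set_scope.
Local Open Scope ring_scope.

(** Let [phi_j] be the characteristic functional of [xi_j] and [J_j] the adjoint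
of [x |-> (A_1j x, ..., A_mj x)], a map from the [m]-th power of the dual [X']
to [X']. By independence ([cexpectation_prod], [charfun_linear_forms]) the
factorization of the characteristic functional of the linear forms is an
equation
  [prod_j phi_j (J_j f) = prod_s R_s (f restricted to s)]
in which every factor on the right ignores some coordinate of [f]. Since no
factor vanishes, one may apply iterated multiplicative differences ([mdiff]),
which are differences of logarithms without a choice of logarithms. A
difference in the [p]-th coordinate removes the [R_s] that ignore it, and a
difference along the kernel of [J_j] removes [phi_j]. Performing all of them,
with [j] different from a fixed [i], leaves [mdiff H phi_i = 1], where the
steps [H] range over the images under [J_i] of the coordinate spaces and of the
kernels of the other [J_j]. All these images are total subspaces of [X'], that
is, they separate the points of [X]: the first ones because the operators are
injective, the second ones because by the Hahn-Banach theorem the points they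
annihilate have their image in the closures of two of the graphs [G_i]
([total_range_adjoint], [total_adjoint_ker]).

A total subspace need not be dense in the norm of [X'], but [phi_i] is
uniformly continuous for a weaker seminorm, the [L^2] norm of
[f(xi_i) / (1 + |xi_i|)] ([covariance_charfun]). The covariance operator of this
bounded random element takes its values in [X] ([covariance_rep]); hence the
usual Hilbert space argument, in which a residue orthogonal to the subspace is
represented by a point of [X] and vanishes by totality, shows that total
subspaces are dense for the seminorm ([total_dense]). So [mdiff H phi_i = 1] for
all steps in [X'] ([mdiff_charfun]).

On a line, [u(t) = phi_i (t f)] is a continuous function with trivial iterated
multiplicative differences, hence the exponential of a polynomial
([mdiff_eq1_exp_poly], after Frechet). It is also a characteristic function, and
the theorem of Marcinkiewicz ([marcinkiewicz]) says that the polynomial then has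
degree at most two: the power series of [u] bounds all moments, so that the
moment generating function is entire and coincides with the analytic extension
of [u]; its modulus at [x + i y] is at most its value at [x], and this
inequality between exponentials of polynomials is incompatible with the growth
of a leading term of degree at least three ([ridge_size_le3]). *)

(** * Hahn-Banach extension and total subspaces of the dual *)

Section hahn_banach.
Context {R : realType} {V : lmodType R}.
Implicit Types p q : V -> R.

Definition sublinear p :=
  (forall x y, p (x + y) <= p x + p y) /\
  (forall a x, 0 <= a -> p (a *: x) = a * p x).

Lemma sublinear0 p : sublinear p -> p 0 = 0.
Proof. by move=> [_ h]; rewrite -(scale0r (0 : V)) h // mul0r. Qed.

Lemma sublinear_geN p x : sublinear p -> - p (- x) <= p x.
Proof.
by move=> sp; have := sp.1 x (- x); rewrite subrr sublinear0 //; lra.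
Qed.

(** The largest sublinear minorant of [p] whose value at [- v] is at most
    [- p v]. A minimal sublinear functional therefore is odd, hence linear. *)
Definition flatten_along p (v x : V) : R :=
  inf [set p (x + t *: v) - t * p v | t in [set t : R | 0 <= t]].

Lemma flatten_along_has_inf p v x : sublinear p ->
  has_inf [set p (x + t *: v) - t * p v | t in [set t : R | 0 <= t]].
Proof.
move=> sp; split; first by exists (p (x + 0 *: v) - 0 * p v), 0 => /=.
exists (- p (- x)) => _ [t /= t0 <-].
have := sp.1 (x + t *: v) (- x).
by rewrite addrAC subrr add0r sp.2 //; lra.
Qed.

Lemma flatten_along_le p v x t : sublinear p -> 0 <= t ->
  flatten_along p v x <= p (x + t *: v) - t * p v.
Proof.
move=> sp t0; apply: ge_inf; last by exists t.
by case: (flatten_along_has_inf v x sp).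
Qed.

Lemma le_flatten_along p v x c : sublinear p ->
  (forall t, 0 <= t -> c <= p (x + t *: v) - t * p v) ->
  c <= flatten_along p v x.
Proof.
move=> sp h; apply: lb_le_inf; first by case: (flatten_along_has_inf v x sp).
by move=> _ [t /= t0 <-]; exact: h.
Qed.

Lemma sublinear_flatten_along p v : sublinear p -> sublinear (flatten_along p v).
Proof.
move=> sp.
have hZ a x : 0 < a -> flatten_along p v (a *: x) <= a * flatten_along p v x.
  move=> a0; rewrite -ler_pdivrMl //; apply: le_flatten_along => // t t0.
  rewrite ler_pdivrMl //.
  apply: le_trans (flatten_along_le v _ sp (mulr_ge0 (ltW a0) t0)) _.
  rewrite -scalerA -scalerDr sp.2; last exact: ltW.
  by rewrite mulrBr mulrA.
split=> [x y | a x].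
  rewrite -lerBlDr; apply: le_flatten_along => // t t0.
  rewrite lerBlDr -lerBlDl; apply: le_flatten_along => // s s0.
  have := flatten_along_le v (x + y) sp (addr_ge0 t0 s0).
  have := sp.1 (x + t *: v) (y + s *: v).
  by rewrite addrACA -scalerDl; lra.
rewrite le_eqVlt => /predU1P[<- | a0].
  rewrite scale0r mul0r; apply/le_anti/andP; split.
    have := flatten_along_le v 0 sp (lexx 0).
    by rewrite scale0r addr0 (sublinear0 sp) mul0r subr0.
  apply: le_flatten_along => // t t0.
  by rewrite add0r sp.2 // subrr.
apply/le_anti; rewrite hZ //=.
have := hZ a^-1 (a *: x); rewrite invr_gt0 => /(_ a0).
by rewrite scalerA mulVf ?gt_eqF // scale1r ler_pdivlMl.
Qed.

Lemma flatten_along_le_self p v x : sublinear p -> flatten_along p v x <= p x.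
Proof.
move=> sp; have := flatten_along_le v x sp (lexx 0).
by rewrite scale0r addr0 mul0r subr0.
Qed.

Lemma flatten_alongN p v : sublinear p -> flatten_along p v (- v) <= - p v.
Proof.
move=> sp; have := flatten_along_le v (- v) sp ler01.
by rewrite scale1r addNr sublinear0 // mul1r sub0r.
Qed.

(** Zorn's lemma: the pointwise infimum of a chain of sublinear functionals is
    sublinear, and it is finite because [q x >= - q (- x) >= - p (- x)]. *)
Lemma minimal_sublinear p : sublinear p -> exists2 f,
  sublinear f /\ (forall x, f x <= p x) &
  forall g, sublinear g -> (forall x, g x <= f x) -> g = f.
Proof.
move=> sp.
pose T := {q : V -> R | `[< sublinear q /\ forall x, q x <= p x >]}.
pose rT (s t : T) := `[< forall x, val t x <= val s x >].
have PT (t : T) : sublinear (val t) /\ forall x, val t x <= p x.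
  by case: t => q /= /asboolP.
have [| | | |t tmax] := @Zorn T rT.
- by move=> t; apply/asboolP.
- move=> r s t /asboolP rs /asboolP st; apply/asboolP => x.
  exact: le_trans (st x) (rs x).
- move=> s t /asboolP st /asboolP ts; apply/val_inj/funext => x.
  by apply/le_anti; rewrite st ts.
- move=> A totA; have [[t0 At0]|A0] := pselect (exists t, A t); last first.
    have tP : `[< sublinear p /\ forall x, p x <= p x >] by exact/asboolP.
    by exists (exist _ p tP) => s As; case: A0; exists s.
  have hi x : has_inf [set val t x | t in A].
    split; first by exists (val t0 x), t0.
    exists (- p (- x)) => _ [t At <-].
    have [st tp] := PT t; have := sublinear_geN x st; have := tp (- x); lra.
  pose q x := inf [set val t x | t in A].
  have q_le t x : A t -> q x <= val t x.
    by move=> At; apply: ge_inf; [case: (hi x) | exists t].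
  have le_q c x : (forall t, A t -> c <= val t x) -> c <= q x.
    move=> h; apply: lb_le_inf; first by case: (hi x).
    by move=> _ [t At <-]; exact: h.
  have sq : sublinear q.
    split=> [x y | a x a0].
      rewrite -lerBlDr; apply: (le_q _ _) => t At; rewrite lerBlDr -lerBlDl.
      apply: (le_q _ _) => s As; rewrite lerBlDr.
      have [/asboolP ts | /asboolP st] := totA t s At As.
        apply: le_trans (q_le s _ As) _; apply: le_trans ((PT s).1.1 x y) _.
        by have := ts x; lra.
      apply: le_trans (q_le t _ At) _; apply: le_trans ((PT t).1.1 x y) _.
      by have := st y; lra.
    have hZ b y : 0 < b -> q (b *: y) <= b * q y.
      move=> b0; rewrite -ler_pdivrMl //; apply: (le_q _ _) => t At.
      rewrite ler_pdivrMl //; apply: le_trans (q_le t _ At) _.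
      by rewrite (PT t).1.2 //; exact: ltW.
    move: a0; rewrite le_eqVlt => /predU1P[<- | a0].
      rewrite scale0r mul0r; apply/le_anti/andP; split.
        by have := q_le t0 0 At0; rewrite (sublinear0 (PT t0).1).
      by apply: (le_q _ _) => t At; rewrite (sublinear0 (PT t).1).
    apply/le_anti; rewrite hZ //=.
    have := hZ a^-1 (a *: x); rewrite invr_gt0 => /(_ a0).
    by rewrite scalerA mulVf ?gt_eqF // scale1r ler_pdivlMl.
  have qP : `[< sublinear q /\ forall x, q x <= p x >].
    apply/asboolP; split=> // x.
    exact: le_trans (q_le t0 x At0) ((PT t0).2 x).
  by exists (exist _ q qP) => s As; apply/asboolP => x; exact: q_le.
exists (val t); first exact: PT.
move=> g sg gt.
have gP : `[< sublinear g /\ forall x, g x <= p x >].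
  by apply/asboolP; split=> // x; exact: le_trans (gt x) ((PT t).2 x).
rewrite -(tmax (exist _ g gP)) //; exact/asboolP.
Qed.

(** Flattening [p] along [v] first forces the linear minorant to attain [p v]. *)
Lemma hahn_banach p v : sublinear p -> exists f : V -> R,
  [/\ forall a x y, f (a *: x + y) = a * f x + f y,
      forall x, f x <= p x & f v = p v].
Proof.
move=> sp; have sq := sublinear_flatten_along v sp.
have [f [sf fq] fmin] := minimal_sublinear sq.
have fp x : f x <= p x := le_trans (fq x) (flatten_along_le_self v x sp).
have fN x : f (- x) = - f x.
  have fx : flatten_along f x = f.
    apply: fmin; first exact: sublinear_flatten_along.
    by move=> y; exact: flatten_along_le_self.
  have := flatten_alongN x sf; rewrite fx.
  by have := sublinear_geN x sf; lra.
have fD x y : f (x + y) = f x + f y.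
  apply/le_anti; rewrite sf.1 /=.
  by have := sf.1 (- x) (- y); rewrite -opprD !fN; lra.
exists f; split=> //.
  move=> a x y; rewrite fD; congr (_ + _).
  have [a0|a0] := leP 0 a; first by rewrite sf.2.
  rewrite -[a]opprK scaleNr fN sf.2 ?mulNr //.
  by rewrite oppr_ge0 ltW.
apply/le_anti; rewrite fp /=.
by have := fq (- v); rewrite fN; have := flatten_alongN v sp; lra.
Qed.

End hahn_banach.

Section duality.
Context {R : realType} {X : normedModType R}.

Lemma dual_of_bounded (f : X -> R) :
  (forall a x y, f (a *: x + y) = a * f x + f y) ->
  (forall x, `|f x| <= `|x|) ->
  exists2 g : dual X, forall x, g x = f x & `|g| <= 1.
Proof.
move=> lf bf.
pose mf := GRing.isLinear.Build R X R^o _ f lf.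
pose F : {linear X -> R^o} := HB.pack f mf.
have cF : continuous F.
  apply/linear_bounded_continuous/bounded_funP => r; exists r => x.
  exact: le_trans.
have FP : (f : X -> R^o) \in dual_pred by apply/dual_predP.
exists (Dual FP) => //; apply: dual_norm_le => x.
exact: le_trans.
Qed.

Lemma norming_functional (x : X) : exists2 g : dual X, `|g| <= 1 & g x = `|x|.
Proof.
have [|f [lf fle fx]] := @hahn_banach R X (fun y => `|y|) x.
  split=> [y z|a y a0]; first exact: ler_normD.
  by rewrite normrZ ger0_norm.
have [|g gf g1] := dual_of_bounded lf; last by exists g; rewrite ?gf.
move=> y; rewrite ler_norml fle andbT.
have f0 : f 0 = 0 by have := lf 1 0 0; rewrite scale1r add0r; lra.
have := lf (-1) y 0; rewrite f0 addr0 scaleN1r mulN1r addr0.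
by have := fle (- y); rewrite normrN; lra.
Qed.

Lemma norm_le_functionals (x : X) c :
  (forall g : dual X, `|g| <= 1 -> g x <= c) -> `|x| <= c.
Proof. by move=> h; have [g g1 <-] := norming_functional x; exact: h. Qed.

Lemma dual_separates (x : X) : (forall g : dual X, g x = 0) -> x = 0.
Proof.
by move=> h; apply/eqP; rewrite -normr_le0; apply: norm_le_functionals => g _;
  rewrite h.
Qed.

(** A point of a finite power of [X] on which every functional vanishing on a
    subspace vanishes is a limit of points of the subspace: the Hahn-Banach
    theorem is applied to the distance to the subspace. *)
Lemma closure_of_annihilator m (G : set ('I_m -> X)) (x : 'I_m -> X) :
  G 0 -> (forall a u v, G u -> G v -> G (a *: u + v)) ->
  (forall h : 'I_m -> dual X,
     (forall g, G g -> \sum_p h p (g p) = 0) -> \sum_p h p (x p) = 0) ->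
  forall e, 0 < e -> exists2 g, G g & forall p, `|x p - g p| < e.
Proof.
move=> G0 GZD hx e e0.
pose N (v : 'I_m -> X) := \sum_p `|v p|.
have N0 v : 0 <= N v by exact: sumr_ge0.
have ND u v : N (u + v) <= N u + N v.
  by rewrite -big_split /=; apply: ler_sum => p _; exact: ler_normD.
have NZ a v : N (a *: v) = `|a| * N v.
  by rewrite mulr_sumr; apply: eq_bigr => p _; rewrite -normrZ.
pose D v := inf [set N (v - g) | g in G].
have hi v : has_inf [set N (v - g) | g in G].
  split; first by exists (N (v - 0)), 0.
  by exists 0 => _ [g _ <-].
have D_le v g : G g -> D v <= N (v - g).
  by move=> Gg; apply: ge_inf; [case: (hi v) | exists g].
have le_D c v : (forall g, G g -> c <= N (v - g)) -> c <= D v.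
  move=> h; apply: lb_le_inf; first by case: (hi v).
  by move=> _ [g Gg <-]; exact: h.
have GZ a u : G u -> G (a *: u).
  by move=> Gu; rewrite -[_ *: _]addr0; exact: GZD.
have D0 : D 0 = 0.
  apply/le_anti/andP; split; last by apply: (le_D).
  by apply: le_trans (D_le 0 0 G0) _; rewrite subrr /N big1 // => p _; rewrite normr0.
have sD : sublinear D.
  split=> [u v | a u].
    rewrite -lerBlDr; apply: (le_D) => g Gg; rewrite lerBlDr -lerBlDl.
    apply: (le_D) => k Gk; rewrite lerBlDl.
    have Ggk : G (g + k) by rewrite -[g]scale1r; exact: GZD.
    apply: le_trans (D_le _ _ Ggk) _; rewrite opprD addrACA; exact: ND.
  have hZ b y : 0 < b -> D (b *: y) <= b * D y.
    move=> b0; rewrite -ler_pdivrMl //; apply: (le_D) => g Gg.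
    rewrite ler_pdivrMl //; apply: le_trans (D_le _ _ (GZ b g Gg)) _.
    by rewrite -scalerBr NZ gtr0_norm.
  rewrite le_eqVlt => /predU1P[<- | a0]; first by rewrite scale0r mul0r.
  apply/le_anti; rewrite hZ //=.
  have := hZ a^-1 (a *: u); rewrite invr_gt0 => /(_ a0).
  by rewrite scalerA mulVf ?gt_eqF // scale1r ler_pdivlMl.
have [f [lf fD fx]] := hahn_banach x sD.
have f0 : f 0 = 0 by have := lf 1 0 0; rewrite scale1r add0r; lra.
have fN v : f (- v) = - f v.
  by have := lf (-1) v 0; rewrite f0 addr0 scaleN1r mulN1r addr0.
have fDD u v : f (u + v) = f u + f v by have := lf 1 u v; rewrite scale1r mul1r.
have fG g : G g -> f g = 0.
  have le0 k : G k -> f k <= 0.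
    move=> Gk; apply: le_trans (fD k) _; apply: le_trans (D_le k k Gk) _.
    by rewrite subrr /N big1 // => p _; rewrite normr0.
  move=> Gg; have := le0 g Gg; have := le0 _ (GZ (-1) g Gg).
  by rewrite scaleN1r fN; lra.
pose inj p (y : X) : 'I_m -> X := fun q => if q == p then y else 0.
have injE v : v = \sum_p inj p (v p).
  apply/funext => q; rewrite fct_sumE (bigD1 q) //= /inj eqxx big1 ?addr0 //.
  by move=> p /negbTE; rewrite eq_sym => ->.
have /choice[h hE] (p : 'I_m) : exists g : dual X, forall y, g y = f (inj p y).
  have [||g gE _] := @dual_of_bounded (fun y => f (inj p y)).
  - move=> a y z; rewrite -lf; congr (f _); apply/funext => q.
    rewrite [RHS]/(a *: inj p y q + inj p z q) /inj.
    by case: ifP => // _; rewrite scaler0; exact/esym/addr0.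
  - have Ninj y : N (inj p y) = `|y|.
      rewrite /N (bigD1 p) //= /inj eqxx big1 ?addr0 // => q /negbTE ->.
      by rewrite normr0.
    have fle y : f (inj p y) <= `|y|.
      apply: le_trans (fD _) _; apply: le_trans (D_le _ _ G0) _.
      by rewrite subr0 Ninj.
    move=> y; rewrite ler_norml fle andbT.
    have -> : inj p y = - inj p (- y).
      apply/funext => q; rewrite [RHS]/(- inj p (- y) q) /inj.
      by case: ifP => _; [exact/esym/opprK | exact/esym/oppr0].
    by rewrite fN lerN2; have := fle (- y); rewrite normrN.
  - by exists g.
have fE v : \sum_p h p (v p) = f v.
  rewrite [in RHS](injE v); under eq_bigr do rewrite hE.
  by rewrite -(big_morph f fDD f0).
have : f x = 0 by rewrite -fE; apply: hx => g Gg; rewrite fE fG.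
rewrite fx => Dx.
have /(inf_adherent e0) := hi x; rewrite -/(D x) Dx add0r => -[_ [g Gg <-] Ng].
exists g => // p; apply: le_lt_trans Ng.
by rewrite /N (bigD1 p) //= lerDl sumr_ge0.
Qed.

Definition total (E : set (dual X)) :=
  forall x, (forall f, E f -> f x = 0) -> x = 0.

Lemma dual_comp_pred (A : {linear X -> X}) (a : dual X) : continuous A ->
  (fun x => a (A x)) \in dual_pred.
Proof.
move=> cA; apply/dual_predP; split=> [c x y | x].
  by rewrite linearP dual_linear.
by apply: continuous_comp; [exact: cA | exact: dual_continuous].
Qed.

Definition adjoint (A : {linear X -> X}) (cA : continuous A) (a : dual X) :=
  Dual (dual_comp_pred a cA).

Lemma adjoint_linear (A : {linear X -> X}) (cA : continuous A) :
  linear (adjoint cA).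
Proof. by move=> c a b; apply: dualP. Qed.

HB.instance Definition _ (A : {linear X -> X}) (cA : continuous A) :=
  GRing.isLinear.Build R (dual X) (dual X) _ (adjoint cA) (adjoint_linear cA).

Lemma total_range_adjoint (A : {linear X -> X}) (cA : continuous A) :
  A @^-1` [set 0] = [set 0] -> total (range (adjoint cA)).
Proof.
move=> kA x hx; suff : (A @^-1` [set 0]) x by rewrite kA.
by apply: dual_separates => g; apply: (hx (adjoint cA g)); exists g.
Qed.

Lemma dual_sumE (I : finType) (f : I -> dual X) x : (\sum_i f i) x = \sum_i f i x.
Proof. by elim/big_rec2: _ => // i y z _ <-. Qed.

End duality.

Section adjoint_forms.
Context {R : realType} {X : normedModType R} {m n : nat}.
Variables (A : 'I_m -> 'I_n -> {linear X -> X}).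
Hypothesis cA : forall p j, continuous (A p j).

(** The adjoint of [x |-> (A_1j x, ..., A_mj x)], from [(X^* )^m] to [X^*]. *)
Definition adjoint_form j (h : 'I_m -> dual X) : dual X :=
  \sum_p adjoint (cA (p := p) (j := j)) (h p).

Lemma adjoint_form_linear j : linear (adjoint_form j).
Proof.
move=> c a b; rewrite /adjoint_form scaler_sumr -big_split /=.
by apply: eq_bigr => p _; rewrite linearP.
Qed.

HB.instance Definition _ j := GRing.isLinear.Build R ('I_m -> dual X) (dual X) _
  (adjoint_form j) (adjoint_form_linear j).

Lemma adjoint_formE j h x : adjoint_form j h x = \sum_p h p (A p j x).
Proof. exact: dual_sumE. Qed.

Let graph j : set 'rV[X]_m := [set (\row_p A p j x : 'rV[X]_m) | x in [set: X]].

(** The annihilator of this image of the kernel consists of the [x] whose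
    image in [X^m] lies in the closure of the [j]-th graph. *)
Lemma total_adjoint_ker i j : (0 < m)%N ->
  (forall p, A p i @^-1` [set 0] = [set 0]) ->
  closure (graph i) `&` closure (graph j) = [set 0] ->
  total [set adjoint_form i h | h in [set h | adjoint_form j h = 0]].
Proof.
move=> m0 kA Gij x hx.
pose G := [set (fun p => A p j y) | y in [set: X]].
have aG : forall e, 0 < e ->
    exists2 g, G g & forall p, `|A p i x - g p| < e.
  apply: (@closure_of_annihilator _ _ _ G (fun p => A p i x)).
  - by exists 0 => //; apply/funext => p; rewrite linear0.
  - move=> a _ _ [y _ <-] [z _ <-]; exists (a *: y + z) => //.
    by apply/funext => p; rewrite linearP.
  - move=> h hG; rewrite -adjoint_formE; apply: hx; exists h => //=.
    by apply: dualP => y; rewrite adjoint_formE; apply: hG; exists y.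
suff : (\row_p A p i x : 'rV[X]_m) = 0.
  move=> /rowP/(_ (Ordinal m0)); rewrite !mxE => Ax0.
  suff : (A (Ordinal m0) i @^-1` [set 0]) x by rewrite kA.
  exact: Ax0.
suff : (closure (graph i) `&` closure (graph j)) (\row_p A p i x) by rewrite Gij.
split; first by apply: subset_closure; exists x.
move=> B /nbhs_ballP[e e0 eB]; have [_ [y _ <-] yx] := aG e e0.
exists (\row_p A p j y); split; first by exists y.
apply: eB; split=> // k l; rewrite !mxE -ball_normE /=; exact: yx.
Qed.

End adjoint_forms.

(** * Complex exponential and complex expectations *)

Notation normc := ComplexField.Normc.normc.
Notation Re := complex.Re.
Notation Im := complex.Im.

Section complex_numbers.
Context {R : realType}.
Implicit Types z w : R[i].

Lemma normc_ge0 z : 0 <= normc z.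
Proof. by case: z => a b; rewrite sqrtr_ge0. Qed.

Lemma normr_normc z : `|z| = (normc z)%:C%C.
Proof. by case: z. Qed.

Lemma normcX z k : normc (z ^+ k) = normc z ^+ k.
Proof.
elim: k => [|k IH]; first by rewrite !expr0 ComplexField.Normc.normc1.
by rewrite !exprS ComplexField.Normc.normcM IH.
Qed.

Lemma normcC (x : R) : normc x%:C%C = `|x|.
Proof. by rewrite /= expr0n addr0 sqrtr_sqr. Qed.

Lemma normc_Re z : `|Re z| <= normc z.
Proof. by case: z => a b; rewrite -sqrtr_sqr ler_wsqrtr // lerDl sqr_ge0. Qed.

Lemma normc_Im z : `|Im z| <= normc z.
Proof. by case: z => a b; rewrite -sqrtr_sqr ler_wsqrtr // lerDr sqr_ge0. Qed.

Lemma normc_le_ReIm z : normc z <= `|Re z| + `|Im z|.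
Proof.
rewrite {1}[z]complexE; apply: le_trans (le_normcD _ _) _.
by rewrite ComplexField.Normc.normcM !normcC /= expr0n add0r expr1n sqrtr1 mul1r.
Qed.

Lemma normc_sum (I : Type) (r : seq I) (Q : pred I) (F : I -> R[i]) :
  normc (\sum_(i <- r | Q i) F i) <= \sum_(i <- r | Q i) normc (F i).
Proof.
elim/big_rec2: _ => [|i y z _ IH]; first by rewrite ComplexField.Normc.normc0.
exact: le_trans (le_normcD _ _) (lerD _ IH).
Qed.

Lemma normc_eq0 z : (normc z == 0) = (z == 0).
Proof.
apply/eqP/eqP => [/ComplexField.Normc.eq0_normc // | ->].
exact: ComplexField.Normc.normc0.
Qed.

Lemma ReD z w : Re (z + w) = Re z + Re w. Proof. by case: z; case: w. Qed.
Lemma ImD z w : Im (z + w) = Im z + Im w. Proof. by case: z; case: w. Qed.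
Lemma ReM z w : Re (z * w) = Re z * Re w - Im z * Im w.
Proof. by case: z; case: w. Qed.
Lemma ImM z w : Im (z * w) = Re z * Im w + Im z * Re w.
Proof. by case: z => a b; case: w. Qed.

Lemma complex_ext z w : Re z = Re w -> Im z = Im w -> z = w.
Proof. by case: z => a b; case: w => c e /= -> ->. Qed.

Lemma cexpE z : cexp z = (expR (Re z) * cos (Im z) +i* (expR (Re z) * sin (Im z)))%C.
Proof. by case: z. Qed.

Lemma cexp0 : cexp 0 = 1 :> R[i].
Proof. by rewrite cexpE /= expR0 cos0 sin0 mulr0 mulr1. Qed.

Lemma cexpD z w : cexp (z + w) = cexp z * cexp w.
Proof.
case: z => a b; case: w => c e; rewrite !cexpE /= expRD cosD sinD.
by apply: complex_ext => /=; ring.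
Qed.

Lemma cexp_neq0 z : cexp z != 0.
Proof.
apply/negP => /eqP z0; have := cexpD z (- z).
by rewrite subrr cexp0 z0 mul0r => /eqP; rewrite oner_eq0.
Qed.

Lemma cexpN z : cexp (- z) = (cexp z)^-1.
Proof.
apply: (mulfI (cexp_neq0 z)).
by rewrite -cexpD subrr cexp0 mulfV // cexp_neq0.
Qed.

Lemma cexpB z w : cexp (z - w) = cexp z / cexp w.
Proof. by rewrite cexpD cexpN. Qed.

Lemma cexp_sum (I : Type) (r : seq I) (Q : pred I) (F : I -> R[i]) :
  cexp (\sum_(i <- r | Q i) F i) = \prod_(i <- r | Q i) cexp (F i).
Proof. exact: (big_morph cexp cexpD cexp0). Qed.

Lemma normc_cexp z : normc (cexp z) = expR (Re z).
Proof.
rewrite cexpE /= !exprMn -mulrDr cos2Dsin2 mulr1 sqrtr_sqr ger0_norm //.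
Qed.

Lemma cexp_i (x : R) : cexp ('i * x%:C)%C = (cos x +i* sin x)%C.
Proof. by rewrite cexpE ReM ImM /= !mul0r mulr0 subr0 add0r mul1r expR0 !mul1r. Qed.

Lemma normc_cexp_i (x : R) : normc (cexp ('i * x%:C)%C) = 1.
Proof. by rewrite normc_cexp ReM /= !mul0r mulr0 subr0 expR0. Qed.

Lemma cexp_eq1_small z : cexp z = 1 -> `|Im z| < 2 -> z = 0.
Proof.
move=> z1 zs.
have Rz : Re z = 0.
  apply: (@expR_inj R); rewrite expR0 -normc_cexp z1.
  exact: ComplexField.Normc.normc1.
apply: complex_ext => //=.
move: z1; rewrite cexpE Rz expR0 !mul1r => -[_ s0].
apply/eqP/negP => /negP i0.
have [ip|ip|/eqP] := ltgtP 0 (Im z); last by rewrite eq_sym (negbTE i0).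
  have : 0 < sin (Im z) by rewrite sin2_gt0 // ip; move: zs; rewrite gtr0_norm.
  by rewrite s0 ltxx.
have : 0 < sin (- Im z).
  by rewrite sin2_gt0 // oppr_gt0 ip; move: zs; rewrite ltr0_norm.
by rewrite sinN s0 oppr0 ltxx.
Qed.

End complex_numbers.

Section integrable_functions.
Context d (T : measurableType d) {R : realType} (P : probability T R).
Implicit Types (f h : T -> R) (g k : T -> R[i]).

Definition intble f := P.-integrable [set: T] (EFin \o f).

Lemma intble_dom f h : measurable_fun [set: T] f -> intble h ->
  (forall w, `|f w| <= h w) -> intble f.
Proof.
move=> mf ih fh; apply: le_integrable ih => //; first exact/measurable_EFinP.
move=> w _ /=; rewrite lee_fin (le_trans (fh w)) //; exact: ler_norm.
Qed.

Lemma intble_cst (c : R) : intble (cst c).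
Proof. exact: finite_measure_integrable_cst. Qed.

Lemma intble_bounded f M : measurable_fun [set: T] f ->
  (forall w, `|f w| <= M) -> intble f.
Proof. by move=> mf fM; apply: (intble_dom mf (intble_cst M)). Qed.

Lemma intbleD f h : intble f -> intble h -> intble (fun w => f w + h w).
Proof. by move=> i j; have := integrableD measurableT i j. Qed.

Lemma intbleZ c f : intble f -> intble (fun w => c * f w).
Proof. by move=> i; have := integrableZl measurableT c i. Qed.

Lemma intbleB f h : intble f -> intble h -> intble (fun w => f w - h w).
Proof. by move=> i j; have := integrableB measurableT i j. Qed.

Definition cintble g := intble (fun w => Re (g w)) /\ intble (fun w => Im (g w)).

Lemma cintbleD g k : cintble g -> cintble k -> cintble (fun w => g w + k w).
Proof.
move=> [g1 g2] [k1 k2]; split.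
  by under eq_fun do rewrite ReD; exact: intbleD.
by under eq_fun do rewrite ImD; exact: intbleD.
Qed.

Lemma cintbleZ c g : cintble g -> cintble (fun w => c * g w).
Proof.
move=> [g1 g2]; split.
  by under eq_fun do rewrite ReM; apply: intbleB; exact: intbleZ.
by under eq_fun do rewrite ImM; apply: intbleD; exact: intbleZ.
Qed.

Lemma cintble_cst (c : R[i]) : cintble (fun=> c).
Proof. by split; exact: intble_cst. Qed.

Local Notation CE := (cexpectation P).

Lemma eq_cexpectation g k : g =1 k -> CE g = CE k.
Proof. by move=> gk; congr CE; apply/funext. Qed.

Lemma cexpectationD g k : cintble g -> cintble k ->
  CE (fun w => g w + k w) = CE g + CE k.
Proof.
move=> [g1 g2] [k1 k2]; rewrite /cexpectation.
under [in X in (X +i* _)%C]eq_Rintegral do rewrite ReD.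
under [in X in (_ +i* X)%C]eq_Rintegral do rewrite ImD.
by rewrite !RintegralD.
Qed.

Lemma cexpectationZ c g : cintble g -> CE (fun w => c * g w) = c * CE g.
Proof.
move=> [g1 g2]; rewrite /cexpectation.
under [in X in (X +i* _)%C]eq_Rintegral do rewrite ReM.
under [in X in (_ +i* X)%C]eq_Rintegral do rewrite ImM.
rewrite RintegralB ?RintegralD //; try exact: intbleZ.
by rewrite !RintegralZl //; case: c.
Qed.

Lemma cexpectation_cst (c : R[i]) : CE (fun=> c) = c.
Proof.
rewrite /cexpectation !Rintegral_cst //= probability_setT /= !mulr1.
by case: c.
Qed.

Lemma Rintegral_prob_cst (c : R) : \int[P]_w c = c.
Proof. by rewrite Rintegral_cst //= probability_setT /= mulr1. Qed.

Lemma cintbleB g k : cintble g -> cintble k -> cintble (fun w => g w - k w).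
Proof.
move=> ig ik; under eq_fun do rewrite -mulN1r.
by apply: cintbleD => //; exact: cintbleZ.
Qed.

Lemma cexpectationB g k : cintble g -> cintble k ->
  CE (fun w => g w - k w) = CE g - CE k.
Proof.
move=> ig ik; rewrite -[in RHS]mulN1r -cexpectationZ // -cexpectationD //.
  by apply: eq_cexpectation => w; rewrite mulN1r.
exact: cintbleZ.
Qed.

Lemma Re_cexpectation g : Re (CE g) = \int[P]_w Re (g w).
Proof. by []. Qed.

Lemma Im_cexpectation g : Im (CE g) = \int[P]_w Im (g w).
Proof. by []. Qed.

Lemma le_intble f h : intble f -> intble h -> (forall w, f w <= h w) ->
  \int[P]_w f w <= \int[P]_w h w.
Proof. by move=> fi hi fh; apply: le_Rintegral. Qed.

(** Rotating the expectation to the positive half-line turns its modulus into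
    the integral of a real part. *)
Lemma normc_cexpectation_le g h : cintble g -> intble h ->
  (forall w, normc (g w) <= h w) -> normc (CE g) <= \int[P]_w h w.
Proof.
move=> ig ih gh; have [z0|z0] := eqVneq (CE g) 0.
  rewrite z0 ComplexField.Normc.normc0; apply: Rintegral_ge0 => w _.
  exact: le_trans (normc_ge0 _) (gh w).
set c := ((normc (CE g))%:C / CE g)%C.
have nz : normc (CE g) != 0 by rewrite normc_eq0.
have nc : normc c = 1.
  rewrite ComplexField.Normc.normcM ComplexField.Normc.normcV normcC.
  by rewrite ger0_norm ?normc_ge0 // mulfV.
have -> : normc (CE g) = Re (CE (fun w => c * g w)).
  by rewrite cexpectationZ // /c mulfVK.
rewrite Re_cexpectation; apply: le_intble => //.
  by have [] := cintbleZ c ig.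
move=> w; apply: le_trans (ler_norm _) _; apply: le_trans (normc_Re _) _.
by rewrite ComplexField.Normc.normcM nc mul1r.
Qed.

Definition cmeas g := measurable_fun [set: T] (fun w => Re (g w)) /\
  measurable_fun [set: T] (fun w => Im (g w)).

Lemma cintble_dom g h : cmeas g -> intble h ->
  (forall w, normc (g w) <= h w) -> cintble g.
Proof.
move=> [m1 m2] ih gh; split; apply: (intble_dom _ ih) => // w.
  exact: le_trans (normc_Re _) (gh w).
exact: le_trans (normc_Im _) (gh w).
Qed.

Lemma cintble_bounded g M : cmeas g -> (forall w, normc (g w) <= M) -> cintble g.
Proof. by move=> mg gM; apply: (cintble_dom mg (intble_cst M)). Qed.

Lemma cmeas_cexp_i f : measurable_fun [set: T] f ->
  cmeas (fun w => cexp ('i * (f w)%:C)%C).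
Proof.
move=> mf; split.
  under eq_fun do rewrite cexp_i /=.
  by apply: measurableT_comp => //; apply: continuous_measurable_fun; exact: continuous_cos.
under eq_fun do rewrite cexp_i /=.
by apply: measurableT_comp => //; apply: continuous_measurable_fun; exact: continuous_sin.
Qed.

Lemma cintble_cexp_i f : measurable_fun [set: T] f ->
  cintble (fun w => cexp ('i * (f w)%:C)%C).
Proof.
move=> mf; apply: (@cintble_bounded _ 1); first exact: cmeas_cexp_i.
by move=> w; rewrite normc_cexp_i.
Qed.

Lemma cmeasM g k : cmeas g -> cmeas k -> cmeas (fun w => g w * k w).
Proof.
move=> [m1 m2] [m3 m4]; split.
  by under eq_fun do rewrite ReM; apply: measurable_funB; exact: measurable_funM.
by under eq_fun do rewrite ImM; apply: measurable_funD; exact: measurable_funM.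
Qed.

End integrable_functions.

(** * Factorization of expectations under independence *)

Section bounded_functions.
Context d' (T' : measurableType d') {R : realType}.

Lemma measurable_approx_simple (h : T' -> R) M e :
  measurable_fun [set: T'] h -> (forall x, `|h x| <= M) -> 0 < e ->
  exists (L : nat) (c : 'I_L -> R) (B : 'I_L -> set T'),
    (forall l, measurable (B l)) /\
    forall x, `|h x - \sum_l c l * \1_(B l) x| <= e.
Proof.
move=> mh hM e0; pose r x := (h x + M) / e.
have r0 x : 0 <= r x.
  apply: divr_ge0; last exact: ltW.
  by have := hM x; rewrite ler_norml; lra.
pose L := (Num.truncn (M *+ 2 / e)).+1.
have rL x : (Num.truncn (r x) < L)%N.
  rewrite ltnS; apply: le_truncn; rewrite ler_wpM2r ?invr_ge0 ?(ltW e0) //.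
  by have := hM x; rewrite ler_norml mulr2n; lra.
exists L, (fun l => l%:R * e - M),
  (fun l : 'I_L => h @^-1` `[(l : nat)%:R * e - M, (l : nat).+1%:R * e - M[%classic).
split=> [l | x].
  by rewrite -[X in measurable X]setTI; apply: mh.
have e_ne0 : e != 0 by rewrite gt_eqF.
have hx : h x = r x * e - M by rewrite /r mulfVK // addrK.
pose l0 : 'I_L := Ordinal (rL x).
rewrite (bigD1 l0) //= big1 ?addr0; last first.
  move=> l ll0; rewrite indicE memNset ?mulr0 //= in_itv /= hx.
  move=> /andP[]; rewrite lerD2r ler_pM2r // ltrD2r ltr_pM2r // => a b.
  move/negP: ll0; apply; apply/eqP/val_inj => /=; apply/esym/eqP.
  by rewrite truncn_eq // a b.
have /andP[a b] : (Num.truncn (r x))%:R <= r x < (Num.truncn (r x)).+1%:R.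
  exact: truncn_itv.
rewrite indicE mem_set ?mulr1; last first.
  by rewrite /= in_itv /= hx lerD2r ler_pM2r // a ltrD2r ltr_pM2r.
rewrite hx /= (_ : _ - _ = (r x - (Num.truncn (r x))%:R) * e); last by ring.
rewrite normrM (gtr0_norm e0).
rewrite ler_piMl ?(ltW e0) // ger0_norm ?subr_ge0 //.
by move: b; rewrite -natr1; lra.
Qed.

(** Bounded measurable functions are obtained from indicators by linear
    combinations and uniform limits. *)
Lemma bounded_measurable_ind (Q : (T' -> R[i]) -> Prop) :
  (forall B, measurable B -> Q (fun x => (\1_B x)%:C%C)) ->
  (forall c g k, cmeas g -> cmeas k -> (exists M, forall x, normc (g x) <= M) ->
     (exists M, forall x, normc (k x) <= M) -> Q g -> Q k ->
     Q (fun x => c * g x + k x)) ->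
  (forall g, cmeas g -> (exists M, forall x, normc (g x) <= M) ->
     (forall e, 0 < e -> exists k, [/\ cmeas k, exists M, forall x, normc (k x) <= M,
       Q k & forall x, normc (g x - k x) <= e]) -> Q g) ->
  forall g M, cmeas g -> (forall x, normc (g x) <= M) -> Q g.
Proof.
move=> Q1 QD Ql.
have c1 B : measurable B -> cmeas (fun x : T' => (\1_B x : R)%:C%C).
  move=> mB; split => /=; last exact: measurable_cst.
  exact: measurable_indic.
have b1 (B : set T') x : normc ((\1_B x : R)%:C%C) <= 1 :> R.
  by rewrite normcC indicE; case: (_ \in _); rewrite ?normr1 ?normr0.
have Q0 : Q (fun=> 0).
  have := Q1 set0 measurable0; congr Q; apply/funext => x.
  by rewrite indicE in_set0.
have cD c g k : cmeas g -> cmeas k -> cmeas (fun x : T' => c * g x + k x :> R[i]).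
  move=> [g1 g2] [k1 k2]; split.
    under eq_fun do rewrite ReD ReM.
    by apply: measurable_funD => //; apply: measurable_funB; apply: measurable_funM.
  under eq_fun do rewrite ImD ImM.
  by apply: measurable_funD => //; apply: measurable_funD; apply: measurable_funM.
have bD c (g k : T' -> R[i]) : (exists M, forall x, normc (g x) <= M) ->
     (exists M, forall x, normc (k x) <= M) ->
     exists M, forall x, normc (c * g x + k x) <= M.
  move=> [M gM] [N kN]; exists (normc c * M + N) => x.
  apply: le_trans (le_normcD _ _) _; apply: lerD _ (kN x).
  by rewrite ComplexField.Normc.normcM ler_wpM2l ?normc_ge0.
have Qs (L : nat) (c : 'I_L -> R) (B : 'I_L -> set T') :
    (forall l, measurable (B l)) ->
    let k := fun x => (\sum_l c l * \1_(B l) x)%:C%C in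
    [/\ cmeas k, exists M, forall x, normc (k x) <= M & Q k].
  move=> mB k.
  have -> : k = fun x => \sum_(l <- enum 'I_L) ((c l)%:C * (\1_(B l) x)%:C)%C.
    apply/funext => x; rewrite /k rmorph_sum big_enum /=.
    by apply: eq_bigr => l _; rewrite rmorphM.
  elim: (enum 'I_L) => [|l s [ck bk Qk]].
    have -> : (fun x : T' => \sum_(l <- [::]) ((c l)%:C * (\1_(B l) x)%:C)%C) = fun=> 0.
      by apply/funext => x; rewrite big_nil.
    split; [by split; exact: measurable_cst | | exact: Q0].
    by exists 0 => x; rewrite big_nil ComplexField.Normc.normc0.
  have -> : (fun x : T' => \sum_(i <- l :: s) ((c i)%:C * (\1_(B i) x)%:C)%C) =
      fun x => ((c l)%:C * (\1_(B l) x)%:C)%C + \sum_(i <- s) ((c i)%:C * (\1_(B i) x)%:C)%C.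
    by apply/funext => x; rewrite big_cons.
  split; first exact: cD (c1 _ (mB l)) ck.
    have [M IHM] := bD (c l)%:C%C _ _ (ex_intro _ 1 (b1 (B l))) bk.
    by exists M => x; rewrite big_cons; exact: IHM.
  by apply: QD => //; [exact: c1 | exists 1 | exact: Q1].
have Qr (h : T' -> R) M : measurable_fun [set: T'] h -> (forall x, `|h x| <= M) ->
    Q (fun x => (h x)%:C%C).
  move=> mh hM; apply: Ql.
  - by split => //=; exact: measurable_cst.
  - by exists M => x; rewrite normcC.
  - move=> e e0; have [L [c [B [mB hB]]]] := measurable_approx_simple mh hM e0.
    have [ck bk Qk] := Qs L c B mB; eexists; split; [exact: ck|exact: bk|exact: Qk|].
    by move=> x; rewrite -rmorphB normcC.
move=> g M [g1 g2] gM.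
have bRe x : `|Re (g x)| <= M by exact: le_trans (normc_Re _) (gM x).
have bIm x : `|Im (g x)| <= M by exact: le_trans (normc_Im _) (gM x).
have -> : g = fun x => ('i * (Im (g x))%:C + (Re (g x))%:C)%C.
  by apply/funext => x; rewrite addrC -complexE.
apply: QD; [| | | |exact: Qr bIm|exact: Qr bRe].
- by split => //=; exact: measurable_cst.
- by split => //=; exact: measurable_cst.
- by exists M => x; rewrite normcC.
- by exists M => x; rewrite normcC.
Qed.

End bounded_functions.

Section independence.
Context d (T : measurableType d) {R : realType} (P : probability T R).
Context d' (T' : measurableType d') (n : nat).
Variable xi : 'I_n -> {RV P >-> T'}.
Hypothesis indep : mutually_independent xi.
Local Notation CE := (cexpectation P).

Let bounded (g : T' -> R[i]) := exists M, forall x, normc (g x) <= M.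

Let cmeas_RV (g : T' -> R[i]) i : cmeas g -> cmeas (fun w => g (xi i w)).
Proof.
by move=> [g1 g2]; split;
  [apply: (measurableT_comp g1) | apply: (measurableT_comp g2)].
Qed.

Let cmeas_prod (r : seq 'I_n) (Q : pred 'I_n) (g : 'I_n -> T' -> R[i]) :
  (forall j, cmeas (g j)) -> cmeas (fun w => \prod_(j <- r | Q j) g j (xi j w)).
Proof.
move=> cg; elim: r => [|j r IH].
  have -> : (fun w => \prod_(j <- [::] | Q j) g j (xi j w)) = fun=> 1.
    by apply/funext => w; rewrite big_nil.
  by split; exact: measurable_cst.
have -> : (fun w => \prod_(i <- j :: r | Q i) g i (xi i w)) =
    fun w => (if Q j then g j (xi j w) else 1) * \prod_(i <- r | Q i) g i (xi i w).
  by apply/funext => w; rewrite big_cons; case: ifP => // _; rewrite mul1r.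
apply: cmeasM => //; case: (Q j); first exact: cmeas_RV.
by split; exact: measurable_cst.
Qed.

Let bounded_prod (r : seq 'I_n) (Q : pred 'I_n) (g : 'I_n -> T' -> R[i]) :
  (forall j, bounded (g j)) ->
  exists M, forall w, normc (\prod_(j <- r | Q j) g j (xi j w)) <= M.
Proof.
move=> bg; elim: r => [|j r [M IH]].
  by exists 1 => w; rewrite big_nil ComplexField.Normc.normc1.
have [N gN] := bg j; exists (if Q j then N * M else M) => w; rewrite big_cons.
case: ifP => // _; rewrite ComplexField.Normc.normcM.
by apply: ler_pM (gN _) (IH w); exact: normc_ge0.
Qed.

(** The factors are replaced one at a time, starting from a product of
    indicators, for which the identity is the definition of independence. *)
Lemma cexpectation_prod (g : 'I_n -> T' -> R[i]) :
  (forall j, cmeas (g j)) -> (forall j, exists M, forall x, normc (g j x) <= M) ->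
  CE (fun w => \prod_j g j (xi j w)) = \prod_j CE (fun w => g j (xi j w)).
Proof.
suff step k : forall g : 'I_n -> T' -> R[i], (forall j, cmeas (g j)) ->
    (forall j, bounded (g j)) ->
    (forall j : 'I_n, (k <= j)%N ->
       exists2 B, measurable B & g j = fun x => (\1_B x)%:C%C) ->
    CE (fun w => \prod_j g j (xi j w)) = \prod_j CE (fun w => g j (xi j w)).
  move=> cg bg; apply: (step n) => // j; rewrite leqNgt ltn_ord.
  by [].
elim: k => [{}g cg bg gB | k IH {}g cg bg gB].
  have /choice[B hB] j : exists B, measurable B /\ g j = fun x => (\1_B x)%:C%C.
    by have [B mB gj] := gB j (leq0n _); exists B.
  have mB j : measurable (B j) by case: (hB j).
  have gE j : g j = fun x => (\1_(B j) x)%:C%C by case: (hB j).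
  have CE1 (A : set T) : measurable A -> CE (fun w => (\1_A w)%:C%C) = (fine (P A))%:C%C.
    move=> mA; apply: complex_ext => /=.
      by rewrite /Rintegral integral_indic // setIT.
    by rewrite Rintegral_cst // mul0r.
  have -> : (fun w => \prod_j g j (xi j w)) =
      fun w => (\1_(\bigcap_(i in [set` [set: 'I_n]%SET]) (xi i @^-1` B i)) w)%:C%C.
    apply/funext => w; rewrite indicE.
    have [wB | wB] := pselect ((\bigcap_(i in [set` [set: 'I_n]%SET]) (xi i @^-1` B i)) w).
      rewrite mem_set // big1 // => j _; rewrite gE indicE mem_set //.
      by apply: wB; rewrite /= inE.
    rewrite memNset //; have [j wj] : exists j, ~ B j (xi j w).
      by apply: contra_notP wB => h j _; apply: contrapT => hj; apply: h; exists j.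
    by rewrite (bigD1 j) //= gE indicE memNset // mul0r.
  have mpre j : measurable (xi j @^-1` B j).
    by rewrite -[X in measurable X]setTI; exact: measurable_funP.
  rewrite CE1; last by apply: fin_bigcap_measurable => // j _; exact: mpre.
  rewrite indep // -[in RHS](eq_bigl _ _ (@finset.in_setT 'I_n)).
  rewrite [in RHS](eq_bigr (fun j => (fine (P (xi j @^-1` B j)))%:C%C)); last first.
    by move=> j _; rewrite gE -CE1.
  rewrite -rmorph_prod; congr (_%:C%C).
  rewrite (eq_bigr (fun j => (fine (P (xi j @^-1` B j)))%:E)); last first.
    by move=> j _; rewrite fineK // fin_num_measure.
  by rewrite -(big_morph EFin (@EFinM R) erefl).
have [kn|kn] := ltnP k n; last first.
  by apply: IH => // j kj; move: (ltn_ord j); rewrite ltnNge (leq_trans kn kj).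
pose k0 := Ordinal kn.
pose upd h j := if j == k0 then h else g j.
pose W w := \prod_(j | j != k0) g j (xi j w).
pose c := \prod_(j | j != k0) CE (fun w => g j (xi j w)).
have updE h w : \prod_j upd h j (xi j w) = h (xi k0 w) * W w.
  rewrite (bigD1 k0) //= /upd eqxx; congr (_ * _).
  by apply: eq_bigr => j /negbTE ->.
have updCE h : \prod_j CE (fun w => upd h j (xi j w)) = CE (fun w => h (xi k0 w)) * c.
  rewrite (bigD1 k0) //= /upd eqxx; congr (_ * _).
  by apply: eq_bigr => j /negbTE ->.
have cW : cmeas W by exact: cmeas_prod.
have [N WN] : exists N, forall w, normc (W w) <= N by exact: bounded_prod.
have N0 : 0 <= N.
  have [w _] : [set: T] !=set0.
    apply/set0P/negP => /eqP T0; have := probability_setT P.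
    by rewrite T0 measure0 => /eqP; rewrite eq_sym onee_eq0.
  exact: le_trans (normc_ge0 _) (WN w).
have iW h : cmeas h -> bounded h -> cintble P (fun w => h (xi k0 w) * W w).
  move=> ch [M hM]; apply: (@cintble_bounded _ _ _ _ _ (M * N)).
    by apply: cmeasM => //; exact: cmeas_RV.
  move=> w; rewrite ComplexField.Normc.normcM.
  by apply: ler_pM (hM _) (WN w); exact: normc_ge0.
have ih h : cmeas h -> bounded h -> cintble P (fun w => h (xi k0 w)).
  move=> ch [M hM]; apply: (@cintble_bounded _ _ _ _ _ M) => //.
  exact: cmeas_RV.
suff Q h M : cmeas h -> (forall x, normc (h x) <= M) ->
    CE (fun w => h (xi k0 w) * W w) = CE (fun w => h (xi k0 w)) * c.
  have [M gM] := bg k0; have := Q _ M (cg k0) gM; rewrite -updCE.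
  have -> : upd (g k0) = g by apply/funext => j; rewrite /upd; case: eqP => // ->.
  move=> <-; apply: eq_cexpectation => w.
  by rewrite -updE /upd; apply: eq_bigr => j _; case: eqP => // ->.
move: h M; apply: (@bounded_measurable_ind _ T' R
  (fun h => CE (fun w => h (xi k0 w) * W w) = CE (fun w => h (xi k0 w)) * c)).
- move=> B mB; pose h1 := fun x : T' => (\1_B x : R)%:C%C.
  rewrite -[LHS]/(CE (fun w => h1 (xi k0 w) * W w)).
  rewrite -[RHS]/(CE (fun w => h1 (xi k0 w)) * c) -updCE.
  rewrite -(eq_cexpectation P (updE h1)).
  apply: IH => j; rewrite /upd.
  + case: eqP => // _; split => /=; last exact: measurable_cst.
    exact: measurable_indic.
  + case: eqP => // _; exists 1 => x.
    by rewrite normcC indicE; case: (_ \in _); rewrite ?normr1 ?normr0.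
  + move=> kj; case: eqP => [_|jk]; first by exists B.
    apply: gB; rewrite ltn_neqAle kj andbT; apply/eqP => kjE.
    by apply: jk; apply/val_inj.
- move=> a h1 h2 c1 c2 b1 b2 Q1 Q2.
  have -> : (fun w => (a * h1 (xi k0 w) + h2 (xi k0 w)) * W w) =
      fun w => a * (h1 (xi k0 w) * W w) + h2 (xi k0 w) * W w.
    by apply/funext => w; rewrite mulrDl mulrA.
  rewrite cexpectationD ?cexpectationZ ?Q1 ?Q2 //; try exact: iW.
    rewrite cexpectationD ?cexpectationZ //; try exact: ih.
      by rewrite mulrDl mulrA.
    by apply: cintbleZ; exact: ih.
  by apply: cintbleZ; exact: iW.
- move=> h ch bh happ; apply/eqP; rewrite -subr_eq0 -normc_eq0 eq_le normc_ge0 andbT.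
  apply/ler_addgt0Pr => e e0; rewrite add0r.
  set K := N + normc c + 1.
  have K0 : 0 < K by rewrite /K; have := normc_ge0 c; lra.
  have [k' [ck bk Qk hk]] := happ (e / K) (divr_gt0 e0 K0).
  have -> : CE (fun w => h (xi k0 w) * W w) - CE (fun w => h (xi k0 w)) * c =
      CE (fun w => (h (xi k0 w) - k' (xi k0 w)) * W w) -
      CE (fun w => h (xi k0 w) - k' (xi k0 w)) * c.
    rewrite (cexpectationB (ih _ ch bh) (ih _ ck bk)).
    under [in RHS]eq_cexpectation do rewrite mulrBl.
    rewrite (cexpectationB (iW _ ch bh) (iW _ ck bk)) Qk; ring.
  have idiff : cintble P (fun w => h (xi k0 w) - k' (xi k0 w)).
    by apply: cintbleB; exact: ih.
  have idiffW : cintble P (fun w => (h (xi k0 w) - k' (xi k0 w)) * W w).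
    under eq_fun do rewrite mulrBl.
    by apply: cintbleB; exact: iW.
  have eK0 : 0 <= e / K by rewrite divr_ge0 ?(ltW e0) ?(ltW K0).
  have n1 := normc_cexpectation_le idiffW (intble_cst P (e / K * N)).
  have n2 := normc_cexpectation_le idiff (intble_cst P (e / K)).
  rewrite !Rintegral_prob_cst in n1 n2.
  apply: le_trans (le_normcD _ _) _; rewrite normcN ComplexField.Normc.normcM.
  apply: (@le_trans _ _ (e / K * N + e / K * normc c)).
    apply: lerD; last by apply: ler_wpM2r (n2 _) => //; exact: normc_ge0.
    apply: n1 => w; rewrite ComplexField.Normc.normcM.
    by apply: ler_pM (hk _) (WN w); exact: normc_ge0.
  have -> : e = e / K * K by rewrite mulfVK // gt_eqF.
  by rewrite mulfK ?gt_eqF // -mulrDr ler_wpM2l // /K lerDl ler01.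
Qed.

End independence.

(** * The covariance seminorm on the dual *)

Lemma exists_harmonic_lt (R : realType) (e : R) : 0 < e ->
  exists N : nat, forall n, (N <= n)%N -> n.+1%:R^-1 < e.
Proof.
move=> e0.
have /cvgrPdist_lt/(_ e e0)[N _ hN] := @cvg_harmonic R.
exists N => n Nn; have := hN n Nn.
by rewrite /= sub0r normrN ger0_norm // invr_ge0.
Qed.

Section norm_complete.
Context {R : realType} {X : completeNormedModType R}.

Lemma cauchy_of_functionals (u : nat -> X) (c : R) :
  (forall n k (g : dual X),
     `|g (u n) - g (u k)| <= c * (n.+1%:R^-1 + k.+1%:R^-1) * `|g|) ->
  exists x, forall (g : dual X) e, 0 < e -> exists N, forall n, (N <= n)%N ->
    `|g (u n) - g x| < e.
Proof.
move=> hu; pose C := `|c| + 1.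
have C0 : 0 < C by rewrite ltr_wpDl.
have uu n k : `|u n - u k| <= C * (n.+1%:R^-1 + k.+1%:R^-1).
  apply: norm_le_functionals => g g1; rewrite linearB /=.
  apply: le_trans (ler_norm _) _; apply: le_trans (hu n k g) _.
  have p0 : 0 <= n.+1%:R^-1 + k.+1%:R^-1 :> R by rewrite addr_ge0 ?invr_ge0.
  apply: le_trans (_ : C * (n.+1%:R^-1 + k.+1%:R^-1) * `|g| <= _).
    rewrite ler_wpM2r // ler_wpM2r // /C.
    by have := ler_norm c; lra.
  by rewrite ler_piMr // mulr_ge0 // ltW.
have : cvg (u @ \oo).
  apply: cauchy_cvg; apply: cauchy_exP => e e0.
  have [N hN] := exists_harmonic_lt (divr_gt0 e0 (mulr_gt0 C0 (ltr0n R 2))).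
  exists (u N); exists N => // n Nn; rewrite -ball_normE /=.
  apply: le_lt_trans (uu N n) _.
  have := hN N (leqnn N); have := hN n Nn.
  have C2 : 0 < C * 2 by rewrite mulr_gt0.
  rewrite !ltr_pdivlMr //; set a := n.+1%:R^-1; set b := N.+1%:R^-1; lra.
move=> /cvg_ex[x ux]; exists x => g e e0.
have gux : (g (u n)) @[n --> \oo] --> (g x : R^o).
  by apply: continuous_cvg => //; exact: dual_continuous.
move/cvgrPdist_lt: gux => /(_ e e0)[N _ hN].
by exists N => n Nn; rewrite distrC; exact: hN.
Qed.

(** A functional on the dual which is norm-approximable by evaluations is an
    evaluation. *)
Lemma evaluation_closed (F : dual X -> R) :
  (forall e, 0 < e -> exists u : X, forall g, `|F g - g u| <= e * `|g|) ->
  exists x : X, forall g, F g = g x.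
Proof.
move=> hF.
have /choice[u hu] n : exists u : X, forall g, `|F g - g u| <= n.+1%:R^-1 * `|g|.
  by apply: hF; rewrite invr_gt0.
have [|x hx] := @cauchy_of_functionals u 1.
  move=> n k g; rewrite mul1r mulrDl.
  have -> : g (u n) - g (u k) = (F g - g (u k)) - (F g - g (u n)) by ring.
  by apply: le_trans (ler_normB _ _) _; rewrite addrC; apply: lerD.
exists x => g; apply/eqP; rewrite -subr_eq0 -normr_le0.
apply/ler_addgt0Pr => e e0; rewrite add0r.
have e2 : 0 < e / 2 by rewrite divr_gt0.
have [N1 h1] := hx g _ e2.
have G0 : 0 < `|g| + 1 by rewrite ltr_wpDl.
have [N2 h2] := exists_harmonic_lt (divr_gt0 e2 G0).
pose N := maxn N1 N2.
have := h1 N (leq_maxl _ _); have := h2 N (leq_maxr _ _); have := hu N g.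
rewrite ltr_pdivlMr // => a b c.
have -> : F g - g x = (F g - g (u N)) + (g (u N) - g x) by ring.
apply: le_trans (ler_normD _ _) _.
have : 0 < N.+1%:R^-1 :> R by rewrite invr_gt0.
move: a b; set k := N.+1%:R^-1; rewrite mulrDr mulr1; lra.
Qed.

Section density.
Variable q : dual X -> dual X -> R.
Hypothesis qC : forall f g, q f g = q g f.
Hypothesis qD : forall a f g h, q (a *: f + g) h = a * q f h + q g h.
Hypothesis q_ge0 : forall f, 0 <= q f f.
Hypothesis q_le : forall f, q f f <= `|f| ^+ 2.
Hypothesis q_rep : forall f, exists x : X, forall g, q f g = g x.

Lemma sqr_le_discriminant (a b c : R) : 0 <= b ->
  (forall t, 0 <= c - t * a *+ 2 + t ^+ 2 * b) -> a ^+ 2 <= c * b.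
Proof.
move=> b0 h; have [b_0|bn0] := eqVneq b 0.
  have [->|a0] := eqVneq a 0; first by rewrite b_0 expr0n /= mulr0.
  have := h ((c + 1) / a); rewrite b_0 mulr0 addr0 divfK // mulr2n.
  by have := h 0; rewrite !mul0r mul0rn expr0n /= mul0r; lra.
have bp : 0 < b by rewrite lt_neqAle eq_sym bn0.
have := h (a / b); rewrite -(pmulr_lge0 _ bp).
have -> : (c - a / b * a *+ 2 + (a / b) ^+ 2 * b) * b = c * b - a ^+ 2.
  by field.
by rewrite subr_ge0.
Qed.

Let qDr a f g h : q h (a *: f + g) = a * q h f + q h g.
Proof. by rewrite qC qD !(qC _ h). Qed.

Let q_sub f g t : q (f - t *: g) (f - t *: g) =
  q f f - t * q f g *+ 2 + t ^+ 2 * q g g.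
Proof.
have -> : f - t *: g = (- t) *: g + f by rewrite scaleNr addrC.
by rewrite qD !qDr (qC g f); ring.
Qed.

Let CS f g : q f g ^+ 2 <= q f f * q g g.
Proof. by apply: sqr_le_discriminant => // t; rewrite -q_sub. Qed.

(** If [q] is represented by a map from the dual to the space, then total
    subspaces are dense for [q]: the residues of a minimizing sequence have
    representatives converging in the space, and totality forces the limit to
    vanish. *)
Lemma total_dense (E : set (dual X)) : E 0 ->
  (forall a e e', E e -> E e' -> E (a *: e + e')) -> total E ->
  forall f e, 0 < e -> exists2 g, E g & q (f - g) (f - g) < e.
Proof.
move=> E0 EZD totE f e e0.
pose S := [set q (f - g) (f - g) | g in E].
have hiS : has_inf S.
  by split; [exists (q (f - 0) (f - 0)), 0 | exists 0 => _ [g _ <-]].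
pose D := inf S.
have D_le g : E g -> D <= q (f - g) (f - g).
  by move=> Eg; apply: ge_inf; [case: hiS | exists g].
have D0 : 0 <= D by apply: lb_le_inf; [case: hiS | move=> _ [g _ <-]].
have Dinf d : 0 < d -> exists2 g, E g & q (f - g) (f - g) < D + d.
  by move=> d0; have [_ [g Eg <-] h] := inf_adherent d0 hiS; exists g.
have [De|eD] := ltP D e.
  have [|g Eg] := Dinf (e - D); first by rewrite subr_gt0.
  by rewrite (_ : D + (e - D) = e); [move=> ge; exists g | ring].
have Dp : 0 < D by exact: lt_le_trans e0 eD.
pose h n : R := n.+1%:R^-1.
have h0 n : 0 < h n by rewrite invr_gt0.
have /choice[s hs] n : exists g, E g /\ q (f - g) (f - g) < D + h n ^+ 2.
  by have [|g Eg gD] := Dinf (h n ^+ 2); [exact: exprn_gt0 | exists g].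
pose r n := f - s n.
(* Minimality of the distance makes the residues almost orthogonal to [E]. *)
have Es n : E (s n) by case: (hs n).
have small n g : E g -> q (r n) g ^+ 2 <= h n ^+ 2 * q g g.
  move=> Eg; apply: sqr_le_discriminant => // t.
  have := D_le (t *: g + s n) (EZD _ _ _ Eg (Es n)).
  have -> : f - (t *: g + s n) = r n - t *: g by rewrite /r opprD addrA addrAC.
  by rewrite q_sub; have := (hs n).2; rewrite -/(r n); lra.
have /choice[b hb] n : exists x : X, forall g, q (r n) g = g x by exact: q_rep.
have bb n k (g : dual X) : `|g (b n) - g (b k)| <= 2 * (n.+1%:R^-1 + k.+1%:R^-1) * `|g|.
  rewrite -!hb -/(h n) -/(h k).
  pose v := s k - s n.
  have Ev : E v.
    by rewrite /v addrC -scaleN1r; exact: EZD.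
  have rv z : q (r n) z - q (r k) z = q v z.
    have -> : v = (-1) *: r k + r n.
      by rewrite /v /r scaleN1r opprB addrA subrK.
    by rewrite qD; ring.
  have hn := h0 n; have hk := h0 k; have qv := q_ge0 v.
  have s1 : q v v <= (2 * (h n + h k)) ^+ 2.
    have [->|qn0] := eqVneq (q v v) 0; first exact: sqr_ge0.
    have qp : 0 < q v v by rewrite lt_neqAle eq_sym qn0.
    have a1 := small n v Ev; have a2 := small k v Ev; have := rv v.
    set A := q (r n) v in a1 *; set B := q (r k) v in a2 * => AB.
    have : q v v ^+ 2 <= 2 * (h n ^+ 2 + h k ^+ 2) * q v v.
      by rewrite -[in X in X <= _]AB; have := sqr_ge0 (A + B); nra.
    rewrite expr2 ler_pM2r // => /le_trans; apply.
    by rewrite exprMn; nra.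
  rewrite rv -[leLHS]ger0_norm // -(ler_pXn2r (n := 2)) ?nnegrE //; last first.
    by rewrite !mulr_ge0 // addr_ge0 // ltW.
  rewrite normr_id real_normK ?num_real // exprMn.
  apply: le_trans (CS v g) _; apply: ler_pM => //.
have [x hx] := cauchy_of_functionals bb.
have x0 : x = 0.
  apply: totE => g Eg; apply/eqP; rewrite -normr_le0.
  apply/ler_addgt0Pr => d d0; rewrite add0r.
  have d2 : 0 < d / 2 by rewrite divr_gt0.
  have [N1 h1] := hx g _ d2.
  have G0 : 0 < q g g + 1 by rewrite ltr_wpDl.
  have [N2 h2] := exists_harmonic_lt (divr_gt0 d2 G0).
  pose N := maxn N1 N2.
  have := h1 N (leq_maxl _ _); have := h2 N (leq_maxr _ _).
  rewrite -hb ltr_pdivlMr // -/(h N) => a c.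
  have : `|q (r N) g| <= h N * (q g g + 1).
    rewrite -(ler_pXn2r (n := 2)) ?nnegrE //; last first.
      by rewrite mulr_ge0 // ltW.
    rewrite real_normK ?num_real // exprMn; apply: le_trans (small N g Eg) _.
    rewrite ler_wpM2l ?sqr_ge0 //; have := q_ge0 g; nra.
  have -> : g x = q (r N) g - (q (r N) g - g x) by ring.
  by move=> k; apply: le_trans (ler_normB _ _) _; lra.
(* The same almost orthogonality bounds [q (r n) (s n)], so that [q (r n) f]
   stays close to [q (r n) (r n)], which is at least [D]. *)
have rf n : `|q (r n) (s n)| <= h n * (q f f *+ 4 + D *+ 4 + 5).
  have qs : q (s n) (s n) <= q f f *+ 2 + (D + h n ^+ 2) *+ 2.
    have := q_sub f (r n) 1; rewrite scale1r.
    have -> : f - r n = s n by rewrite /r opprB addrC subrK.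
    have := (hs n).2; rewrite -/(r n) => rn.
    have := q_sub f (r n) (-1); rewrite scaleN1r opprK expr1n sqrrN expr1n.
    have := q_ge0 (f + r n); rewrite !mulr2n; lra.
  have h1 : h n <= 1 by rewrite invf_le1 // ler1n.
  have K0 : 0 <= q f f *+ 4 + D *+ 4 + 5 :> R.
    by rewrite !addr_ge0 // mulrn_wge0.
  rewrite -(ler_pXn2r (n := 2)) ?nnegrE //; last by rewrite mulr_ge0 // ltW.
  rewrite real_normK ?num_real // exprMn; apply: le_trans (small n _ (Es n)) _.
  rewrite ler_wpM2l ?sqr_ge0 //; apply: le_trans qs _.
  have hh : h n ^+ 2 <= 1 by rewrite expr_le1 // ltW.
  have := q_ge0 f; set z := q f f => z0.
  rewrite !mulrS !mulr0n !addr0; nra.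
exfalso.
have [N1 h1] := hx f _ (divr_gt0 Dp (ltr0n R 2)).
have K0 : 0 < q f f *+ 4 + D *+ 4 + 5 :> R.
  by rewrite ltr_wpDl // addr_ge0 // mulrn_wge0.
have [N2 h2] := exists_harmonic_lt (divr_gt0 (divr_gt0 Dp (ltr0n R 2)) K0).
pose N := maxn N1 N2.
have := h1 N (leq_maxl _ _); have := h2 N (leq_maxr _ _).
rewrite -hb ltr_pdivlMr // -/(h N) x0 linear0 subr0 => a c.
have := rf N; have := D_le _ (Es N); rewrite -/(r N).
have -> : q (r N) (r N) = q (r N) f - q (r N) (s N).
  have {2}-> : r N = (-1) *: s N + f by rewrite /r scaleN1r addrC.
  by rewrite qDr; ring.
move: c; have := ler_norm (q (r N) f); have := ler_norm (- q (r N) (s N)).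
by rewrite normrN; lra.
Qed.

End density.
End norm_complete.

Lemma measurable_borel_continuous (R : realType) (X : normedModType R) (g : X -> R) :
  continuous g -> measurable_fun [set: borel X] (g : borel X -> R).
Proof.
move=> cg; apply: (measurability (@RGenOInfty.G R)).
  exact: RGenOInfty.measurableE.
move=> _ [_ [a ->] <-]; apply: sub_sigma_algebra.
have -> : [set: borel X] `&` g @^-1` `]a, +oo[%classic = g @^-1` [set y | a < y].
  by rewrite setTI; apply/seteqP; split=> x /=; rewrite in_itv /= andbT.
by apply: open_comp; [move=> x _; exact: cg | exact: open_gt].
Qed.

Section random_element.
Context d (T : measurableType d) {R : realType} (P : probability T R).
Context {X : completeNormedModType R}.
Variable xi : {RV P >-> borel X}.
Implicit Types f g h : dual X.

Lemma measurable_RV_continuous (g : X -> R) : continuous g ->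
  measurable_fun [set: T] (fun w => g (xi w)).
Proof.
by move=> cg; apply: (measurableT_comp (measurable_borel_continuous cg)).
Qed.

Lemma measurable_RV_dual f : measurable_fun [set: T] (fun w => f (xi w)).
Proof. exact/measurable_RV_continuous/dual_continuous. Qed.

Lemma measurable_RV_ge (g : X -> R) a : continuous g ->
  measurable [set w | a <= g (xi w)].
Proof.
move=> cg; have -> : [set w | a <= g (xi w)] =
    [set: T] `&` (fun w => g (xi w)) @^-1` `[a, +oo[%classic.
  by rewrite setTI; apply/seteqP; split=> w /=; rewrite in_itv /= andbT.
by apply: measurable_RV_continuous => //; exact: measurable_itv.
Qed.

Let den w : R := (1 + `|(xi w : X)|)^-1.

Let den_gt0 w : 0 < 1 + `|(xi w : X)|. Proof. by rewrite ltr_wpDr. Qed.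

(** Damping by the norm makes the form bounded without any moment
    assumption. *)
Definition damped f (w : T) : R := f (xi w) / (1 + `|(xi w : X)|).

Lemma measurable_den : measurable_fun [set: T] den.
Proof.
apply: (@measurable_RV_continuous (fun x => (1 + `|x|)^-1)) => x.
apply: cvgV; first by rewrite gt_eqF // ltr_wpDr.
by apply: cvgD; [exact: cvg_cst | exact: norm_continuous].
Qed.

Lemma measurable_damped f : measurable_fun [set: T] (damped f).
Proof. by apply: measurable_funM; [exact: measurable_RV_dual | exact: measurable_den]. Qed.

Lemma damped_le f w : `|damped f w| <= `|f|.
Proof.
rewrite /damped normrM normfV [X in _ / X]gtr0_norm ?den_gt0 //.
rewrite ler_pdivrMr ?den_gt0 //; apply: le_trans (dual_normP f _) _.
by apply: ler_wpM2l; [exact: dual_norm_ge0 | rewrite lerDr].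
Qed.

Definition covariance f g : R := \int[P]_w (damped f w * damped g w).

Let intble_cov f g : intble P (fun w => damped f w * damped g w).
Proof.
apply: (@intble_bounded _ _ _ _ _ (`|f| * `|g|)).
  by apply: measurable_funM; exact: measurable_damped.
by move=> w; rewrite normrM; apply: ler_pM => //; exact: damped_le.
Qed.

Lemma covarianceC f g : covariance f g = covariance g f.
Proof. by apply: eq_Rintegral => w _; rewrite mulrC. Qed.

Lemma covarianceD a f g h :
  covariance (a *: f + g) h = a * covariance f h + covariance g h.
Proof.
rewrite -RintegralZl //; last exact: intble_cov.
rewrite -RintegralD //; try exact: intble_cov; last exact/intbleZ/intble_cov.
apply: eq_Rintegral => w _; rewrite /damped dualD dualZ; ring.
Qed.

Lemma covariance_ge0 f : 0 <= covariance f f.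
Proof. by apply: Rintegral_ge0 => w _; rewrite -expr2 sqr_ge0. Qed.

Lemma covariance_add_le f g :
  covariance (f + g) (f + g) <= 2 * covariance f f + 2 * covariance g g.
Proof.
have e h : covariance (f + g) h = covariance f h + covariance g h.
  by rewrite -{1}[f]scale1r covarianceD mul1r.
have h1 : covariance (f + g) (f + g) =
    covariance f f + 2 * covariance f g + covariance g g.
  rewrite e (covarianceC f) (covarianceC g) !e (covarianceC g f); ring.
have h2 : covariance ((-1) *: f + g) ((-1) *: f + g) =
    covariance f f - 2 * covariance f g + covariance g g.
  rewrite covarianceD (covarianceC f) (covarianceC g).
  rewrite (covarianceD _ _ _ f) (covarianceD _ _ _ g).
  rewrite (covarianceC g f); ring.
have := covariance_ge0 ((-1) *: f + g); rewrite h1 h2 {e h1 h2}.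
move: (covariance f f) (covariance f g) (covariance g g) => a b c; lra.
Qed.

Lemma covariance_le f : covariance f f <= `|f| ^+ 2.
Proof.
rewrite -(Rintegral_prob_cst P (`|f| ^+ 2)); apply: le_intble.
- exact: intble_cov.
- exact: intble_cst.
- move=> w; rewrite -expr2 -real_normK ?num_real // ler_pXn2r ?nnegrE //.
  exact: damped_le.
Qed.

Lemma probability_vanish (F : nat -> set T) : (forall n, measurable (F n)) ->
  (forall n, F n.+1 `<=` F n) -> \bigcap_n F n = set0 ->
  forall e, 0 < e -> exists N, fine (P (F N)) < e.
Proof.
move=> mF FS F0 e e0.
have : (P \o F) x @[x --> \oo] --> P (\bigcap_n F n).
  apply: nonincreasing_cvg_mu => //.
  - by apply: le_lt_trans (probability_le1 P (mF 0%N)) _; exact: ltry.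
  - by rewrite F0.
  - by apply/nonincreasing_seqP => n; apply/subsetPset; exact: FS.
rewrite F0 measure0 => /fine_cvgP[_] /cvgrPdist_lt/(_ e e0)[N _ hN].
exists N; have := hN N (leqnn N); rewrite /= sub0r normrN.
by apply: le_lt_trans; exact: ler_norm.
Qed.

Let Rint_indic (A : set T) : measurable A -> \int[P]_w (\1_A w : R) = fine (P A).
Proof. by move=> mA; rewrite /Rintegral integral_indic // setIT. Qed.

(** Outside the event where [xi] is large the difference of the exponentials is
    controlled by [f xi - g xi], hence by a multiple of its damped version, whose
    first moment is bounded by the second one. *)
Lemma covariance_charfun e : 0 < e -> exists2 del, 0 < del &
  forall f g, covariance (f - g) (f - g) < del ->
  normc (charfun P xi f - charfun P xi g) <= e.
Proof.
move=> e0.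
pose F (n : nat) := [set w : T | n%:R <= `|(xi w : X)|].
have mF n : measurable (F n).
  by apply: (@measurable_RV_ge (fun x => `|x|)); exact: norm_continuous.
have [|||M FM] := @probability_vanish F mF _ _ (e / 8).
- by move=> n w; apply: le_trans; rewrite ler_nat.
- rewrite -subset0 => w wF; have := wF (Num.truncn `|(xi w : X)|).+1 I.
  rewrite /F /= leNgt; apply/negP/negPn.
  by have /andP[] := truncn_itv (normr_ge0 (xi w : X)).
- by rewrite divr_gt0.
pose C : R := 1 + M%:R.
have C0 : 0 < C by rewrite ltr_wpDr.
pose s := e / (8 * C).
have s0 : 0 < s by rewrite divr_gt0 // mulr_gt0.
exists (s ^+ 2); first exact: exprn_gt0.
move=> f g fg.
have lip (a b : R) :
    normc (cexp ('i * a%:C)%C - cexp ('i * b%:C)%C) <= 2 * `|a - b|.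
  have lipf (u u' : R -> R) : (forall x : R, is_derive x (1 : R) u (u' x)) ->
      (forall x, `|u' x| <= 1) -> `|u a - u b| <= `|a - b|.
    move=> du u1; wlog ab : / b <= a.
      move=> wl; have [/wl //|/ltW ba] := leP b a.
      rewrite distrC (distrC a b).
      have cu : {within `[a, b], continuous u}.
        apply: continuous_subspaceT => x; apply: differentiable_continuous.
        by apply/derivable1_diffP; have [] := du x.
      have [c _ ->] := MVT_segment ba (fun x _ => du x) cu.
      by rewrite normrM ler_piMl.
    have cu : {within `[b, a], continuous u}.
      apply: continuous_subspaceT => x; apply: differentiable_continuous.
      by apply/derivable1_diffP; have [] := du x.
    have [c _ ->] := MVT_segment ab (fun x _ => du x) cu.
    by rewrite normrM ler_piMl.
  apply: le_trans (normc_le_ReIm _) _; rewrite !cexp_i /= mulr2n mulrDl !mul1r.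
  apply: lerD.
    apply: (lipf _ (fun x => - sin x)) => x; rewrite ?normrN ?sin_max //.
    by apply: (lipf _ cos) => x; rewrite ?cos_max.
have mi h := measurable_RV_dual h.
rewrite /charfun -cexpectationB; try exact: cintble_cexp_i.
pose k := f - g.
pose B w := 2 * \1_(F M) w + 2 * C * (s + (damped k w * damped k w) / s) : R.
have iB : intble P B.
  apply: intbleD.
    by apply: intbleZ; apply: (@intble_bounded _ _ _ _ _ 1) => [|w];
      [exact: measurable_indic
      | rewrite indicE; case: (_ \in _); rewrite ?normr1 ?normr0].
  apply: intbleZ; apply: intbleD; first exact: intble_cst.
  by under eq_fun do rewrite mulrC; apply: intbleZ; exact: intble_cov.
apply: (@le_trans _ _ (\int[P]_w B w)).
  apply: normc_cexpectation_le => //.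
    by apply: cintbleB; exact: cintble_cexp_i.
  move=> w; rewrite /B indicE.
  have sq0 : 0 <= damped k w * damped k w by rewrite -expr2 sqr_ge0.
  have [wF|wF] := boolP (w \in F M).
    apply: (@le_trans _ _ 2).
      apply: le_trans (le_normcD _ _) _.
      by rewrite normcN !normc_cexp_i.
    by rewrite mulr1 lerDl !mulr_ge0 ?addr_ge0 ?(ltW s0) ?(ltW C0) // divr_ge0 // ltW.
  rewrite mulr0 add0r; apply: le_trans (lip _ _) _.
  rewrite -mulrA ler_wpM2l //.
  have -> : f (xi w) - g (xi w) = (1 + `|(xi w : X)|) * damped k w.
    by rewrite /damped mulrC divfK ?gt_eqF ?den_gt0 // /k.
  rewrite normrM gtr0_norm ?den_gt0 //; apply: ler_pM => //.
    rewrite lerD2l ltW // ltNge; apply: contra wF => wF; exact: mem_set.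
  set z := damped k w.
  have -> : s + z * z / s = (s ^+ 2 + `|z| ^+ 2) / s.
    by rewrite real_normK ?num_real // mulrDl expr2 mulfK ?gt_eqF // expr2.
  rewrite ler_pdivlMr //; have := sqr_ge0 (s - `|z|); have := normr_ge0 z; nra.
have -> : \int[P]_w B w = 2 * fine (P (F M)) + 2 * C * (s + covariance k k / s).
  rewrite /B.
  have i1 : intble P (fun w => \1_(F M) w : R).
    by apply: (@intble_bounded _ _ _ _ _ 1) => [|w];
      [exact: measurable_indic
      | rewrite indicE; case: (_ \in _); rewrite ?normr1 ?normr0].
  have i2 : intble P (fun w => (damped k w * damped k w) / s).
    by under eq_fun do rewrite mulrC; apply: intbleZ; exact: intble_cov.
  rewrite RintegralD //; first last.
  - by apply: intbleZ; apply: intbleD => //; exact: intble_cst.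
  - exact: intbleZ.
  congr (_ + _).
    by rewrite RintegralZl //; congr (_ * _); exact: Rint_indic.
  rewrite RintegralZl //; last by apply: intbleD => //; exact: intble_cst.
  congr (_ * _); rewrite RintegralD //; last exact: intble_cst.
  congr (_ + _); first exact: Rintegral_prob_cst.
  by rewrite RintegralZr //; exact: intble_cov.
have c1 : covariance k k / s <= s by rewrite ler_pdivrMr // -expr2 ltW.
have e8 : C * s = e / 8 by rewrite /s; field; rewrite gt_eqF.
rewrite mulrDr -!mulrA e8.
have : C * (covariance k k / s) <= e / 8 by rewrite -e8 ler_wpM2l // ltW.
move: FM; set p := fine _; set z := C * _; lra.
Qed.

(** The representative is the barycenter of a bounded multiple of [xi]: up to a
    small event, [xi] is uniformly close to a simple random element. *)
Lemma covariance_rep f : separable X -> exists x : X, forall g, covariance f g = g x.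
Proof.
move=> [D cD dD].
have [u hu] : exists u : nat -> X, forall y e, 0 < e -> exists k, `|y - u k| < e.
  have [j ij] := countable_injP D cD.
  have /choice[u hu] k : exists y : X, forall z, D z -> j z = k -> y = z.
    have [[z Dz jz]|nz] := pselect (exists2 z, D z & j z = k).
      by exists z => z' Dz' jz'; apply: ij; rewrite ?inE // jz jz'.
    by exists 0 => z Dz jz; case: nz; exists z.
  exists u => y e e0.
  have [||z [yz Dz]] := dD (ball y e).
  - by exists y; exact: ballxx.
  - exact: ball_open.
  - exists (j z); rewrite (hu (j z) z Dz erefl).
    by move: yz; rewrite -ball_normE.
pose c w := damped f w * den w.
have mc : measurable_fun [set: T] c.
  by apply: measurable_funM; [exact: measurable_damped | exact: measurable_den].
have den_le1 w : den w <= 1 by rewrite invf_le1 ?den_gt0 // lerDl.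
have den0 w : 0 <= den w by rewrite invr_ge0 ltW ?den_gt0.
have cf w : `|c w| <= `|f|.
  rewrite /c normrM (ger0_norm (den0 w)) -[leRHS]mulr1.
  by apply: ler_pM => //; exact: damped_le.
have cov g : covariance f g = \int[P]_w (c w * g (xi w)).
  by apply: eq_Rintegral => w _; rewrite /c /damped /den; ring.
apply: evaluation_closed => e e0.
pose a := e / (2 * (`|f| + 1)).
have f1 : 0 < `|f| + 1 by rewrite ltr_wpDl.
have a0 : 0 < a by rewrite divr_gt0 // mulr_gt0.
pose F (K : nat) := [set w : T | forall k, (k < K)%N -> a <= `|(xi w : X) - u k|].
have mball k : measurable [set w : T | a <= `|(xi w : X) - u k|].
  apply: (@measurable_RV_ge (fun x => `|x - u k|)).
  by move=> x; apply: cvg_norm; apply: cvgB; [exact: cvg_id | exact: cvg_cst].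
have FS K : F K.+1 = F K `&` [set w | a <= `|(xi w : X) - u K|].
  apply/seteqP; split=> [w wF | w [wF wK] k].
    by split=> [k kK|]; apply: wF => //; exact: ltnW.
  by rewrite ltnS leq_eqVlt => /predU1P[-> //|]; exact: wF.
have mF K : measurable (F K).
  elim: K => [|K IH]; last by rewrite FS; exact: measurableI.
  by have -> : F 0%N = setT by apply/seteqP; split.
have [|||K FK] := @probability_vanish F mF _ _ a.
- by move=> K; rewrite FS => w [].
- rewrite -subset0 => w wF; have [k] := hu (xi w) a a0.
  by rewrite ltNge (wF k.+1 I).
- exact: a0.
(* [A k] is the event that [u k] is the first point at distance less than [a]
   from [xi]; off [F K] the simple random element [s K] picks that point. *)
pose A k := F k `\` F k.+1.
have mA k : measurable (A k) by exact: measurableD.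
pose s K' w : X := \sum_(k < K') (\1_(A k) w : R) *: u k.
have sP K' w : (w \in F K' -> s K' w = 0) /\
    (w \notin F K' -> `|(xi w : X) - s K' w| <= a).
  elim: K' => [|K' [IH1 IH2]].
    by rewrite /s big_ord0; split=> // /negP[]; rewrite inE.
  have sS : s K'.+1 w = s K' w + (\1_(A K') w : R) *: u K' by rewrite /s big_ord_recr.
  have AE : (w \in A K') = (w \in F K') && (w \notin F K'.+1).
    by rewrite /A in_setD.
  rewrite sS indicE AE; split=> wF.
    rewrite wF andbF scale0r addr0; apply: IH1.
    by move: wF; rewrite !inE FS => -[].
  rewrite wF andbT; have [wK|wK] := boolP (w \in F K').
    rewrite IH1 // scale1r add0r ltW // ltNge; apply: contra wF => aK.
    by move: wK; rewrite !inE FS.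
  by rewrite scale0r addr0; exact: IH2.
pose W k := \int[P]_w (c w * \1_(A k) w).
have i1 k : intble P (fun w => c w * \1_(A k) w).
  apply: (@intble_bounded _ _ _ _ _ `|f|).
    by apply: measurable_funM => //; exact: measurable_indic.
  move=> w; rewrite normrM indicE -[leRHS]mulr1; apply: ler_pM => //.
  by case: (_ \in _); rewrite ?normr1 ?normr0.
exists (\sum_(k < K) W k *: u k) => g.
have gs w : g (s K w) = \sum_(k < K) \1_(A k) w * g (u k).
  by rewrite linear_sum; apply: eq_bigr => k _; rewrite linearZ.
have igs : intble P (fun w => c w * g (s K w)).
  have : intble P (fun w => \sum_(k <- enum 'I_K) g (u k) * (c w * \1_(A k) w)).
    elim: (enum 'I_K) => [|k l IH].
      by have := intble_cst P 0; congr (intble _ _); apply/funext => w; rewrite big_nil.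
    have := intbleD (intbleZ (g (u k)) (i1 k)) IH.
    by congr (intble _ _); apply/funext => w; rewrite big_cons.
  congr (intble _ _); apply/funext => w; rewrite gs mulr_sumr big_enum /=.
  by apply: eq_bigr => k _; ring.
have -> : g (\sum_(k < K) W k *: u k) = \int[P]_w (c w * g (s K w)).
  rewrite linear_sum /=; under eq_bigr do rewrite linearZ /=.
  have -> : (fun w => c w * g (s K w)) =
      fun w => \sum_(k <- enum 'I_K) g (u k) * (c w * \1_(A k) w).
    apply/funext => w; rewrite gs mulr_sumr big_enum /=.
    by apply: eq_bigr => k _; ring.
  rewrite (_ : \sum_(k < K) _ = \sum_(k <- enum 'I_K) W k * g (u k)); last first.
    by rewrite big_enum.
  have : forall l : seq 'I_K,
     (\sum_(k <- l) W k * g (u k) =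
       \int[P]_w (\sum_(k <- l) g (u k) * (c w * \1_(A k) w))) /\
     intble P (fun w => \sum_(k <- l) g (u k) * (c w * \1_(A k) w)).
    elim=> [|k l [IH1 IH2]].
      have -> : (fun w => \sum_(k <- ([::] : seq 'I_K)) g (u k) * (c w * \1_(A k) w)) =
          cst 0.
        by apply/funext => w; rewrite big_nil.
      by rewrite big_nil Rintegral_prob_cst; split=> //; exact: intble_cst.
    have -> : (fun w => \sum_(i <- k :: l) g (u i) * (c w * \1_(A i) w)) =
       (fun w => g (u k) * (c w * \1_(A k) w) +
          \sum_(i <- l) g (u i) * (c w * \1_(A i) w)).
      by apply/funext => w; rewrite big_cons.
    split; last by apply: intbleD => //; exact: intbleZ.
    rewrite big_cons RintegralD //; last exact: intbleZ.
    rewrite RintegralZl //; last exact: i1.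
    by rewrite -IH1 [in LHS]mulrC.
  by move=> /(_ (enum 'I_K))[].
have icg : intble P (fun w => c w * g (xi w)).
  have := intble_cov f g; congr (intble _ _); apply/funext => w.
  by rewrite /c /damped /den; ring.
rewrite cov -RintegralB //.
apply: le_trans (le_normr_Rintegral _ _) _ => //; first exact: intbleB.
pose B w : R := `|f| * `|g| * (a + \1_(F K) w).
have iF : intble P (fun w => \1_(F K) w : R).
  by apply: (@intble_bounded _ _ _ _ _ 1) => [|w];
      [exact: measurable_indic
      | rewrite indicE; case: (_ \in _); rewrite ?normr1 ?normr0].
have iB : intble P B by apply: intbleZ; apply: intbleD => //; exact: intble_cst.
apply: (@le_trans _ _ (\int[P]_w B w)).
  apply: le_intble => //; first exact/integrable_norm/intbleB.
  move=> w; rewrite -mulrBr -linearB /= /B -mulrA normrM.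
  have [sF sNF] := sP K w; rewrite indicE; have [wF|wF] := boolP (w \in F K).
    rewrite sF // subr0.
    have -> : `|c w| * `|g (xi w)| = `|damped f w| * `|damped g w|.
      rewrite /c normrM [X in _ = _ * X]normrM !(ger0_norm (den0 w)).
      by rewrite mulrAC mulrA.
    apply: ler_pM => //; first exact: damped_le.
    by apply: le_trans (damped_le g w) _; rewrite ler_peMr // lerDr ltW.
  rewrite addr0; apply: ler_pM => //; apply: le_trans (dual_normP g _) _.
  by apply: ler_wpM2l; [exact: dual_norm_ge0 | exact: sNF].
rewrite /B RintegralZl //; last by apply: intbleD => //; exact: intble_cst.
have -> : \int[P]_w (a + \1_(F K) w) = a + fine (P (F K)).
  rewrite RintegralD //; last exact: intble_cst.
  by congr (_ + _); [exact: Rintegral_prob_cst | exact: Rint_indic].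
rewrite mulrAC ler_wpM2r //.
have : `|f| * (a + fine (P (F K))) <= (`|f| + 1) * (a * 2).
  have p0 : 0 <= fine (P (F K)) by exact: fine_ge0.
  have := normr_ge0 f; move: FK p0; set p := fine _; set n := `|f|; nra.
move=> /le_trans; apply; rewrite le_eqVlt; apply/orP; left; apply/eqP.
by rewrite /a; field; rewrite gt_eqF.
Qed.

Lemma total_covariance_dense (E : set (dual X)) : separable X -> E 0 ->
  (forall a e e', E e -> E e' -> E (a *: e + e')) -> total E ->
  forall f e, 0 < e -> exists2 g, E g & covariance (f - g) (f - g) < e.
Proof.
move=> sX; apply: total_dense.
- exact: covarianceC.
- exact: covarianceD.
- exact: covariance_ge0.
- exact: covariance_le.
- by move=> f; exact: covariance_rep.
Qed.

End random_element.

(** * Iterated multiplicative differences *)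

Section multiplicative_differences.
Context {K : fieldType} {V W : zmodType}.
Implicit Types (F G : V -> K) (H : seq V).

(** The exponential of the iterated difference of a logarithm, which needs no
    choice of a logarithm. *)
Fixpoint mdiff {V : zmodType} (H : seq V) (F : V -> K) (g : V) : K :=
  if H is h :: H' then mdiff H' F (g + h) / mdiff H' F g else F g.

Lemma eq_mdiff F G H g : F =1 G -> mdiff H F g = mdiff H G g.
Proof. by move=> FG; elim: H g => [|h H IH] g /=; rewrite ?FG ?IH. Qed.

Lemma mdiffM F G H g :
  mdiff H (fun v => F v * G v) g = mdiff H F g * mdiff H G g.
Proof. by elim: H g => [|h H IH] g //=; rewrite !IH invfM mulrACA. Qed.

Lemma mdiff1 H g : mdiff H (fun _ : V => 1 : K) g = 1.
Proof. by elim: H g => [|h H IH] g //=; rewrite !IH divr1. Qed.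

Lemma mdiff_prod (I : Type) (r : seq I) (Q : pred I) (F : I -> V -> K) H g :
  mdiff H (fun v => \prod_(i <- r | Q i) F i v) g =
  \prod_(i <- r | Q i) mdiff H (F i) g.
Proof.
elim: r => [|i r IH].
  by rewrite big_nil; apply: etrans (mdiff1 H g); apply: eq_mdiff => v; rewrite big_nil.
rewrite big_cons -IH -[in RHS](mulr1 (mdiff H (F i) g)).
transitivity (mdiff H (fun v => (if Q i then F i v else 1) *
   \prod_(i <- r | Q i) F i v) g).
  by apply: eq_mdiff => v; rewrite big_cons; case: ifP => // _; rewrite mul1r.
by rewrite mdiffM; case: ifP => // _; rewrite ?mulr1 // mdiff1 mul1r.
Qed.

Lemma mdiff_comp (J : {additive V -> W}) (F : W -> K) H g :
  mdiff H (fun v => F (J v)) g = mdiff (map J H) F (J g).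
Proof. by elim: H g => [|h H IH] g //=; rewrite !IH raddfD. Qed.

Lemma mdiff_neq0 F H g : (forall v, F v != 0) -> mdiff H F g != 0.
Proof.
by move=> F0; elim: H g => [|h H IH] g //=; rewrite mulf_neq0 // invr_neq0.
Qed.

Lemma mdiff_shift F H h g : mdiff H F (g + h) = mdiff H (fun v => F (v + h)) g.
Proof. by elim: H g => [|k H IH] g //=; rewrite -IH addrAC IH. Qed.

(** The step along which [F] is invariant may occur anywhere among the steps,
    because the shifts commute. *)
Lemma mdiff_invariant F H h g : (forall v, F v != 0) -> h \in H ->
  (forall v, F (v + h) = F v) -> mdiff H F g = 1.
Proof.
move=> F0 + Fh; elim: H g => [//|k H IH] g; rewrite inE => /predU1P[<- /=|hH /=].
  by rewrite mdiff_shift (eq_mdiff _ _ Fh) divff // mdiff_neq0.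
by rewrite !IH // divr1.
Qed.

End multiplicative_differences.

Section density_extension.
Context {K : numFieldType} {V : zmodType}.
Variable cv : (nat -> V) -> V -> Prop.
Hypothesis cvD : forall u v a b, cv u a -> cv v b -> cv (fun n => u n + v n) (a + b).
Variable F : V -> K.
Hypothesis F0 : forall v, F v != 0.
Hypothesis cF : forall u a, cv u a -> F (u n) @[n --> \oo] --> F a.

Lemma mdiff_cvg (I : Type) (s : seq I) (u : I -> nat -> V) (h : I -> V) w g :
  (forall k, cv (u k) (h k)) -> cv w g ->
  mdiff [seq u k n | k <- s] F (w n) @[n --> \oo] --> mdiff [seq h k | k <- s] F g.
Proof.
move=> uh; elim: s w g => [|k s IH] w g wg /=; first exact: cF.
apply: cvgM; first by apply: IH; exact: cvD.
by apply: cvgV; [exact: mdiff_neq0 | exact: IH].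
Qed.

Definition seq_dense (E : set V) :=
  forall a, exists2 u : nat -> V, forall n, E (u n) & cv u a.

(** Only sequential continuity for an abstract additive notion of convergence is
    used, so that it can be instantiated with a topology weaker than that of the
    norm. *)
Lemma mdiff_eq1_dense (I : Type) (s : seq I) (E : I -> set V) (E0 : set V) :
  (forall k, seq_dense (E k)) -> seq_dense E0 ->
  (forall h : I -> V, (forall k, E k (h k)) -> forall g, E0 g ->
     mdiff [seq h k | k <- s] F g = 1) ->
  forall (h : I -> V) g, mdiff [seq h k | k <- s] F g = 1.
Proof.
move=> dE dE0 F1 h g.
have /choice[u hu] k : exists u : nat -> V, (forall n, E k (u n)) /\ cv u (h k).
  by have [u uE uh] := dE k (h k); exists u.
have [w wE wg] := dE0 g.
have uh k : cv (u k) (h k) by case: (hu k).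
have := @mdiff_cvg _ s _ _ _ _ uh wg.
have -> : (fun n => mdiff [seq u k n | k <- s] F (w n)) = cst 1.
  apply/funext => n; apply: (F1 (fun k => u k n)) => // k.
  by case: (hu k).
move=> c1; apply/esym; apply: (cvg_unique _ _ c1) => //.
exact: cvg_cst.
Qed.

End density_extension.

(** * Elimination of all but one random element *)

Section elimination.
Context (R : realType) (X : completeNormedModType R) (n m : nat).
Variable A : 'I_m -> 'I_n -> {linear X -> X}.
Hypothesis cA : forall p j, continuous (A p j).
Context d (T : measurableType d) (P : probability T R).
Variable xi : 'I_n -> {RV P >-> borel X}.

Lemma charfun_linear_forms (f : 'rV[dual X]_m) : mutually_independent xi ->
  charfun_vec P (fun w => \row_(p < m) \sum_(j < n) A p j (xi j w)) f =
  \prod_j charfun P (xi j) (adjoint_form cA j (fun p => f ord0 p)).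
Proof.
move=> indep; pose a j := adjoint_form cA j (fun p => f ord0 p).
pose g j (x : borel X) := cexp ('i * (a j x)%:C)%C.
rewrite -[RHS](@cexpectation_prod _ _ _ _ _ _ _ xi indep g).
- apply: eq_cexpectation => w; rewrite -cexp_sum; congr cexp.
  rewrite -mulr_sumr -rmorph_sum; congr (_ * _%:C)%C.
  under eq_bigr do rewrite mxE linear_sum.
  rewrite exchange_big /=; apply: eq_bigr => j _.
  by rewrite /a adjoint_formE.
- move=> j; apply: cmeas_cexp_i; apply: measurable_borel_continuous.
  exact: dual_continuous.
- by move=> j; exists 1 => x; rewrite normc_cexp_i.
Qed.

Hypothesis X_separable : separable X.

Definition cov_cvg (i : 'I_n) (u : nat -> dual X) (a : dual X) :=
  forall e, 0 < e -> exists N, forall k, (N <= k)%N ->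
    covariance (xi i) (u k - a) (u k - a) < e.

Lemma cov_cvgD i u v a b : cov_cvg i u a -> cov_cvg i v b ->
  cov_cvg i (fun n => u n + v n) (a + b).
Proof.
move=> ua vb e e0; have e4 : 0 < e / 4 by rewrite divr_gt0.
have [N1 h1] := ua _ e4; have [N2 h2] := vb _ e4.
exists (maxn N1 N2) => k; rewrite geq_max => /andP[/h1 {}h1 /h2 {}h2].
rewrite opprD addrACA; move: (u k - a) (v k - b) h1 h2 => y z h1 h2.
apply: le_lt_trans (covariance_add_le (xi i) y z) _; lra.
Qed.

Lemma charfun_cov_cvg i u a : cov_cvg i u a ->
  charfun P (xi i) (u k) @[k --> \oo] --> (charfun P (xi i) a : R[i]^o).
Proof.
move=> ua; apply/(@cvgrPdist_le _ R[i]^o) => e; rewrite ltcE => /andP[/eqP e1 e2].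
have [del del0 hdel] := covariance_charfun (xi i) e2.
have [N hN] := ua _ del0.
exists N => // k /= Nk; rewrite distrC normr_normc.
rewrite lecE e1 /= eqxx /=.
by apply: hdel; exact: hN.
Qed.

Lemma seq_dense_total i (E : set (dual X)) : E 0 ->
  (forall a e e', E e -> E e' -> E (a *: e + e')) -> total E ->
  seq_dense (cov_cvg i) E.
Proof.
move=> E0 EZD tE a.
have /choice[u hu] k : exists g, E g /\ covariance (xi i) (a - g) (a - g) < k.+1%:R^-1.
  have [|g Eg h] := total_covariance_dense (xi i) X_separable E0 EZD tE a (e := k.+1%:R^-1).
    by rewrite invr_gt0.
  by exists g.
exists u => [k|e e0]; first by case: (hu k).
have [N hN] := exists_harmonic_lt e0.
exists N => k Nk; have [_ h] := hu k; apply: lt_trans (hN k Nk).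
have -> // : covariance (xi i) (u k - a) (u k - a) =
          covariance (xi i) (a - u k) (a - u k).
rewrite -opprB; move: (a - u k) => z; rewrite /covariance; apply: eq_Rintegral => w _.
rewrite /damped; have -> : (- z) (xi i w) = - z (xi i w) by [].
by ring.
Qed.

Hypothesis A_ker : forall p j, A p j @^-1` [set 0] = [set 0].
Hypothesis m_gt1 : (1 < m)%N.
Hypothesis G_closure : forall i j : 'I_n, i != j ->
    closure [set (\row_p A p i x : 'rV[X]_m) | x in [set: X]] `&`
    closure [set (\row_p A p j x : 'rV[X]_m) | x in [set: X]] = [set 0].
Hypothesis indep : mutually_independent xi.
Hypothesis xi_neq0 : forall (i : 'I_n) (f : dual X), charfun P (xi i) f != 0.
Hypothesis L_class_D : class_D P m.-1
    (fun w => \row_(p < m) \sum_(j < n) A p j (xi j w)).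

Lemma exists_missing (s : m.-1.-tuple 'I_m) : exists p, p \notin s.
Proof.
apply/existsP; rewrite -negb_forall; apply/negP => /forallP h.
have := uniq_leq_size (enum_uniq 'I_m) (fun p _ => h p).
by rewrite size_enum_ord size_tuple; case: m m_gt1 => // k _; rewrite ltnn.
Qed.

Definition single p (a : dual X) : 'I_m -> dual X := fun q => if q == p then a else 0.

Lemma adjoint_form_single i p a : adjoint_form cA i (single p a) = adjoint (@cA p i) a.
Proof.
rewrite /adjoint_form (bigD1 p) //= /single eqxx big1 ?addr0 // => q /negbTE ->.
by rewrite linear0.
Qed.

(** Shifting the [p]-th argument alone annihilates the factors of the
    factorization that miss [p]; shifting along the kernel of the [j]-th adjoint
    annihilates the [j]-th characteristic functional. Each of these shifts acts
    on the [i]-th one through a total subspace. *)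
Lemma mdiff_charfun i : exists (M : nat), forall H : seq (dual X), size H = M ->
  forall g, mdiff H (charfun P (xi i)) g = 1.
Proof.
have m0 : (0 < m)%N by exact: ltnW.
pose p0 : 'I_m := Ordinal m0.
pose J j := adjoint_form cA j.
pose E (k : 'I_m + 'I_n) : set (dual X) := match k with
  | inl p => range (adjoint (@cA p i))
  | inr j => if j == i then range (J i) else [set J i h | h in [set h | J j h = 0]]
  end.
pose s : seq ('I_m + 'I_n) :=
  [seq inl p | p <- enum 'I_m] ++ [seq inr j | j <- enum 'I_n & j != i].
have range0 (W : lmodType R) (F : {linear W -> dual X}) : range F 0.
  by exists 0; rewrite ?linear0.
have rangeZD (W : lmodType R) (F : {linear W -> dual X}) a e e' :
    range F e -> range F e' -> range F (a *: e + e').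
  by move=> [x _ <-] [y _ <-]; exists (a *: x + y); rewrite ?linearP.
have dE0 : seq_dense (cov_cvg i) (range (J i)).
  apply: seq_dense_total; [exact: range0 | exact: rangeZD|].
  move=> x hx; have tr := @total_range_adjoint _ _ _ (@cA p0 i) (@A_ker p0 i).
  apply: (tr x) => _ [a _ <-].
  by apply: hx; exists (single p0 a) => //; exact: adjoint_form_single.
have dE k : seq_dense (cov_cvg i) (E k).
  case: k => [p|j] /=.
    apply: seq_dense_total; [exact: range0 | exact: rangeZD|].
    exact: total_range_adjoint.
  case: eqP => [_ //|/eqP ji].
  apply: seq_dense_total.
  - by exists 0; rewrite /= /J linear0.
  - move=> a _ _ [x /= x0 <-] [y /= y0 <-]; exists (a *: x + y) => /=; last first.
      by rewrite /J linearP.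
    have -> : J j (a *: x + y) = a *: J j x + J j y by rewrite /J linearP.
    by rewrite x0 y0 scaler0 addr0.
  - apply: total_adjoint_ker => //; apply: G_closure; by rewrite eq_sym.
have key : forall h, (forall k, E k (h k)) -> forall g, range (J i) g ->
    mdiff [seq h k | k <- s] (charfun P (xi i)) g = 1.
  move=> h hE _ [x _ <-].
  have /choice[v hv] k : exists v, J i v = h k /\ match k with
     | inl p => forall q, q != p -> v q = 0
     | inr j => j != i -> J j v = 0 end.
    have := hE k; case: k => [p|j] /=.
      move=> [a _ <-]; exists (single p a); split; first exact: adjoint_form_single.
      by move=> q /negbTE; rewrite /single => ->.
    by case: eqP => [_ [v _ vh]|_ [v v0 vh]]; exists v.
  have hJ : [seq h k | k <- s] = map (J i) [seq v k | k <- s].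
    by rewrite -map_comp; apply: eq_map => k /=; have [-> _] := hv k.
  set H := [seq v k | k <- s].
  rewrite hJ -/H /J -(mdiff_comp (adjoint_form cA i) (charfun P (xi i))).
  have [Rf [_ _ RfE]] := L_class_D.
  pose phi j (y : 'I_m -> dual X) := charfun P (xi j) (adjoint_form cA j y).
  pose rho (t : m.-1.-tuple 'I_m) (y : 'I_m -> dual X) : R[i] :=
    Rf t (\row_(l < m.-1) y (tnth t l)).
  have phiE y : \prod_j phi j y =
      \prod_(t : m.-1.-tuple 'I_m | sorted ltn (map val t)) rho t y.
    have := RfE (\row_p y p); rewrite charfun_linear_forms //.
    under eq_bigr => j _.
      have -> : (fun p => (\row_p0 y p0) ord0 p) = y by apply/funext => p; rewrite mxE.
      over.
    move=> ->; apply: eq_bigr => t _; rewrite /rho; congr (Rf t _).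
    by apply/rowP => l; rewrite !mxE.
  have rho0 (t : m.-1.-tuple 'I_m) y : sorted ltn (map val t) -> rho t y != 0.
    move=> st; have : \prod_j phi j y != 0.
      by apply/prodf_neq0 => j _; exact: xi_neq0.
    by rewrite phiE => /prodf_neq0/(_ t st).
  have : \prod_j mdiff H (phi j) x = 1.
    rewrite -mdiff_prod (eq_mdiff H x phiE) mdiff_prod big1 // => t st.
    have [p pt] := exists_missing t.
    apply: (@mdiff_invariant _ _ _ _ (v (inl p))).
    - by move=> y; exact: rho0.
    - by apply: map_f; rewrite mem_cat map_f // mem_enum.
    - move=> y; rewrite /rho; congr (Rf t _); apply/rowP => l; rewrite !mxE.
      have [_ vp] := hv (inl p).
      rewrite -[RHS]addr0 -(vp (tnth t l)) //.
      by apply: contraNneq pt => <-; exact: mem_tnth.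
  rewrite (bigD1 i) //= big1 ?mulr1 // => j ji.
  apply: (@mdiff_invariant _ _ _ _ (v (inr j))).
  - by move=> y; exact: xi_neq0.
  - apply: map_f; rewrite mem_cat; apply/orP; right; apply: map_f.
    by rewrite mem_filter ji mem_enum.
  - move=> y; rewrite /phi; congr (charfun _ _ _).
    rewrite [adjoint_form _ _ _]linearD /=.
    by have [_ /(_ ji)] := hv (inr j); rewrite /J => ->; rewrite addr0.
have s_uniq : uniq s.
  rewrite cat_uniq; apply/and3P; split.
  - by rewrite map_inj_uniq ?enum_uniq // => ? ? [].
  - by apply/hasPn => _ /mapP[j _ ->]; apply/negP => /mapP[].
  - rewrite map_inj_uniq => [|? ? [] //].
    by apply: filter_uniq; exact: enum_uniq.
exists (size s) => H sH g.
have -> : H = [seq nth 0 H (index k s) | k <- s].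
  apply: (@eq_from_nth _ 0); first by rewrite size_map.
  move=> l lH; rewrite (nth_map (inl p0)) ?index_uniq -?sH //.
exact: (@mdiff_eq1_dense _ _ (cov_cvg i) (@cov_cvgD i) _ (xi_neq0 i)
  (@charfun_cov_cvg i) _ s E _ dE dE0 key).
Qed.

End elimination.

(** * Continuous functions with trivial multiplicative differences *)

Section additive_differences.
Context {R : realType}.
Implicit Types (g : R -> R) (p : {poly R}).

Fixpoint adiff (M : nat) (h : R) g (t : R) : R :=
  if M is M'.+1 then adiff M' h g (t + h) - adiff M' h g t else g t.

Lemma adiffB M h g (k : R -> R) t :
  adiff M h (fun s => g s - k s) t = adiff M h g t - adiff M h k t.
Proof. by elim: M t => [//|M IH] t /=; rewrite !IH; ring. Qed.

Lemma adiffS M h g t : adiff M.+1 h g t = adiff M h (fun s => g (s + h) - g s) t.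
Proof.
rewrite adiffB /=; congr (_ - _).
by elim: M t => [//|M IH] t /=; rewrite !IH.
Qed.

Lemma size_poly_difference p (c : R) :
  (size (p \Po ('X + c%:P) - p)%R <= (size p).-1)%N.
Proof.
elim/poly_ind: p => [|p a IH]; first by rewrite comp_poly0 subr0 size_poly0.
have [->|p0] := eqVneq p 0.
  by rewrite mul0r add0r comp_polyC subrr size_poly0.
rewrite size_MXaddC (negbTE p0) /= comp_polyD comp_polyM comp_polyX comp_polyC.
have -> : (p \Po ('X + c%:P)) * ('X + c%:P) + a%:P - (p * 'X + a%:P) =
    (p \Po ('X + c%:P) - p) * 'X + c *: (p \Po ('X + c%:P)).
  by rewrite -mul_polyC; ring.
apply: leq_trans (size_polyD _ _) _; rewrite geq_max; apply/andP; split.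
  have [->|d0] := eqVneq (p \Po ('X + c%:P) - p) 0; first by rewrite mul0r size_poly0.
  rewrite size_mulX //; apply: leq_ltn_trans IH _.
  by rewrite prednK // lt0n size_poly_eq0.
by apply: leq_trans (size_scale_leq _ _) _; rewrite size_comp_poly2 // size_XaddC.
Qed.

Lemma adiff_poly M p h t : (size p <= M)%N -> adiff M h (horner p) t = 0.
Proof.
elim: M p t => [|M IH] p t sp.
  by move: sp; rewrite leqn0 size_poly_eq0 => /eqP -> /=; rewrite horner0.
rewrite adiffS.
have -> : (fun s => p.[s + h] - p.[s]) = horner (p \Po ('X + h%:P) - p).
  apply/funext => s; rewrite hornerD hornerN horner_comp.
  by rewrite hornerD hornerX hornerC.
apply: IH; apply: leq_trans (size_poly_difference _ _) _.
by case: (size p) sp.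
Qed.

(** All terms of the difference but the last one vanish; this is the recurrence
    that propagates zeros along an arithmetic progression. *)
Lemma adiff_last M h g t : (forall j, (j < M)%N -> g (t + j%:R * h) = 0) ->
  adiff M h g t = g (t + M%:R * h).
Proof.
elim: M t => [|M IH] t h0 /=; first by rewrite mul0r addr0.
rewrite !IH => [|j jM|j jM].
- by rewrite h0 // subr0 -natr1 mulrDl mul1r addrA addrAC.
- by apply: h0; exact: ltnW.
- have -> : t + h + j%:R * h = t + j.+1%:R * h by rewrite -natr1; ring.
  exact: h0.
Qed.

Lemma adiff_le M h g t c : (forall j, (j <= M)%N -> `|g (t + j%:R * h)| <= c) ->
  `|adiff M h g t| <= 2 ^+ M * c.
Proof.
elim: M t => [|M IH] t gc /=.
  by have := gc 0%N isT; rewrite mul0r addr0 expr0 mul1r.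
rewrite exprS -mulrA mulr2n mulrDl mul1r; apply: le_trans (ler_normB _ _) _.
apply: lerD; apply: IH => j jM; last by apply: gc; exact: leqW.
have -> : t + h + j%:R * h = t + j.+1%:R * h by rewrite -natr1; ring.
exact: gc.
Qed.

Lemma poly_interpolation M (x y : nat -> R) :
  (forall i j, (i < M)%N -> (j < M)%N -> x i = x j -> i = j) ->
  exists2 p : {poly R}, (size p <= M)%N & forall j, (j < M)%N -> p.[x j] = y j.
Proof.
elim: M => [|M IH] xinj; first by exists 0; rewrite ?size_poly0.
have [|p sp py] := IH.
  by move=> i j iM jM; apply: xinj; exact: ltnW.
pose q : {poly R} := \prod_(j < M) ('X - (x j)%:P).
have qM : q.[x M] != 0.
  rewrite horner_prod; apply/prodf_neq0 => j _; rewrite hornerXsubC subr_eq0.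
  apply/eqP => xM; have := xinj M j (ltnSn M) (ltnW (ltn_ord j)) xM.
  by move=> /eqP; rewrite eq_sym ltn_eqF.
exists (p + ((y M - p.[x M]) / q.[x M]) *: q).
  apply: leq_trans (size_polyD _ _) _; rewrite geq_max (leqW sp) /=.
  apply: leq_trans (size_scale_leq _ _) _.
  by rewrite size_prod_XsubC /index_enum -enumT size_enum_ord.
move=> j; rewrite ltnS leq_eqVlt hornerD hornerZ => /predU1P[-> | jM].
  by rewrite divfK // addrC subrK.
have -> : q.[x j] = 0.
  by rewrite horner_prod (bigD1 (Ordinal jM)) //= hornerXsubC subrr mul0r.
by rewrite py // mulr0 addr0.
Qed.

Lemma poly_eq_on_points M (p q : {poly R}) (x : nat -> R) :
  (forall i j, (i < M)%N -> (j < M)%N -> x i = x j -> i = j) ->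
  (size p <= M)%N -> (size q <= M)%N -> (forall j, (j < M)%N -> p.[x j] = q.[x j]) ->
  p = q.
Proof.
move=> xinj sp sq pq; apply/eqP; rewrite -subr_eq0; apply/negP => /negP d0.
have : (size [seq x j | j <- iota 0 M] < size (p - q)%R)%N.
  apply: max_poly_roots => //.
    apply/allP => z /mapP[j]; rewrite mem_iota add0n => /andP[_ jM] ->.
    by rewrite rootE hornerD hornerN pq // subrr.
  rewrite map_inj_in_uniq ?iota_uniq // => i j; rewrite !mem_iota !add0n /=.
  exact: xinj.
rewrite size_map size_iota ltnNge.
by rewrite (leq_trans (size_polyD _ _)) // size_polyN geq_max sp sq.
Qed.

(** On every mesh the function is the restriction of a polynomial; meshes
    refining a common one give the same polynomial, and continuity fills in the
    remaining points. *)
Lemma adiff_eq0_poly M (g : R -> R) del : 0 < del ->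
  (forall t, 0 <= t <= del -> {for t, continuous g}) ->
  (forall t h, 0 <= t -> 0 < h -> t + M%:R * h <= del -> adiff M h g t = 0) ->
  exists2 p : {poly R}, (size p <= M)%N & forall t, 0 <= t <= del -> g t = p.[t].
Proof.
move=> d0 cg gM.
(* The mesh of index [0] has at least [M] points in the segment and is contained
   in all the others. *)
pose step K : R := del / (M.+1%:R * K.+1%:R).
have s0 K : 0 < step K by rewrite divr_gt0 // mulr_gt0.
have inj K i j : (i < M)%N -> (j < M)%N -> i%:R * step K = j%:R * step K -> i = j.
  have sn0 : step K != 0 by rewrite gt_eqF.
  by move=> _ _ /(mulIf sn0)/eqP; rewrite eqr_nat => /eqP.
have mesh K p : (size p <= M)%N -> (forall j, (j < M)%N -> p.[j%:R * step K] = g (j%:R * step K)) ->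
    forall k, k%:R * step K <= del -> g (k%:R * step K) = p.[k%:R * step K].
  move=> sp pg; elim/ltn_ind => k IH kd.
  have [kM|Mk] := ltnP k M; first by rewrite pg.
  pose t := (k - M)%:R * step K.
  have tj j : t + j%:R * step K = (k - M + j)%:R * step K by rewrite natrD mulrDl.
  have tk : t + M%:R * step K = k%:R * step K by rewrite tj subnK.
  have t0 : 0 <= t by apply: mulr_ge0 => //; exact/ltW/s0.
  have := gM t (step K) t0 (s0 K); rewrite tk => /(_ kd) gt.
  apply/eqP; rewrite -subr_eq0 -tk.
  rewrite -(@adiff_last M (step K) (fun s => g s - p.[s])).
    by rewrite adiffB gt (@adiff_poly M p) // subr0.
  move=> j jM; have jk : (k - M + j < k)%N by lia.
  rewrite tj IH ?subrr //; apply: le_trans kd.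
  by rewrite ler_wpM2r ?(ltW (s0 K)) // ler_nat ltnW.
have /choice[p hp] K : exists p : {poly R}, (size p <= M)%N /\
    forall j, (j < M)%N -> p.[j%:R * step K] = g (j%:R * step K).
  have [p sp pg] := @poly_interpolation M (fun j => j%:R * step K)
     (fun j => g (j%:R * step K)) (inj K).
  by exists p.
have pK K : p K = p 0%N.
  have [sK gK] := hp K; have [sp0 g0] := hp 0%N.
  apply: (@poly_eq_on_points M _ _ (fun j => j%:R * step 0%N) (inj 0%N)) => // j jM.
  rewrite g0 //; have e : j%:R * step 0%N = (j * K.+1)%:R * step K.
    by rewrite /step natrM; field; rewrite !nat1r !pnatr_eq0.
  rewrite e -(mesh K (p K)) // -e /step mulrA ler_pdivrMr ?mulr_gt0 //.
  have jM1 : j%:R <= M.+1%:R :> R by rewrite ler_nat; lia.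
  by rewrite [1%:R]/(1 : R) mulr1 mulrC ler_wpM2l // ltW.
exists (p 0%N) => [|t /andP[t0 td]]; first by case: (hp 0%N).
apply/eqP; rewrite -subr_eq0 -normr_le0; apply/ler_addgt0Pr => e e0; rewrite add0r.
have cf : {for t, continuous (fun s => g s - (p 0%N).[s])}.
  by apply: cvgB; [apply: cg; rewrite t0 td | exact: continuous_horner].
have /cvgrPdist_le/(_ e e0)/nbhs_ballP[r /= r0 hr] := cf.
have [K hK] : exists K, step K < r.
  have [K hK] := exists_harmonic_lt (divr_gt0 r0 d0).
  exists K; have := hK K (leqnn K); rewrite ltr_pdivlMr // => hr'.
  apply: le_lt_trans hr'; rewrite /step mulrC ler_wpM2r ?(ltW d0) //.
  by rewrite lef_pV2 ?posrE ?mulr_gt0 // ler_peMl // ler1n.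
pose k := Num.truncn (t / step K).
have /andP[k1 k2] : k%:R <= t / step K < k.+1%:R.
  by apply: truncn_itv; rewrite divr_ge0 // ltW.
rewrite ler_pdivlMr // in k1; rewrite ltr_pdivrMr // -natr1 mulrDl mul1r in k2.
have := hr (k%:R * step K); rewrite -ball_normE /= ger0_norm ?subr_ge0 //.
move=> /(_ _)/wrap[]; first by lra.
have [sK gK] := hp K.
by rewrite (mesh K (p K)) // ?pK ?subrr ?subr0 //; exact: le_trans td.
Qed.

End additive_differences.

Section local_logarithm.
Context {R : realType}.
Implicit Types (u w : R -> R[i]) (z : R[i]).

(** The principal logarithm on the open right half-plane. *)
Definition clog z : R[i] := (ln (normc z) +i* atan (Im z / Re z))%C.

Lemma cexp_clog z : 0 < Re z -> cexp (clog z) = z.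
Proof.
move=> z0; pose s := Im z / Re z.
have rt0 : 0 < Num.sqrt (1 + s ^+ 2) by rewrite sqrtr_gt0 ltr_pwDl // sqr_ge0.
have nz : normc z = Re z * Num.sqrt (1 + s ^+ 2).
  have -> : normc z = Num.sqrt (Re z ^+ 2 + Im z ^+ 2) by case: (z).
  have -> : Re z ^+ 2 + Im z ^+ 2 = Re z ^+ 2 * (1 + s ^+ 2).
    by rewrite /s; field; rewrite gt_eqF.
  by rewrite sqrtrM ?sqr_ge0 // sqrtr_sqr gtr0_norm.
have nz0 : 0 < normc z by rewrite nz mulr_gt0.
have ca : cos (atan s) != 0 by rewrite cos_atan invr_neq0 // gt_eqF.
have sa : sin (atan s) = s * cos (atan s) by rewrite -{2}[s]atanK /tan divfK.
rewrite cexpE /= lnK ?posrE // -/s sa cos_atan nz.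
apply: complex_ext => /=; first by rewrite mulfK // gt_eqF.
by rewrite /s; field; rewrite !gt_eqF.
Qed.

Lemma mdiff_nseq_cexp M h u (a b : R -> R) t :
  (forall j, (j <= M)%N ->
    u (t + j%:R * h) = cexp (a (t + j%:R * h) +i* b (t + j%:R * h))%C) ->
  mdiff (nseq M h) u t = cexp (adiff M h a t +i* adiff M h b t)%C.
Proof.
elim: M t => [|M IH] t uE /=.
  by have := uE 0%N isT; rewrite mul0r addr0.
have sh j : t + h + j%:R * h = t + j.+1%:R * h by rewrite -natr1; ring.
rewrite (IH (t + h)); last by move=> j jM; rewrite sh; exact: uE.
rewrite (IH t); last by move=> j jM; apply: uE; exact: leqW.
by rewrite -cexpB cexpE.
Qed.

Lemma mdiff_nseq_last M h w t : (forall j, (j < M)%N -> w (t + j%:R * h) = 1) ->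
  mdiff (nseq M h) w t = w (t + M%:R * h).
Proof.
elim: M t => [|M IH] t h0 /=; first by rewrite mul0r addr0.
rewrite !IH => [|j jM|j jM].
- rewrite (h0 M) // divr1; congr w; rewrite -natr1; ring.
- by apply: h0; exact: ltnW.
- have -> : t + h + j%:R * h = t + j.+1%:R * h by rewrite -natr1; ring.
  exact: h0.
Qed.

(** An arithmetic progression along which [w] is trivial at [M] consecutive points
    carries no other value, whatever the sign of its step. *)
Lemma mdiff_nseq_eq1 M w h s : (forall t, mdiff (nseq M h) w t = 1) ->
  (forall j, (j < M)%N -> w (s + j%:R * h) = 1) ->
  forall k, w (s + k%:R * h) = 1.
Proof.
move=> w1 ws; elim/ltn_ind => k IH; have [kM|Mk] := ltnP k M; first exact: ws.
have e j : s + (k - M)%:R * h + j%:R * h = s + (k - M + j)%:R * h.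
  by rewrite natrD; ring.
have := w1 (s + (k - M)%:R * h); rewrite mdiff_nseq_last ?e ?subnK //.
by move=> j jM; rewrite e; apply: IH; lia.
Qed.

Lemma mdiff_eq1_on_segment M w del : 0 < del ->
  (forall h t, mdiff (nseq M h) w t = 1) ->
  (forall t, 0 <= t <= del -> w t = 1) -> forall t, w t = 1.
Proof.
move=> d0 w1 wd t; pose h := del / M.+1%:R.
have h0 : 0 < h by rewrite divr_gt0.
have dE : del = M.+1%:R * h by rewrite /h mulrC divfK // pnatr_eq0.
have jh j : (j < M)%N -> 0 <= j%:R * h /\ j%:R * h + h <= del.
  move=> jM; split; first by rewrite mulr_ge0 // ltW.
  rewrite dE -{2}[h]mul1r -mulrDl ler_wpM2r ?(ltW h0) // natr1 ler_nat; lia.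
have [t0|t0] := leP 0 t.
  pose k := Num.truncn (t / h).
  have /andP[k1 k2] : k%:R <= t / h < k.+1%:R.
    by apply: truncn_itv; rewrite divr_ge0 // ltW.
  rewrite ler_pdivlMr // in k1; rewrite ltr_pdivrMr // -natr1 mulrDl mul1r in k2.
  have -> : t = (t - k%:R * h) + k%:R * h by rewrite subrK.
  apply: mdiff_nseq_eq1 (w1 h) _ _ => j /jh[j1 j2]; apply: wd; lra.
pose k := Num.truncn ((del - t) / h).
have /andP[k1 k2] : k%:R <= (del - t) / h < k.+1%:R.
  apply: truncn_itv; apply: divr_ge0; last exact: ltW.
  by rewrite subr_ge0; apply: ltW; exact: lt_trans t0 d0.
rewrite ler_pdivlMr // in k1; rewrite ltr_pdivrMr // -natr1 mulrDl mul1r in k2.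
have -> : t = (t + k%:R * h) + k%:R * - h by ring.
apply: mdiff_nseq_eq1 (w1 (- h)) _ _ => j /jh[j1 j2]; apply: wd.
rewrite mulrN; lra.
Qed.

(** Near the origin the difference equation holds for the principal logarithm,
    up to a small multiple of the period, hence exactly; there the function is
    the exponential of a polynomial, and the difference equation propagates this
    to the whole line. *)
Lemma mdiff_eq1_exp_poly M u : u 0 = 1 ->
  continuous (fun t => Re (u t)) -> continuous (fun t => Im (u t)) ->
  (forall h t, mdiff (nseq M h) u t = 1) ->
  exists P1 P2 : {poly R}, forall t, u t = cexp (P1.[t] +i* P2.[t])%C.
Proof.
move=> u0 cR cI uM.
pose a t := ln (normc (u t)); pose b t := atan (Im (u t) / Re (u t)).
have ca t : 0 < Re (u t) -> {for t, continuous a}.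
  move=> ut; have n0 : 0 < normc (u t).
    by apply: lt_le_trans ut _; apply: le_trans (ler_norm _) (normc_Re _).
  apply: (@continuous_comp _ _ _ (fun t => normc (u t)) (@ln R)); last first.
    exact: continuous_ln.
  have -> : (fun t => normc (u t)) = fun t => Num.sqrt (Re (u t) ^+ 2 + Im (u t) ^+ 2).
    by apply/funext => s; case: (u s).
  apply: (@continuous_comp _ _ _ (fun t => Re (u t) ^+ 2 + Im (u t) ^+ 2) Num.sqrt).
    apply: cvgD; rewrite ?expr2; under eq_fun do rewrite expr2.
      by apply: cvgM; exact: cR.
    by apply: cvgM; exact: cI.
  exact: sqrt_continuous.
have cb t : 0 < Re (u t) -> {for t, continuous b}.
  move=> ut; apply: (@continuous_comp _ _ _ (fun t => Im (u t) / Re (u t)) (@atan R)).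
    by apply: cvgM; [exact: cI | apply: cvgV; [rewrite gt_eqF | exact: cR]].
  exact: continuous_atan.
(* A difference of order [M] multiplies bounds by at most [2 ^+ M]; an imaginary
   part below [2] in modulus is not a nonzero multiple of the period. *)
pose c : R := (2 ^+ M)^-1.
have c0 : 0 < c by rewrite invr_gt0 exprn_gt0.
have [del d0 hdel] : exists2 del, 0 < del &
    forall t, 0 <= t <= del -> 0 < Re (u t) /\ `|b t| <= c.
  have Re0 : 0 < Re (u 0) by rewrite u0.
  have b0 : b 0 = 0 by rewrite /b u0 /= mul0r atan0.
  have /cvgrPdist_lt/(_ 1 ltr01)/nbhs_ballP[r1 /= r10 h1] := cR 0.
  have /cvgrPdist_le/(_ c c0)/nbhs_ballP[r2 /= r20 h2] := cb 0 Re0.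
  exists (Num.min r1 r2 / 2) => [|t /andP[t0 tr]].
    by rewrite divr_gt0 // lt_min r10.
  have tm : t < Num.min r1 r2.
    have m0 : 0 < Num.min r1 r2 by rewrite lt_min r10.
    apply: le_lt_trans tr _; rewrite ltr_pdivrMr // mulr2n mulrDr mulr1.
    by rewrite ltrDl.
  move: tm; rewrite lt_min => /andP[t1 t2].
  have := h1 t; have := h2 t; rewrite -!ball_normE /= !sub0r !normrN ger0_norm //.
  rewrite b0 sub0r normrN => /(_ t2) bt /(_ t1).
  by rewrite u0 /= ltr_norml; split=> //; lra.
have uE t : 0 <= t <= del -> u t = cexp (a t +i* b t)%C.
  by move=> /hdel[ut _]; rewrite -{1}(cexp_clog ut).
have zero t h : 0 <= t -> 0 < h -> t + M%:R * h <= del ->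
    adiff M h a t = 0 /\ adiff M h b t = 0.
  move=> t0 h0 td.
  have seg j : (j <= M)%N -> 0 <= t + j%:R * h <= del.
    move=> jM; apply/andP; split; first by rewrite addr_ge0 // mulr_ge0 // ltW.
    by apply: le_trans td; rewrite lerD2l ler_wpM2r ?(ltW h0) // ler_nat.
  have := uM h t; rewrite (mdiff_nseq_cexp (a := a) (b := b)); last first.
    by move=> j jM; exact/uE/seg.
  move=> e1; have sm : `|adiff M h b t| < 2.
    apply: (@le_lt_trans _ _ (2 ^+ M * c)).
      by apply: adiff_le => j jM; have [] := hdel _ (seg j jM).
    by rewrite mulfV ?expf_neq0 // ltr1n.
  by case: (cexp_eq1_small e1 sm).
have [||P1 s1 P1E] := @adiff_eq0_poly _ M a del d0.
- by move=> t /hdel[ut _]; exact: ca.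
- by move=> t h t0 h0 td; have [] := zero t h t0 h0 td.
have [||P2 s2 P2E] := @adiff_eq0_poly _ M b del d0.
- by move=> t /hdel[ut _]; exact: cb.
- by move=> t h t0 h0 td; have [] := zero t h t0 h0 td.
exists P1, P2 => t.
pose v s := cexp ((- P1).[s] +i* (- P2).[s])%C.
suff : u t * v t = 1.
  move=> uv; have vt : v t != 0 by exact: cexp_neq0.
  apply: (mulIf vt); rewrite uv /v -cexpD -cexp0; congr cexp.
  by apply: complex_ext => /=; rewrite hornerN subrr.
apply: (@mdiff_eq1_on_segment M (fun s => u s * v s) del d0) => [h s|s sd].
  rewrite mdiffM uM mul1r (mdiff_nseq_cexp (a := horner (- P1)) (b := horner (- P2))) //.
  by rewrite !adiff_poly ?size_polyN // cexp0.
rewrite uE // P1E // P2E // /v -cexpD -cexp0; congr cexp.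
by apply: complex_ext => /=; rewrite hornerN subrr.
Qed.

End local_logarithm.

(** * Everywhere convergent complex power series *)

Section power_series.
Context {R : realType}.
Implicit Types (a b : nat -> R[i]) (F G : R[i] -> R[i]) (z w : R[i]).

Definition psum a z n : R[i] := \sum_(k < n) a k * z ^+ k.

Definition rapid a := forall r : R, 0 <= r ->
  exists K : R, forall k, normc (a k) * r ^+ k <= K.

(** Convergence in the complex plane is measured by the real-valued modulus. *)
Definition ccvg (s : nat -> R[i]) (l : R[i]) := forall e : R, 0 < e ->
  exists N, forall n, (N <= n)%N -> normc (s n - l) <= e.

Definition entire a F := rapid a /\ forall z, ccvg (psum a z) (F z).

Lemma ccvg_unique s l l' : ccvg s l -> ccvg s l' -> l = l'.
Proof.
move=> h h'; apply/eqP; rewrite -subr_eq0 -normc_eq0 eq_le normc_ge0 andbT.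
apply/ler_addgt0Pr => e e0; rewrite add0r; have e2 : 0 < e / 2 by rewrite divr_gt0.
have [N1 h1] := h _ e2; have [N2 h2] := h' _ e2; pose N := maxn N1 N2.
have -> : l - l' = (s N - l') - (s N - l) by ring.
apply: le_trans (le_normcD _ _) _; rewrite normcN.
have := h1 N (leq_maxl _ _); have := h2 N (leq_maxr _ _); lra.
Qed.

Lemma ccvg_le s l (c : R) z : ccvg s l ->
  (exists N, forall n, (N <= n)%N -> normc (z - s n) <= c) -> normc (z - l) <= c.
Proof.
move=> h [N hN]; apply/ler_addgt0Pr => e /h[N' hN'].
pose k := maxn N N'; have -> : z - l = (z - s k) + (s k - l) by ring.
apply: le_trans (le_normcD _ _) _.
by apply: lerD; [apply: hN; exact: leq_maxl | apply: hN'; exact: leq_maxr].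
Qed.

Lemma geometric_half_le N M : (N <= M)%N ->
  \sum_(N <= k < M) (2^-1 : R) ^+ k <= 2 * 2^-1 ^+ N.
Proof.
move=> NM; rewrite -(subnKC NM); elim: (M - N)%N => [|j IH].
  by rewrite addn0 big_geq // mulr_ge0 // exprn_ge0.
rewrite addnS big_nat_recr ?leq_addr //=.
suff h : \sum_(N <= k < N + j) (2^-1 : R) ^+ k = 2 * 2^-1 ^+ N - 2 * 2^-1 ^+ (N + j).
  rewrite h; have : (0 : R) <= 2^-1 ^+ (N + j) by rewrite exprn_ge0.
  lra.
elim: j {IH} => [|j IH]; first by rewrite addn0 big_geq // subrr.
by rewrite addnS big_nat_recr ?leq_addr //= IH exprS; field.
Qed.

(** The partial sums of a rapidly decreasing series approximate its sum to the
    order of the first omitted term. *)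
Lemma entire_tail a F K z n : entire a F -> (forall k, normc (a k) * 2 ^+ k <= K) ->
  normc z <= 1 -> normc (F z - psum a z n) <= 2 * K * normc z ^+ n.
Proof.
move=> [_ cF] aK z1; rewrite -normcN opprB.
apply: ccvg_le (cF z) _; exists n => M nM.
rewrite -normcN opprB /psum -(big_mkord xpredT (fun k => a k * z ^+ k)).
rewrite -(big_mkord xpredT (fun k => a k * z ^+ k)) (big_cat_nat (n := n)) //=.
rewrite addrAC subrr add0r; apply: le_trans (normc_sum _ _ _) _.
have K0 : 0 <= K by apply: le_trans (aK 0%N); rewrite expr0 mulr1 normc_ge0.
apply: (@le_trans _ _ (\sum_(n <= k < M) (K * normc z ^+ n) * (2^-1) ^+ k)).
  apply: ler_sum_nat => k /andP[nk _].
  rewrite ComplexField.Normc.normcM normcX -mulrA [_ ^+ n * _]mulrC mulrA.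
  apply: ler_pM; rewrite ?mulr_ge0 ?normc_ge0 ?exprn_ge0 ?normc_ge0 //.
    by rewrite exprVn ler_pdivlMr ?exprn_gt0.
  by apply: ler_wiXn2l => //; exact: normc_ge0.
rewrite -mulr_sumr -[leRHS]mulrA.
have Kz : 0 <= K * normc z ^+ n by rewrite mulr_ge0 // exprn_ge0 // normc_ge0.
apply: le_trans (ler_wpM2l Kz (geometric_half_le nM)) _.
rewrite mulrCA ler_wpM2l // ler_piMr // exprn_ile1 //.
by rewrite invf_le1 // ler1n.
Qed.

Lemma half_pow_small (C e : R) : 0 < e ->
  exists N, forall n, (N <= n)%N -> C * 2^-1 ^+ n <= e.
Proof.
move=> e0; have C0 : 0 < `|C| + 1 by rewrite ltr_wpDl.
have [N hN] := exists_harmonic_lt (divr_gt0 e0 C0).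
exists N => n Nn; have := hN n Nn; rewrite ltr_pdivlMr // => h.
have p : 2^-1 ^+ n <= n.+1%:R^-1 :> R.
  rewrite exprVn lef_pV2 ?posrE ?exprn_gt0 //.
  by rewrite -natrX ler_nat ltn_expl.
have p0 : 0 <= 2^-1 ^+ n :> R by rewrite exprn_ge0.
have := ler_norm C; move: p p0 h; set a := 2^-1 ^+ n; set b := n.+1%:R^-1; nra.
Qed.

Lemma ccvg_close s t l (C : R) : ccvg s l ->
  (forall n, normc (t n - s n) <= C * 2^-1 ^+ n) -> ccvg t l.
Proof.
move=> h st e e0; have e2 : 0 < e / 2 by rewrite divr_gt0.
have [N1 h1] := h _ e2; have [N2 h2] := half_pow_small C e2.
exists (maxn N1 N2) => n; rewrite geq_max => /andP[/h1 a1 /h2 a2].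
have -> : t n - l = (t n - s n) + (s n - l) by ring.
apply: le_trans (le_normcD _ _) _; have := st n; lra.
Qed.

Lemma ccvgM s t l l' : ccvg s l -> ccvg t l' -> ccvg (fun n => s n * t n) (l * l').
Proof.
move=> h h' e e0; pose D := normc l + normc l' + 1 : R.
have l0 := normc_ge0 l; have l0' := normc_ge0 l'.
have D0 : 0 < D by rewrite /D; lra.
pose d := Num.min 1 (e / (2 * D)).
have d0 : 0 < d by rewrite lt_min ltr01 divr_gt0 // mulr_gt0.
have d1 : d <= 1 by rewrite ge_min lexx.
have dD : d * (2 * D) <= e.
  by rewrite -ler_pdivlMr ?mulr_gt0 // ge_min lexx orbT.
have [N1 h1] := h _ d0; have [N2 h2] := h' _ d0.
exists (maxn N1 N2) => n; rewrite geq_max => /andP[/h1 a1 /h2 a2].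
have -> : s n * t n - l * l' =
  (s n - l) * (t n - l') + ((s n - l) * l' + l * (t n - l')) by ring.
apply: le_trans (le_normcD _ _) _.
apply: (@le_trans _ _ (d * d + (d * normc l' + normc l * d))).
  rewrite ComplexField.Normc.normcM; apply: lerD.
    by apply: ler_pM; rewrite ?normc_ge0.
  apply: le_trans (le_normcD _ _) _; rewrite !ComplexField.Normc.normcM.
  by apply: lerD; [apply: ler_wpM2r | apply: ler_wpM2l]; rewrite ?normc_ge0.
apply: le_trans dD; rewrite /D; nra.
Qed.

(** The product of the partial sums and the partial sum of the Cauchy product
    differ by coefficients of a product of polynomials beyond the order of
    truncation. *)
Lemma cauchy_product a b (l l' : R[i]) (K : R) :
  (forall k, normc (a k) * 8 ^+ k <= K) -> (forall k, normc (b k) * 8 ^+ k <= K) ->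
  ccvg (fun n => \sum_(k < n) a k) l -> ccvg (fun n => \sum_(k < n) b k) l' ->
  ccvg (fun n => \sum_(k < n) \sum_(i < k.+1) a i * b (k - i)%N) (l * l').
Proof.
move=> aK bK al bl; have K0 : 0 <= K.
  by apply: le_trans (aK 0%N); rewrite expr0 mulr1 normc_ge0.
apply: (@ccvg_close _ _ _ (2 * K ^+ 2)) (ccvgM al bl) _ => n.
pose p : {poly R[i]} := \poly_(i < n) a i; pose q : {poly R[i]} := \poly_(i < n) b i.
have pE : \sum_(k < n) a k = p.[1].
  rewrite (horner_coef_wide _ (size_poly n a)); apply: eq_bigr => i _.
  by rewrite expr1n mulr1 coef_poly ltn_ord.
have qE : \sum_(k < n) b k = q.[1].
  rewrite (horner_coef_wide _ (size_poly n b)); apply: eq_bigr => i _.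
  by rewrite expr1n mulr1 coef_poly ltn_ord.
have spq : (size (p * q)%R <= n + n)%N.
  apply: leq_trans (size_polyMleq _ _) _; rewrite (leq_trans (leq_pred _)) //.
  by apply: leq_add; exact: size_poly.
have pc c k : normc ((\poly_(i < n) c i : {poly R[i]})`_k) <= normc (c k).
  by rewrite coef_poly; case: ifP => // _; rewrite ComplexField.Normc.normc0 normc_ge0.
have pqk k : normc (p * q)`_k <= K ^+ 2 * 2^-1 ^+ k.
  rewrite coefM; apply: le_trans (normc_sum _ _ _) _.
  have h8 : forall c k, normc (c k) * 8 ^+ k <= K -> normc (c k) <= K * 8^-1 ^+ k :> R.
    by move=> c k' h; rewrite exprVn ler_pdivlMr ?exprn_gt0.
  apply: (@le_trans _ _ (\sum_(i < k.+1) K ^+ 2 * 8^-1 ^+ k)).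
    apply: ler_sum => i _; rewrite ComplexField.Normc.normcM.
    apply: (@le_trans _ _ ((K * 8^-1 ^+ i) * (K * 8^-1 ^+ (k - i)))).
      apply: ler_pM; rewrite ?normc_ge0 //.
        by apply: le_trans (pc a i) _; exact: h8.
      by apply: le_trans (pc b _) _; exact: h8.
    by rewrite mulrACA -exprD subnKC // -ltnS.
  rewrite sumr_const card_ord -[leLHS]mulr_natr -mulrA ler_wpM2l ?exprn_ge0 //.
  have -> : 8^-1 ^+ k = 2^-1 ^+ k * 4^-1 ^+ k :> R.
    by rewrite -exprMn; congr (_ ^+ _); field.
  rewrite -mulrA ler_piMr ?exprn_ge0 // exprVn mulrC ler_pdivrMr ?exprn_gt0 //.
  rewrite mul1r -natrX ler_nat; apply: leq_trans (ltn_expl k (isT : 1 < 2)%N) _.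
  by rewrite (_ : 4 = 2 ^ 2)%N // -expnM leq_exp2l // mul2n -addnn leq_addr.
rewrite pE qE -hornerM (horner_coef_wide _ spq).
rewrite -(big_mkord xpredT (fun i => (p * q)`_i * 1 ^+ i)).
rewrite (big_cat_nat (n := n)) //= ?leq_addr // big_mkord.
have -> : \sum_(i < n) (p * q)`_i * 1 ^+ i =
    \sum_(k < n) \sum_(i < k.+1) a i * b (k - i)%N.
  apply: eq_bigr => k _; rewrite expr1n mulr1 coefM; apply: eq_bigr => i _.
  have pci j : (j < n)%N -> p`_j = a j by move=> jn; rewrite /p coef_poly jn.
  have qci j : (j < n)%N -> q`_j = b j by move=> jn; rewrite /q coef_poly jn.
  rewrite pci ?qci //; first exact: leq_ltn_trans (leq_subr _ _) (ltn_ord k).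
  by apply: leq_ltn_trans (ltn_ord k); rewrite -ltnS.
rewrite opprD addrA subrr add0r normcN; apply: le_trans (normc_sum _ _ _) _.
apply: (@le_trans _ _ (\sum_(n <= k < n + n) K ^+ 2 * 2^-1 ^+ k)).
  by apply: ler_sum => k _; rewrite expr1n mulr1.
rewrite -mulr_sumr (_ : 2 * _ * _ = K ^+ 2 * (2 * 2^-1 ^+ n)); last by ring.
rewrite ler_wpM2l ?exprn_ge0 //.
by apply: geometric_half_le; exact: leq_addr.
Qed.

End power_series.

Section entire_functions.
Context {R : realType}.
Implicit Types (a b : nat -> R[i]) (F G : R[i] -> R[i]) (z w c : R[i]).

Lemma rapid_common a b (r : R) : 0 <= r -> rapid a -> rapid b -> exists K : R,
  (forall k, normc (a k) * r ^+ k <= K) /\ (forall k, normc (b k) * r ^+ k <= K).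
Proof.
move=> r0 /(_ r r0)[K hK] /(_ r r0)[L hL]; exists (Num.max K L).
by split=> k; rewrite le_max ?hK ?hL ?orbT.
Qed.

Lemma entireM a b F G : entire a F -> entire b G ->
  entire (fun k => \sum_(i < k.+1) a i * b (k - i)%N) (fun z => F z * G z).
Proof.
move=> [ra cF] [rb cG]; split=> [r r0|z].
  have [K [aK bK]] := rapid_common (mulr_ge0 r0 (ler0n R 2)) ra rb.
  have K0 : 0 <= K by apply: le_trans (aK 0%N); rewrite expr0 mulr1 normc_ge0.
  exists (K ^+ 2) => k; apply: le_trans (ler_wpM2r _ (normc_sum _ _ _)) _.
    exact: exprn_ge0.
  rewrite mulr_suml; apply: (@le_trans _ _ (\sum_(i < k.+1) K ^+ 2 * 2^-1 ^+ k)).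
    apply: ler_sum => i _; rewrite ComplexField.Normc.normcM.
    rewrite exprVn ler_pdivlMr ?exprn_gt0 // -mulrA -exprMn.
    have -> : (r * 2) ^+ k = (r * 2) ^+ i * (r * 2) ^+ (k - i).
      by rewrite -exprD subnKC // -ltnS.
    rewrite mulrACA; apply: ler_pM => //; by rewrite mulr_ge0 ?normc_ge0 ?exprn_ge0 ?mulr_ge0.
  rewrite sumr_const card_ord -[leLHS]mulr_natr -mulrA ler_piMr ?exprn_ge0 //.
  rewrite exprVn mulrC ler_pdivrMr ?exprn_gt0 // mul1r -natrX ler_nat.
  exact: ltn_expl.
have r0 : 0 <= 8 * normc z by rewrite mulr_ge0 // normc_ge0.
have [K [aK bK]] := rapid_common r0 ra rb.
have h (d : nat -> R[i]) : (forall k, normc (d k) * (8 * normc z) ^+ k <= K) ->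
    forall k, normc (d k * z ^+ k) * 8 ^+ k <= K.
  move=> dK k; apply: le_trans (dK k).
  by rewrite ComplexField.Normc.normcM normcX exprMn -mulrA [_ ^+ k * _]mulrC.
have := cauchy_product (h a aK) (h b bK) (cF z) (cG z).
congr (ccvg _ _); apply/funext => n; apply: eq_bigr => k _.
rewrite mulr_suml; apply: eq_bigr => i _; rewrite mulrACA -exprD subnKC //.
by rewrite -ltnS.
Qed.

Lemma entireB a b F G : entire a F -> entire b G ->
  entire (fun k => a k - b k) (fun z => F z - G z).
Proof.
move=> [ra cF] [rb cG]; split=> [r r0|z e e0].
  have [K [aK bK]] := rapid_common r0 ra rb; exists (K + K) => k.
  apply: le_trans (ler_wpM2r (exprn_ge0 k r0) (le_normcD _ _)) _.
  by rewrite normcN mulrDl lerD.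
have e2 : 0 < e / 2 by rewrite divr_gt0.
have [N1 h1] := cF z _ e2; have [N2 h2] := cG z _ e2.
exists (maxn N1 N2) => n; rewrite geq_max => /andP[/h1 x1 /h2 x2].
have -> : psum (fun k => a k - b k) z n - (F z - G z) =
    (psum a z n - F z) - (psum b z n - G z).
  by rewrite /psum (eq_bigr (fun k : 'I_n => a k * z ^+ k - b k * z ^+ k));
    [rewrite sumrB; ring | move=> k _; rewrite mulrBl].
apply: le_trans (le_normcD _ _) _; rewrite normcN; lra.
Qed.

Lemma entire_cst c : entire (fun k => if k == 0%N then c else 0) (fun=> c).
Proof.
split=> [r r0|z e e0].
  exists (normc c) => -[|k]; first by rewrite expr0 mulr1.
  by rewrite ComplexField.Normc.normc0 mul0r normc_ge0.
exists 1%N => -[//|n] _; apply: le_trans (ltW e0).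
suff -> : psum (fun k => if k == 0%N then c else 0) z n.+1 - c = 0.
  by rewrite ComplexField.Normc.normc0.
rewrite /psum big_ord_recl /= expr0 mulr1 big1 ?addr0 ?subrr // => k _.
by rewrite mul0r.
Qed.

Lemma entire_comp a F c j : (0 < j)%N -> entire a F ->
  entire (fun k => if (j %| k)%N then a (k %/ j)%N * c ^+ (k %/ j) else 0)
         (fun z => F (c * z ^+ j)).
Proof.
move=> j0 [ra cF]; split=> [r r0|z].
  have [K aK] := ra (normc c * r ^+ j) (mulr_ge0 (normc_ge0 _) (exprn_ge0 _ r0)).
  exists K => k; case: ifP => [/divnK kE|_].
    rewrite -[X in _ * r ^+ X]kE; apply: le_trans (aK (k %/ j)%N).
    by rewrite ComplexField.Normc.normcM normcX exprMn mulnC exprM mulrA.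
  rewrite ComplexField.Normc.normc0 mul0r; apply: le_trans (aK 0%N).
  by rewrite expr0 mulr1 normc_ge0.
set b := fun k : nat => _.
(* The partial sums of the composed series are those of the original one, each
   repeated [j] times. *)
have step n : exists q, (n <= q * j < n + j)%N /\ psum b z n = psum a (c * z ^+ j) q.
  elim: n => [|n [q [/andP[nq qn] IH]]].
    by exists 0%N; rewrite mul0n add0n j0 /psum !big_ord0.
  have E : psum b z n.+1 = psum b z n + b n * z ^+ n by rewrite /psum big_ord_recr.
  have [/dvdnP[l nl]|jn] := boolP (j %| n)%N.
    have ql : q = l.
      apply/eqP; rewrite eqn_leq; apply/andP; split.
        by rewrite -ltnS -(ltn_pmul2r j0) mulSn addnC -nl.
      by rewrite -(leq_pmul2r j0) -nl.
    exists q.+1; rewrite mulSn ql -nl; split; first by apply/andP; split; lia.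
    rewrite E IH ql /psum big_ord_recr /= /b nl dvdn_mull // mulnK //.
    by rewrite exprMn -exprM mulnC mulrA.
  exists q; rewrite E IH /b (negbTE jn) mul0r addr0; split=> //.
  have nqj : n != (q * j)%N by apply: contraNneq jn => ->; exact: dvdn_mull.
  by apply/andP; split; lia.
move=> e e0; have [N hN] := cF (c * z ^+ j) e e0.
exists (N * j)%N => n Nn; have [q [/andP[nq _] ->]] := step n.
by apply: hN; rewrite -(leq_pmul2r j0); exact: leq_trans nq.
Qed.

(** The first coefficient at which the series differ would dominate their
    difference near the origin of the real line. *)
Lemma entire_unique a b F G : entire a F -> entire b G ->
  (forall t : R, F t%:C%C = G t%:C%C) -> a = b.
Proof.
move=> eF eG FG; have eD := entireB eF eG.
have [K dK] := eD.1 2 (ler0n R 2).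
apply/funext; elim/ltn_ind => n IH; apply/eqP; rewrite -subr_eq0 -normc_eq0.
rewrite eq_le normc_ge0 andbT.
have K0 : 0 <= K by apply: le_trans (dK 0%N); rewrite expr0 mulr1 normc_ge0.
have h (t : R) : 0 < t <= 1 -> normc (a n - b n) <= 2 * K * t.
  move=> /andP[t0 t1]; have nt : normc t%:C%C = t by rewrite normcC gtr0_norm.
  have := @entire_tail _ _ _ K t%:C%C n.+1 eD dK; rewrite nt => /(_ t1).
  rewrite FG subrr sub0r normcN /psum big_ord_recr /= big1 => [|k _]; last first.
    by rewrite IH ?subrr ?mul0r.
  rewrite add0r ComplexField.Normc.normcM normcX nt exprS mulrA.
  by rewrite ler_pM2r // exprn_gt0.
apply/ler_addgt0Pr => e e0; rewrite add0r.
have C0 : 0 < 2 * K + 1 by rewrite ltr_wpDl // mulr_ge0.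
pose t := Num.min 1 (e / (2 * K + 1)).
have t0 : 0 < t by rewrite lt_min ltr01 divr_gt0.
have te : t * (2 * K + 1) <= e by rewrite -ler_pdivlMr // ge_min lexx orbT.
have := h t; rewrite t0 ge_min lexx => /(_ isT); lra.
Qed.

Lemma ccvg_ReIm (s : nat -> R[i]) (l : R[i]) :
  Re (s n) @[n --> \oo] --> Re l -> Im (s n) @[n --> \oo] --> Im l -> ccvg s l.
Proof.
move=> hR hI e e0; have e2 : 0 < e / 2 by rewrite divr_gt0.
move/cvgrPdist_le: hR => /(_ _ e2)[N1 _ h1].
move/cvgrPdist_le: hI => /(_ _ e2)[N2 _ h2].
exists (maxn N1 N2) => n; rewrite geq_max => /andP[/h1 /= x1 /h2 /= x2].
apply: le_trans (normc_le_ReIm _) _.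
have -> : Re (s n - l) = - (Re l - Re (s n)) by case: (s n); case: (l) => * /=; ring.
have -> : Im (s n - l) = - (Im l - Im (s n)) by case: (s n); case: (l) => * /=; ring.
rewrite !normrN; lra.
Qed.

Definition cexp_coeff (k : nat) : R[i] := ((k`!%:R)^-1)%:C%C.

Lemma rapid_cexp : rapid cexp_coeff.
Proof.
move=> r r0; exists (expR r) => k; rewrite normcC ger0_norm ?invr_ge0 //.
case: k => [|k]; first by rewrite expr0 mulr1 fact0 invr1 -expR0 ler_expR.
by rewrite mulrC; apply: le_trans (expR_ge1Dxn k r0); rewrite lerDr.
Qed.

Lemma ccvg_cexp_real (x : R) : ccvg (psum cexp_coeff x%:C%C) (expR x)%:C%C.
Proof.
have e n : psum cexp_coeff x%:C%C n = (series (exp_coeff x) n)%:C%C.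
  rewrite /psum /series /= big_mkord rmorph_sum; apply: eq_bigr => k _.
  by rewrite /= rmorphM rmorphXn mulrC.
apply: ccvg_ReIm; under eq_fun do rewrite e /=.
  exact: is_cvg_series_exp_coeff.
exact: cvg_cst.
Qed.

Lemma expi (y : R) k : ('i * y%:C)%C ^+ k =
  ((~~ odd k)%:R * (-1) ^+ k./2 * y ^+ k +i* ((odd k)%:R * (-1) ^+ k.-1./2 * y ^+ k))%C.
Proof.
have h : forall k, ('i * y%:C)%C ^+ k =
  ((~~ odd k)%:R * (-1) ^+ k./2 * y ^+ k +i* ((odd k)%:R * (-1) ^+ k./2 * y ^+ k))%C.
  elim=> [|{}k IH]; first by rewrite !expr0 /= !mul1r !mul0r.
  rewrite exprS IH; apply: complex_ext; rewrite /= uphalf_half exprS.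
    by case: (odd k) => /=; rewrite ?add1n ?exprS; ring.
  by case: (odd k) => /=; rewrite ?add0n; ring.
rewrite h; case: k => [|k] //=; case ok : (odd k) => /=; rewrite ?mul0r //.
by rewrite uphalf_half ok.
Qed.

Lemma ccvg_cexp_imag (y : R) :
  ccvg (psum cexp_coeff ('i * y%:C)%C) (cos y +i* sin y)%C.
Proof.
have e n : psum cexp_coeff ('i * y%:C)%C n =
    (series (cos_coeff y) n +i* series (sin_coeff y) n)%C.
  rewrite /psum /series /= !big_mkord.
  elim: n => [|n IH]; first by rewrite !big_ord0.
  rewrite !big_ord_recr IH expi.
  move: (\sum_(i < n) cos_coeff y i) (\sum_(i < n) sin_coeff y i) => S1 S2.
  by apply: complex_ext; rewrite /= /cos_coeff /sin_coeff /= -?exprnP; ring.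
apply: ccvg_ReIm; under eq_fun do rewrite e /=.
  have -> : cos y = limn (series (cos_coeff y)) by rewrite unlock.
  exact: is_cvg_series_cos_coeff.
have -> : sin y = limn (series (sin_coeff y)) by rewrite unlock.
exact: is_cvg_series_sin_coeff.
Qed.

(** The exponential series at [x + i y] is the Cauchy product of the series at
    [x] and at [i y], by the binomial formula. *)
Lemma entire_cexp : entire cexp_coeff (@cexp R).
Proof.
split=> [|z]; first exact: rapid_cexp.
have h w : exists K, forall k, normc (cexp_coeff k * w ^+ k) * 8 ^+ k <= K.
  have [|K hK] := rapid_cexp (r := 8 * normc w).
    by rewrite mulr_ge0 // normc_ge0.
  exists K => k; apply: le_trans (hK k).
  by rewrite ComplexField.Normc.normcM normcX exprMn -mulrA [_ ^+ k * _]mulrC.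
pose x : R[i] := (Re z)%:C%C; pose y : R[i] := ('i * (Im z)%:C)%C.
have [K1 h1] := h x; have [K2 h2] := h y; pose K := Num.max K1 K2.
have h1' k : normc (cexp_coeff k * x ^+ k) * 8 ^+ k <= K by rewrite le_max h1.
have h2' k : normc (cexp_coeff k * y ^+ k) * 8 ^+ k <= K by rewrite le_max h2 orbT.
have := cauchy_product h1' h2' (ccvg_cexp_real (Re z)) (ccvg_cexp_imag (Im z)).
have -> : (expR (Re z))%:C%C * (cos (Im z) +i* sin (Im z))%C = cexp z.
  by rewrite cexpE; apply: complex_ext => /=; ring.
congr (ccvg _ _); apply/funext => n; apply: eq_bigr => k _.
rewrite [in RHS](complexE z) -/x -/y addrC exprDn mulr_sumr.
apply: eq_bigr => i _; have ik : (i <= k)%N by rewrite -ltnS.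
have -> : cexp_coeff k = cexp_coeff i * cexp_coeff (k - i) * (('C(k, i))%:R)^-1.
  rewrite /cexp_coeff -!rmorphM -(rmorph_nat (real_complex R)) -fmorphV -rmorphM.
  congr (_%:C%C); rewrite -(bin_fact ik) !natrM; field.
  by rewrite !pnatr_eq0 -!lt0n !fact_gt0 bin_gt0 ik.
rewrite -mulr_natr; field.
by rewrite !pnatr_eq0 -!lt0n !fact_gt0 bin_gt0 ik.
Qed.

(** The exponential of a polynomial is the product of the exponentials of its
    monomials. *)
Lemma entire_cexp_poly (p : {poly R[i]}) : exists a, entire a (fun z => cexp p.[z]).
Proof.
have h n : exists a, entire a (fun z => cexp (\sum_(j < n) p`_j * z ^+ j)).
  elim: n => [|n [a IH]].
    have := entire_cst 1; set a := fun k : nat => _ => ea; exists a.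
    by move: ea; congr entire; apply/funext => z; rewrite big_ord0 cexp0.
  have -> : (fun z => cexp (\sum_(j < n.+1) p`_j * z ^+ j)) =
      (fun z => cexp (\sum_(j < n) p`_j * z ^+ j) * cexp (p`_n * z ^+ n)).
    by apply/funext => z; rewrite big_ord_recr cexpD.
  have [b eb] : exists b, entire b (fun z => cexp (p`_n * z ^+ n)).
    case: n {a IH} => [|n].
      have := entire_cst (cexp p`_0); set a := fun k : nat => _ => ea; exists a.
      by move: ea; congr entire; apply/funext => z; rewrite expr0 mulr1.
    by eexists; exact: entire_comp (ltn0Sn n) entire_cexp.
  by eexists; exact: entireM IH eb.
have [a ea] := h (size p); exists a; move: ea; congr entire; apply/funext => z.
by rewrite horner_coef.
Qed.

(** The exponential tail, in a form that integrates to the moment generating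
    function. *)
Lemma cexp_tail z N :
  normc (cexp z - psum cexp_coeff z N) <= 2^-1 ^+ N * expR (2 * normc z).
Proof.
rewrite -normcN opprB; apply: ccvg_le (entire_cexp.2 z) _; exists N => M NM.
rewrite -normcN opprB /psum -(big_mkord xpredT (fun k => cexp_coeff k * z ^+ k)).
rewrite -(big_mkord xpredT (fun k => cexp_coeff k * z ^+ k)) (big_cat_nat (n := N)) //=.
rewrite addrAC subrr add0r; apply: le_trans (normc_sum _ _ _) _.
have z0 : 0 <= 2 * normc z by rewrite mulr_ge0 // normc_ge0.
apply: (@le_trans _ _ (\sum_(N <= k < M) 2^-1 ^+ N * exp_coeff (2 * normc z) k)).
  apply: ler_sum_nat => k /andP[Nk _].
  rewrite ComplexField.Normc.normcM normcX normcC ger0_norm ?invr_ge0 //.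
  rewrite /exp_coeff /= exprMn mulrA [leRHS]mulrC ler_wpM2l ?invr_ge0 //.
  rewrite mulrA ler_peMl ?exprn_ge0 ?normc_ge0 //.
  by rewrite exprVn mulrC ler_pdivlMr ?exprn_gt0 // mul1r ler_eXn2l // ltr1n.
rewrite -mulr_sumr ler_wpM2l ?exprn_ge0 //.
apply: (@le_trans _ _ (series (exp_coeff (2 * normc z)) M)).
  rewrite /series /= [leRHS](big_cat_nat (n := N)) //= lerDr.
  by apply: sumr_ge0 => k _; exact: exp_coeff_ge0.
apply: nondecreasing_cvgn_le; last exact: is_cvg_series_exp_coeff.
by apply: nondecreasing_series => k _ _; exact: exp_coeff_ge0.
Qed.

End entire_functions.

(** * Exponential moments *)

Section even_differences.
Context {R : realType}.

Lemma adiffZ M h (c : R) g t : adiff M h (fun s => c * g s) t = c * adiff M h g t.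
Proof. by elim: M t => [//|M IH] t /=; rewrite !IH mulrBr. Qed.

Lemma adiff_shift M h (g : R -> R) b t :
  adiff M h (fun s => g (s + b)) t = adiff M h g (t + b).
Proof. by elim: M t => [//|M IH] t /=; rewrite !IH addrAC. Qed.

Lemma eq_adiff M h (f g : R -> R) t : f =1 g -> adiff M h f t = adiff M h g t.
Proof. by move=> /funext ->. Qed.

(** Two differences of [s |-> cos (s y)] multiply it by [- (2 - 2 cos (h y))] and
    shift it by [h]. *)
Lemma adiff_cos k h (y t : R) : adiff k.*2 h (fun s => cos (s * y)) t =
  (-1) ^+ k * (2 - 2 * cos (h * y)) ^+ k * cos ((t + k%:R * h) * y).
Proof.
elim: k t => [|k IH] t; first by rewrite /= mul0r addr0 !expr0 !mul1r.
rewrite doubleS !adiffS.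
rewrite (@eq_adiff _ _ _ (fun s => - (2 - 2 * cos (h * y)) * cos ((s + h) * y))).
  rewrite adiffZ (@adiff_shift _ _ (fun s => cos (s * y))) IH.
  have -> : t + h + k%:R * h = t + k.+1%:R * h by rewrite -natr1; ring.
  by rewrite !exprS; ring.
move=> s; have -> : (s + h + h) * y = (s + h) * y + h * y by ring.
have -> : s * y = (s + h) * y - h * y by ring.
by rewrite cosD cosB; ring.
Qed.

Lemma one_sub_cos_ge : exists2 del : R, 0 < del &
  forall x : R, `|x| <= del -> x ^+ 2 <= 4 * (2 - 2 * cos x).
Proof.
have half0 : 0 < 2^-1 :> R by rewrite invr_gt0.
have /cvgrPdist_le/(_ _ half0)/nbhs_ballP[r /= r0 hr] := @continuous_cos R 0.
have hcos x : `|x| < r -> 2^-1 <= cos x.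
  move=> xr; have := hr x; rewrite -ball_normE /= sub0r normrN => /(_ xr).
  by rewrite cos0 ler_norml => /andP[_]; lra.
exists (r / 2); first by rewrite divr_gt0.
have pos x : 0 <= x -> x <= r / 2 -> x ^+ 2 <= 4 * (2 - 2 * cos x).
  move=> x0 xr; have x2 : 0 <= x / 2 by rewrite divr_ge0.
  have cs : {within `[0, x / 2], continuous (@sin R)}.
    by apply: continuous_subspaceT => z; exact: continuous_sin.
  have [c] := MVT_segment x2 (fun z _ => is_derive_sin z) cs.
  rewrite in_itv /= sin0 !subr0 => /andP[c0 cx] sx.
  have cr : 2^-1 <= cos c by apply: hcos; rewrite ger0_norm //; lra.
  have -> : cos x = 1 - 2 * sin (x / 2) ^+ 2.
    have {1}-> : x = x / 2 + x / 2 by lra.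
    by rewrite cosD -!expr2 cos2sin2; ring.
  have s1 : x / 4 <= sin (x / 2) by rewrite sx; nra.
  have : (x / 4) ^+ 2 <= sin (x / 2) ^+ 2 by rewrite ler_pXn2r ?nnegrE //; nra.
  by rewrite exprMn; lra.
move=> x; have [x0|x0] := leP 0 x; first by rewrite ger0_norm //; exact: pos.
rewrite ltr0_norm // -sqrrN -cosN; apply: pos; by rewrite oppr_ge0 ltW.
Qed.

End even_differences.

Section moments.
Context d (T : measurableType d) {R : realType} (P : probability T R).
Variable Y : T -> R.
Hypothesis mY : measurable_fun [set: T] Y.
Variables (a : nat -> R[i]) (F : R[i] -> R[i]).
Hypothesis eF : entire a F.
Hypothesis FE : forall t : R,
  F t%:C%C = cexpectation P (fun w => cexp ('i * (t * Y w)%:C)%C).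

Let v (t : R) := \int[P]_w cos (t * Y w).

Lemma measurable_fun_continuous_comp (g : R -> R) : continuous g ->
  measurable_fun [set: T] (fun w => g (Y w)).
Proof.
move=> cg; apply: measurableT_comp => //; exact: continuous_measurable_fun.
Qed.

Let intble_cos t : intble P (fun w => cos (t * Y w)).
Proof.
apply: (@intble_bounded _ _ _ _ _ 1) => [|w]; last exact: cos_max.
apply: (@measurable_fun_continuous_comp (fun y => cos (t * y))) => y.
by apply: continuous_comp; [exact: mulrl_continuous | exact: continuous_cos].
Qed.

Lemma Rintegral_adiff M h t :
  adiff M h v t = \int[P]_w adiff M h (fun s => cos (s * Y w)) t /\
  intble P (fun w => adiff M h (fun s => cos (s * Y w)) t).
Proof.
elim: M t => [|M IH] t /=; first by split=> //; exact: intble_cos.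
have [e1 i1] := IH (t + h); have [e2 i2] := IH t.
by split; [rewrite RintegralB // e1 e2 | exact: intbleB].
Qed.

Let vE t : v t = Re (F t%:C%C).
Proof. by rewrite FE Re_cexpectation; apply: eq_Rintegral => w _; rewrite cexp_i. Qed.

(** The integral is, up to sign, the central difference of order [2 k] at the
    origin of the real part of [F]. This difference annihilates the terms of the
    power series of degree less than [2 k]; the term of degree [2 k] gives the
    main contribution and the remainder is of higher order in [h]. *)
Lemma integral_one_sub_cos_le k : exists C : R, forall h, 0 < h -> k%:R * h <= 1 ->
  \int[P]_w ((2 - 2 * cos (h * Y w)) ^+ k) <=
  h ^+ k.*2 * (normc (a k.*2) * (k.*2)%:R ^+ k.*2 + C * h).
Proof.
have [K aK] := eF.1 2 (ler0n R 2).
have K0 : 0 <= K by apply: le_trans (aK 0%N); rewrite expr0 mulr1 normc_ge0.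
exists (2 ^+ k.*2 * (2 * K * k%:R ^+ k.*2.+1)) => h h0 kh.
pose t := - (k%:R * h).
have -> : \int[P]_w ((2 - 2 * cos (h * Y w)) ^+ k) =
    (-1) ^+ k * adiff k.*2 h v t.
  have [-> i] := Rintegral_adiff k.*2 h t; rewrite -RintegralZl //.
  apply: eq_Rintegral => w _; rewrite adiff_cos /t addNr mul0r cos0 mulr1.
  by rewrite mulrA -exprMn mulrNN mulr1 expr1n mul1r.
pose p : {poly R} := \poly_(j < k.*2) Re (a j).
pose mono s := Re (a k.*2) * s ^+ k.*2.
have dist s : `|s| <= 1 ->
    `|v s - (p.[s] + mono s)| <= 2 * K * `|s| ^+ k.*2.+1.
  move=> s1; have := @entire_tail _ _ _ K s%:C%C k.*2.+1 eF aK.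
  rewrite normcC => /(_ s1); apply: le_trans.
  apply: le_trans (normc_Re _); rewrite vE.
  have psE n : Re (psum a s%:C%C n) = \sum_(j < n) Re (a j) * s ^+ j.
    rewrite /psum; elim: n => [|n IH]; first by rewrite !big_ord0.
    rewrite !big_ord_recr ReD IH -rmorphXn ReM /=; congr (_ + _); ring.
  have -> : Re (F s%:C%C - psum a s%:C%C k.*2.+1) =
      Re (F s%:C%C) - Re (psum a s%:C%C k.*2.+1).
    by rewrite ReD; congr (_ + _); case: (psum _ _ _).
  rewrite psE big_ord_recr /= horner_poly //.
have tj j : (j <= k.*2)%N -> `|t + j%:R * h| <= k%:R * h.
  move=> jk; rewrite /t; have : j%:R <= k%:R + k%:R :> R.
    by rewrite -natrD ler_nat addnn.
  have : 0 <= j%:R :> R by [].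
  rewrite ler_norml; move: (j%:R : R) (k%:R : R) => x y x0 xy.
  apply/andP; split; nra.
have e1 : adiff k.*2 h v t =
    adiff k.*2 h (fun s => v s - (p.[s] + mono s)) t + adiff k.*2 h mono t.
  rewrite adiffB.
  have -> : adiff k.*2 h (fun s => p.[s] + mono s) t = adiff k.*2 h mono t.
    have := @adiffB _ k.*2 h (fun s => p.[s] + mono s) mono t.
    rewrite (@eq_adiff _ _ _ _ (horner p)) => [|s]; last by rewrite addrK.
    by rewrite adiff_poly ?size_poly // => /esym/eqP; rewrite subr_eq0 => /eqP.
  by rewrite subrK.
have kh0 : 0 <= k%:R * h by rewrite mulr_ge0 // ltW.
have b1 : `|adiff k.*2 h (fun s => v s - (p.[s] + mono s)) t| <=
    2 ^+ k.*2 * (2 * K * (k%:R * h) ^+ k.*2.+1).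
  apply: adiff_le => j jk; have tjk := tj j jk.
  apply: le_trans (dist _ (le_trans tjk kh)) _.
  apply: ler_wpM2l; first by rewrite mulr_ge0.
  by rewrite lerXn2r ?nnegrE.
have b2 : `|adiff k.*2 h mono t| <= 2 ^+ k.*2 * (normc (a k.*2) * (k%:R * h) ^+ k.*2).
  apply: adiff_le => j jk; have tjk := tj j jk.
  rewrite /mono normrM normrX; apply: ler_pM.
  - exact: normr_ge0.
  - by rewrite exprn_ge0.
  - exact: normc_Re.
  - by rewrite lerXn2r ?nnegrE.
apply: le_trans (ler_norm _) _; rewrite normrM normrX normrN1 expr1n mul1r e1.
apply: le_trans (ler_normD _ _) _; apply: le_trans (lerD b1 b2) _.
rewrite le_eqVlt; apply/orP; left; apply/eqP.
have -> : (k.*2)%:R ^+ k.*2 = 2 ^+ k.*2 * k%:R ^+ k.*2 :> R.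
  by rewrite -exprMn -natrM mul2n.
by rewrite !exprMn !exprS; ring.
Qed.

(** Truncation makes every exponential moment finite; the bounds below do not
    depend on the truncation level. *)
Definition truncation (c : R) (w : T) : R := if `|Y w| <= c then Y w else 0.

Lemma measurable_truncation c : measurable_fun [set: T] (truncation c).
Proof.
apply: measurable_fun_ifT => //.
apply: measurable_fun_ler => //.
by apply: (@measurable_fun_continuous_comp (fun y => `|y|)); exact: norm_continuous.
Qed.

Lemma truncation_le c w : 0 <= c -> `|truncation c w| <= c.
Proof. by rewrite /truncation; case: ifP => // _ c0; rewrite normr0. Qed.

Lemma intble_truncationX c j : 0 <= c -> intble P (fun w => truncation c w ^+ j).
Proof.
move=> c0; apply: (@intble_bounded _ _ _ _ _ (c ^+ j)) => [|w].
  by apply: measurable_funX; exact: measurable_truncation.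
by rewrite normrX lerXn2r ?nnegrE // truncation_le.
Qed.

(** On the truncation event [(h Y)^2] is at most [4 (2 - 2 cos (h Y))] for small
    [h]; it remains to let [h] tend to zero. *)
Lemma even_moment_le k c : 0 < c ->
  \int[P]_w (truncation c w ^+ k.*2) <= 4 ^+ k * (normc (a k.*2) * (k.*2)%:R ^+ k.*2).
Proof.
move=> c0; have [C hC] := integral_one_sub_cos_le k.
have [del d0 hd] := @one_sub_cos_ge R.
apply/ler_addgt0Pr => e e0.
pose C' : R := 4 ^+ k * `|C| + 1.
have C'0 : 0 < C' by rewrite ltr_wpDl // mulr_ge0 // exprn_ge0.
pose h := Num.min (del / c) (Num.min (k.+1%:R^-1) (e / C')).
have h0 : 0 < h.
  rewrite !lt_min; apply/and3P; split; last exact: divr_gt0.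
    exact: divr_gt0.
  by rewrite invr_gt0.
have h1 : h * c <= del by rewrite -ler_pdivlMr // ge_min lexx.
have h2 : k%:R * h <= 1.
  have : h <= k.+1%:R^-1 by rewrite !ge_min lexx !orbT.
  rewrite -[k.+1%:R^-1]mul1r ler_pdivlMr // -natr1.
  have : 0 <= k%:R :> R by []. by nra.
have h3 : h * C' <= e by rewrite -ler_pdivlMr // !ge_min lexx !orbT.
have hk0 : 0 < h ^+ k.*2 by rewrite exprn_gt0.
rewrite -(ler_pM2l hk0) -RintegralZl //; last exact/intble_truncationX/ltW.
have ic : intble P (fun w => (2 - 2 * cos (h * Y w)) ^+ k).
  have [_] := Rintegral_adiff k.*2 h (- (k%:R * h)).
  move=> /(intbleZ ((-1) ^+ k)); congr (intble _ _); apply/funext => w.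
  rewrite adiff_cos addNr mul0r cos0 mulr1 mulrA -exprMn mulrNN mulr1 expr1n.
  by rewrite mul1r.
apply: (@le_trans _ _ (\int[P]_w (4 ^+ k * (2 - 2 * cos (h * Y w)) ^+ k))).
  apply: le_intble.
  - by apply: intbleZ; exact/intble_truncationX/ltW.
  - exact: intbleZ.
  - move=> w; have cle : 0 <= 2 - 2 * cos (h * Y w) by have := cos_le1 (h * Y w); lra.
    rewrite -!exprMn -mul2n exprM; apply: lerXn2r; rewrite ?nnegrE ?sqr_ge0 ?mulr_ge0 //.
    rewrite /truncation; case: ifP => Yc; last first.
      by rewrite mulr0 expr0n /= mulr_ge0.
    apply: hd; rewrite normrM gtr0_norm //; apply: le_trans h1.
    by rewrite ler_wpM2l // ltW.
rewrite RintegralZl //.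
have k4 : 0 <= 4 ^+ k :> R by rewrite exprn_ge0.
apply: le_trans (ler_wpM2l k4 (hC h h0 h2)) _.
rewrite mulrCA ler_wpM2l ?(ltW hk0) // mulrDr lerD2l.
apply: le_trans h3; rewrite mulrA [leRHS]mulrC ler_wpM2r ?(ltW h0) // /C'.
by have := ler_wpM2l k4 (ler_norm C); lra.
Qed.

End moments.

Section exponential_moments.
Context d (T : measurableType d) {R : realType} (P : probability T R).
Variable Y : T -> R.
Hypothesis mY : measurable_fun [set: T] Y.
Variables (a : nat -> R[i]) (F : R[i] -> R[i]).
Hypothesis eF : entire a F.
Hypothesis FE : forall t : R,
  F t%:C%C = cexpectation P (fun w => cexp ('i * (t * Y w)%:C)%C).

Lemma expR_tail (x : R) N :
  expR x <= \sum_(j < N) x ^+ j / j`!%:R + 2^-1 ^+ N * expR (2 * `|x|).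
Proof.
have := @cexp_tail R x%:C%C N; rewrite normcC.
have -> : psum (@cexp_coeff R) x%:C%C N = (\sum_(j < N) x ^+ j / j`!%:R)%:C%C.
  rewrite /psum rmorph_sum; apply: eq_bigr => j _.
  by rewrite /= rmorphM rmorphXn mulrC.
have -> : cexp x%:C%C = (expR x)%:C%C by rewrite cexpE /= cos0 sin0 mulr0 mulr1.
by rewrite -rmorphB normcC => /(le_trans (ler_norm _)); rewrite lerBlDl.
Qed.

Lemma natX_le_fact j : j%:R ^+ j <= expR 1 ^+ j * j`!%:R :> R.
Proof.
case: j => [|j]; first by rewrite !expr0 mul1r fact0.
rewrite -ler_pdivrMr ?ltr0n ?fact_gt0 // -expRM_natl mulr1.
by apply: le_trans (expR_ge1Dxn j (ler0n R j.+1)); rewrite lerDr.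
Qed.

Lemma intble_expR_bounded (Z : T -> R) c : measurable_fun [set: T] Z ->
  (forall w, `|Z w| <= c) -> intble P (fun w => expR (Z w)).
Proof.
move=> mZ Zc; apply: (@intble_bounded _ _ _ _ _ (expR c)).
  by apply: measurableT_comp => //; exact: measurable_expR.
by move=> w; rewrite ger0_norm ?expR_ge0 // ler_expR (le_trans (ler_norm _)).
Qed.

(** Symmetrizing in the sign of the exponent leaves even moments only, whose
    bounds by the coefficients of an entire series sum up, since [j ^ j] is at most
    [e ^ j] times [j!]. *)
Lemma exp_truncation_le (r : R) : 0 <= r -> exists C : R, forall c, 0 < c ->
  \int[P]_w (expR (r * truncation Y c w) + expR (- r * truncation Y c w)) <= C.
Proof.
move=> r0; pose e1 : R := expR 1.
have e10 : 0 < e1 by exact: expR_gt0.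
(* A factor [2] compensates the constant in the bound of the moments, another one
   makes the sum geometric. *)
have q0 : 0 <= 4 * e1 * r by rewrite !mulr_ge0 // ltW.
have [K aK] := eF.1 _ q0.
have K0 : 0 <= K by apply: le_trans (aK 0%N); rewrite expr0 mulr1 normc_ge0.
exists (4 * K) => c c0; pose Z := truncation Y c.
have mZ : measurable_fun [set: T] Z by exact: measurable_truncation.
have Zc w : `|Z w| <= c by apply: truncation_le; exact: ltW.
have iX j : intble P (fun w => Z w ^+ j) by apply: intble_truncationX => //; exact: ltW.
have iS N (s : R) : intble P (fun w => \sum_(j < N) (s * Z w) ^+ j / j`!%:R) /\
    \int[P]_w (\sum_(j < N) (s * Z w) ^+ j / j`!%:R) =
    \sum_(j < N) s ^+ j / j`!%:R * \int[P]_w (Z w ^+ j).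
  elim: N => [|N [IH1 IH2]].
    have -> : (fun w => \sum_(j < 0) (s * Z w) ^+ j / j`!%:R) = cst 0.
      by apply/funext => w; rewrite big_ord0.
    by rewrite big_ord0 Rintegral_prob_cst; split=> //; exact: intble_cst.
  have -> : (fun w => \sum_(j < N.+1) (s * Z w) ^+ j / j`!%:R) =
     (fun w => \sum_(j < N) (s * Z w) ^+ j / j`!%:R + s ^+ N / N`!%:R * Z w ^+ N).
    by apply/funext => w; rewrite big_ord_recr /= exprMn; congr (_ + _); ring.
  have iZ : intble P (fun w => s ^+ N / N`!%:R * Z w ^+ N) by exact: intbleZ.
  split; first exact: intbleD.
  rewrite RintegralD // IH2 big_ord_recr /= RintegralZl //; exact: iX.
have bound j : (r ^+ j + (- r) ^+ j) / j`!%:R * \int[P]_w (Z w ^+ j) <=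
    2 * K * 2^-1 ^+ j.
  case oj : (odd j).
    rewrite exprNn -signr_odd oj expr1 mulN1r subrr !mul0r.
    by apply: mulr_ge0; [exact: mulr_ge0 | rewrite exprn_ge0].
  rewrite exprNn -signr_odd oj expr0 mul1r -(even_halfK (negbT oj)).
  set k := j./2; have := even_moment_le mY eF FE k c0; rewrite -/Z => mom.
  have f0 : 0 < (k.*2)`!%:R :> R by rewrite ltr0n fact_gt0.
  have rk : 0 <= r ^+ k.*2 by rewrite exprn_ge0.
  have := aK k.*2; have := natX_le_fact k.*2; rewrite -/e1 => nf ak.
  have -> : (r ^+ k.*2 + r ^+ k.*2) / (k.*2)`!%:R * \int[P]_w Z w ^+ k.*2 =
    2 * r ^+ k.*2 * ((k.*2)`!%:R^-1 * \int[P]_w Z w ^+ k.*2) by ring.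
  have four : 4 ^+ k = 2 ^+ k.*2 :> R by rewrite -mul2n exprM; congr (_ ^+ _); ring.
  have m2 : (k.*2)`!%:R^-1 * \int[P]_w Z w ^+ k.*2 <=
      2 ^+ k.*2 * (normc (a k.*2) * e1 ^+ k.*2).
    rewrite mulrC ler_pdivrMr //; apply: le_trans mom _; rewrite four -mulrA.
    rewrite ler_wpM2l ?exprn_ge0 // -mulrA ler_wpM2l ?normc_ge0 //.
  apply: le_trans (ler_wpM2l _ m2) _; first by rewrite mulr_ge0.
  rewrite -!mulrA ler_wpM2l // exprVn ler_pdivlMr ?exprn_gt0 //.
  apply: le_trans ak; rewrite !exprMn -four; have -> : 4 ^+ k.*2 = 2 ^+ k.*2 * 4 ^+ k :> R.
    by rewrite four -exprMn; congr (_ ^+ _); ring.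
  by rewrite four le_eqVlt; apply/orP; left; apply/eqP; ring.
apply/ler_addgt0Pr => e e0.
have [N hN] := half_pow_small (2 * expR (2 * (r * c))) e0.
have iE s : intble P (fun w => expR (s * Z w)).
  apply: (@intble_expR_bounded (fun w => s * Z w) (`|s| * c)).
    by apply: measurable_funM => //; exact: measurable_cst.
  by move=> w; rewrite normrM ler_wpM2l.
have [i1 E1] := iS N r; have [i2 E2] := iS N (- r).
set B := 2 * expR (2 * (r * c)) * 2^-1 ^+ N in hN *.
apply: (@le_trans _ _ (\int[P]_w (\sum_(j < N) (r * Z w) ^+ j / j`!%:R +
   \sum_(j < N) (- r * Z w) ^+ j / j`!%:R + B))).
  apply: le_intble; first exact: intbleD.
    by apply: intbleD; [exact: intbleD | exact: intble_cst].
  move=> w; have := expR_tail (r * Z w) N; have := expR_tail (- r * Z w) N.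
  have le1 : expR (2 * `|r * Z w|) <= expR (2 * (r * c)).
    by rewrite ler_expR ler_wpM2l // normrM ger0_norm // ler_wpM2l.
  have -> : `|- r * Z w| = `|r * Z w| by rewrite mulNr normrN.
  have p0 : 0 <= 2^-1 ^+ N :> R by rewrite exprn_ge0.
  have := ler_wpM2l p0 le1; rewrite /B.
  move: (\sum_(j < N) _) (\sum_(j < N) _) (expR _) (expR _) (expR _) (expR _) => *.
  lra.
rewrite RintegralD //; [|exact: intbleD|exact: intble_cst].
rewrite RintegralD // E1 E2 Rintegral_prob_cst -big_split /=.
apply: lerD; last exact: hN.
apply: (@le_trans _ _ (\sum_(0 <= j < N) 2 * K * 2^-1 ^+ j)).
  rewrite big_mkord; apply: ler_sum => j _; apply: le_trans (bound j).
  by rewrite -mulrDl -mulrDl.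
rewrite -mulr_sumr.
have K2 : 0 <= 2 * K by rewrite mulr_ge0.
apply: le_trans (ler_wpM2l K2 (@geometric_half_le R 0 N (leq0n N))) _.
by rewrite expr0; lra.
Qed.

(** Monotone convergence along the truncation levels. *)
Lemma intble_expR_norm (r : R) : 0 <= r -> intble P (fun w => expR (r * `|Y w|)).
Proof.
move=> r0; have [C hC] := exp_truncation_le r0.
pose g (n : nat) w : R := if `|Y w| <= n%:R then expR (r * `|Y w|) else 0.
have mE : measurable_fun [set: T] (fun w => expR (r * `|Y w|)).
  apply: (@measurable_fun_continuous_comp _ _ _ Y mY (fun y => expR (r * `|y|))) => y.
  apply: continuous_comp; last exact: continuous_expR.
  by apply: cvgM; [exact: cvg_cst | exact: norm_continuous].
have mg n : measurable_fun [set: T] (g n).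
  apply: measurable_fun_ifT => //; apply: measurable_fun_ler => //.
  by apply: (@measurable_fun_continuous_comp _ _ _ Y mY (fun y => `|y|)); exact: norm_continuous.
have g0 n w : 0 <= g n w by rewrite /g; case: ifP => // _; exact: expR_ge0.
have gn n w : `|g n w| <= expR (r * n%:R).
  rewrite ger0_norm // /g; case: ifP => [h|_]; last exact: expR_ge0.
  by rewrite ler_expR ler_wpM2l.
have ig n : intble P (g n) by exact: intble_bounded (mg n) (gn n).
have gC n : \int[P]_w g n w <= C.
  case: n => [|n].
    apply: le_trans (hC 1 ltr01); apply: le_intble; first exact: ig.
      apply: intbleD; [apply: (@intble_expR_bounded _ (`|r| * 1))
                      |apply: (@intble_expR_bounded _ (`|- r| * 1))];
      try (by apply: measurable_funM => //; exact: measurable_truncation);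
      by move=> w; rewrite normrM ler_wpM2l // truncation_le.
    move=> w; rewrite /g; case: ifP => [|_]; last by rewrite addr_ge0 // expR_ge0.
    rewrite normr_le0 => /eqP Y0; rewrite /truncation Y0 normr0 mulr0 ler01 mulr0 mulr0.
    by rewrite expR0; lra.
  apply: le_trans (hC n.+1%:R (ltr0n R n.+1)); apply: le_intble; first exact: ig.
    apply: intbleD; [apply: (@intble_expR_bounded _ (`|r| * n.+1%:R))
                    |apply: (@intble_expR_bounded _ (`|- r| * n.+1%:R))];
    try (by apply: measurable_funM => //; exact: measurable_truncation);
    by move=> w; rewrite normrM ler_wpM2l // truncation_le.
  move=> w; rewrite /g /truncation; case: ifP => h; last by rewrite addr_ge0 // expR_ge0.
  have [Y0|Y0] := leP 0 (Y w).
    by rewrite ger0_norm // lerDl expR_ge0.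
  by rewrite ltr0_norm // mulrN -mulNr lerDr expR_ge0.
apply/integrableP; split; first exact/measurable_EFinP.
have -> : (\int[P]_w `|(EFin \o (fun w => expR (r * `|Y w|))) w| =
    \int[P]_w limn (fun n => (g n w)%:E))%E.
  apply: eq_integral => w _; rewrite /= ger0_norm ?expR_ge0 //.
  apply/esym/cvg_lim => //; apply: cvg_near_cst.
  exists (Num.truncn `|Y w|).+1 => // n /= hn; rewrite /g ifT //.
  have /andP[_ h2] := truncn_itv (normr_ge0 (Y w)).
  by apply: ltW; apply: lt_le_trans h2 _; rewrite ler_nat.
have mono : forall w, [set: T] w -> {homo (fun n => (g n w)%:E) : n m / (n <= m)%N >-> (n <= m)%E}.
  move=> w _ i j ij; rewrite lee_fin /g; case: ifP => [h|_]; last exact: g0.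
  by rewrite ifT //; apply: le_trans h _; rewrite ler_nat.
have mEg n : measurable_fun [set: T] (fun w => (g n w)%:E) by exact/measurable_EFinP.
have gE0 n w : [set: T] w -> (0 <= (g n w)%:E)%E by rewrite lee_fin.
rewrite (monotone_convergence P measurableT mEg gE0 mono).
have gE n : (\int[P]_w (g n w)%:E = (\int[P]_w g n w)%:E)%E.
  by rewrite /Rintegral fineK //; exact: (integrable_fin_num measurableT (ig n)).
apply: (@le_lt_trans _ _ C%:E); last exact: ltry.
apply: lime_le.
  apply: ereal_nondecreasing_is_cvgn => i j ij.
  apply: ge0_le_integral => //; try exact: gE0; try exact: mEg.
  by move=> w wT; exact: mono wT _ _ ij.
by apply: nearW => n; rewrite gE lee_fin.
Qed.

Definition mgf (z : R[i]) : R[i] := cexpectation P (fun w => cexp (z * (Y w)%:C)%C).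

Definition mgf_coeff (k : nat) : R[i] := ((\int[P]_w (Y w ^+ k)) / k`!%:R)%:C%C.

Lemma intble_moment k : intble P (fun w => Y w ^+ k).
Proof.
have i1 := intbleZ k`!%:R (intble_expR_norm ler01); apply: (intble_dom _ i1).
  exact: measurable_funX.
move=> w; rewrite normrX mul1r.
case: k {i1} => [|k]; first by rewrite expr0 fact0 mul1r -expR0 ler_expR.
rewrite mulrC -ler_pdivrMr ?ltr0n ?fact_gt0 //.
by apply: le_trans (expR_ge1Dxn k (normr_ge0 (Y w))); rewrite lerDr.
Qed.

Lemma cintble_mgf z : cintble P (fun w => cexp (z * (Y w)%:C)%C).
Proof.
apply: (cintble_dom _ (intble_expR_norm (normc_ge0 z))).
  have re w : Re (z * (Y w)%:C)%C = Re z * Y w by rewrite ReM /= mulr0 subr0.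
  have im w : Im (z * (Y w)%:C)%C = Im z * Y w by rewrite ImM /= mulr0 add0r.
  have m1 : measurable_fun [set: T] (fun w => expR (Re z * Y w)).
    by apply: measurableT_comp; [exact: measurable_expR | exact: measurable_funM].
  split; under eq_fun do rewrite cexpE /= re im;
    apply: measurable_funM => //; apply: measurableT_comp; try exact: measurable_funM;
    apply: continuous_measurable_fun; [exact: continuous_cos | exact: continuous_sin].
move=> w; rewrite normc_cexp ler_expR ReM /= mulr0 subr0.
apply: le_trans (ler_norm _) _; rewrite normrM ler_wpM2r //; exact: normc_Re.
Qed.

(** The exponential tail bound is integrable, so the expectation may be taken term
    by term. *)
Lemma entire_mgf : entire mgf_coeff mgf.
Proof.
have pm z N : psum mgf_coeff z N =
    cexpectation P (fun w => psum (@cexp_coeff R) (z * (Y w)%:C)%C N) /\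
    cintble P (fun w => psum (@cexp_coeff R) (z * (Y w)%:C)%C N).
  have i1 k : cintble P (fun w => (Y w ^+ k)%:C%C).
    by split => /=; [exact: intble_moment | exact: intble_cst].
  elim: N => [|N [IH1 IH2]].
    have -> : (fun w => psum (@cexp_coeff R) (z * (Y w)%:C)%C 0) = fun=> 0.
      by apply/funext => w; rewrite /psum big_ord0.
    by rewrite /psum big_ord0 cexpectation_cst; split=> //; exact: cintble_cst.
  have -> : (fun w => psum (@cexp_coeff R) (z * (Y w)%:C)%C N.+1) =
      (fun w => psum (@cexp_coeff R) (z * (Y w)%:C)%C N +
         cexp_coeff N * z ^+ N * (Y w ^+ N)%:C%C).
    apply/funext => w; rewrite /psum big_ord_recr /=; congr (_ + _).
    by rewrite exprMn rmorphXn mulrA.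
  split; last by apply: cintbleD => //; exact: cintbleZ.
  rewrite cexpectationD //; last exact: cintbleZ.
  rewrite cexpectationZ // -IH1 /psum big_ord_recr /=; congr (_ + _).
  have -> : cexpectation P (fun w => (Y w ^+ N)%:C%C) = (\int[P]_w (Y w ^+ N))%:C%C.
    by apply: complex_ext => //=; rewrite Rintegral_prob_cst.
  by rewrite /mgf_coeff rmorphM /cexp_coeff; ring.
split=> [r r0|z].
  exists (\int[P]_w expR (r * `|Y w|)) => k.
  have f0 : 0 <= k`!%:R^-1 :> R by rewrite invr_ge0.
  rewrite normcC normrM (ger0_norm f0) -mulrA.
  have iN : intble P (fun w => `|Y w ^+ k|).
    by have := integrable_norm (intble_moment k).
  apply: (@le_trans _ _ (\int[P]_w (`|Y w ^+ k| * (k`!%:R^-1 * r ^+ k)))).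
    rewrite RintegralZr // ler_wpM2r ?mulr_ge0 ?invr_ge0 ?exprn_ge0 //.
    exact: le_normr_Rintegral (intble_moment k).
  apply: le_intble; [|exact: intble_expR_norm|].
    by under eq_fun do rewrite mulrC; exact: intbleZ.
  move=> w; rewrite normrX mulrCA mulrC -exprMn [`|_| * r]mulrC.
  have rY : 0 <= r * `|Y w| by rewrite mulr_ge0.
  case: k {iN f0} => [|k]; first by rewrite expr0 mul1r fact0 invr1 -expR0 ler_expR.
  by apply: le_trans (expR_ge1Dxn k rY); rewrite lerDr.
move=> e e0.
have i2 : intble P (fun w => expR (2 * normc z * `|Y w|)).
  by apply: intble_expR_norm; rewrite mulr_ge0 // normc_ge0.
have [N hN] := half_pow_small (\int[P]_w expR (2 * normc z * `|Y w|)) e0.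
exists N => n Nn; apply: le_trans (hN n Nn).
have [-> ic] := pm z n; rewrite -normcN opprB -cexpectationB //; last exact: cintble_mgf.
rewrite -RintegralZr //; apply: normc_cexpectation_le.
- by apply: cintbleB => //; exact: cintble_mgf.
- by under eq_fun do rewrite mulrC; exact: intbleZ.
- move=> w; apply: le_trans (cexp_tail _ _) _.
  by rewrite ComplexField.Normc.normcM normcC mulrA mulrC.
Qed.

(** Equality on the imaginary axis propagates to the plane. *)
Lemma entire_eq_mgf z : F z = mgf ('i * z)%C.
Proof.
have eG := entire_comp 'i%C (ltnSn 0) entire_mgf.
have ab := entire_unique eF eG.
have {}ab : a = fun k => if (1 %| k)%N then mgf_coeff (k %/ 1)%N * 'i%C ^+ (k %/ 1) else 0.
  apply: ab => t; rewrite FE /mgf expr1; apply: eq_cexpectation => w.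
  by rewrite rmorphM mulrA.
have := eF.2 z; rewrite ab => c1; have := eG.2 z; rewrite expr1.
exact: ccvg_unique.
Qed.

(** The ridge property of analytic characteristic functions: at real arguments the
    moment generating function integrates the moduli. *)
Lemma normc_ridge z : normc (F z) <= normc (F ('i * (Im z)%:C)%C).
Proof.
rewrite !entire_eq_mgf; have re : Re ('i * z)%C = - Im z by case: (z) => x y /=; ring.
have re' : ('i * ('i * (Im z)%:C) = (- Im z)%:C)%C.
  by apply: complex_ext => /=; ring.
rewrite re'.
have i1 := cintble_mgf (- Im z)%:C%C.
apply: (@le_trans _ _ (Re (mgf (- Im z)%:C%C))); last first.
  exact: le_trans (ler_norm _) (normc_Re _).
rewrite Re_cexpectation; apply: normc_cexpectation_le.
- exact: cintble_mgf.
- by case: i1.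
- move=> w; rewrite normc_cexp cexpE /= !mulr0 !mul0r oppr0 !addr0 cos0 mulr1.
  by rewrite ReM re /= mulr0 subr0.
Qed.

End exponential_moments.

(** * The theorem of Marcinkiewicz *)

Section ridge_polynomials.
Context {R : realType}.

Lemma coef_le0_of_nonpos (q : {poly R}) n : (size q <= n.+2)%N ->
  (forall r, 1 <= r -> q.[r] <= 0) -> q`_n.+1 <= 0.
Proof.
move=> sq hq; rewrite leNgt; apply/negP => c0.
pose S := \sum_(j < n.+1) `|q`_j|.
have S0 : 0 <= S by exact: sumr_ge0.
pose r := 1 + S / q`_n.+1.
have r1 : 1 <= r by rewrite lerDl divr_ge0 // ltW.
have r0 : 0 < r by exact: lt_le_trans r1.
have := hq r r1; rewrite (horner_coef_wide _ sq) big_ord_recr /= => h.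
have : - (S * r ^+ n) <= \sum_(j < n.+1) q`_j * r ^+ j.
  rewrite lerNl -sumrN mulr_suml; apply: ler_sum => j _.
  apply: le_trans (ler_norm _) _; rewrite normrN normrM [X in _ * X]ger0_norm.
    by rewrite ler_wpM2l // ler_weXn2l // -ltnS.
  by rewrite exprn_ge0 // ltW.
have : q`_n.+1 * r ^+ n.+1 = (q`_n.+1 + S) * r ^+ n.
  by rewrite exprS /r mulrA; congr (_ * _); field; rewrite gt_eqF.
have : 0 < r ^+ n by rewrite exprn_gt0.
move: h; move: (r ^+ n) (r ^+ n.+1) (\sum_(_ < _) _) => x y z; nra.
Qed.

Lemma ex_unimodular_root (c : R[i]) k : c != 0 -> exists2 w : R[i],
  normc w = 1 & c * w ^+ k.+1 = (normc c)%:C%C.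
Proof.
move=> c0; pose w := k.+1.-root ((normc c)%:C%C / c); exists w.
  have : normc w ^+ k.+1 = 1.
    rewrite -normcX rootCK // ComplexField.Normc.normcM ComplexField.Normc.normcV.
    by rewrite normcC ger0_norm ?normc_ge0 // mulfV // normc_eq0.
  move=> /eqP; rewrite pexprn_eq1 ?normc_ge0 //= => /eqP //.
by rewrite rootCK // mulrC divfK.
Qed.

(** Along two consecutive directions in which the leading term is positive, the
    bound by the value on the imaginary axis forces both directions to be
    imaginary; in degree at least three their angle is too small for that. *)
Lemma ridge_size_le3 (p : {poly R[i]}) :
  (forall z, Re p.[z] <= Re p.[('i * (Im z)%:C)%C]) -> (size p <= 3)%N.
Proof.
move=> ridge; rewrite leqNgt; apply/negP => sp.
have [k sk] : exists k, size p = k.+4.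
  by exists (size p - 4)%N; move: sp; clear; lia.
pose n := k.+2; have sn : size p = n.+2 by [].
pose c := p`_n.+1.
have c0 : c != 0 by rewrite /c -[n.+1]/(n.+2.-1) -sn -lead_coefE lead_coef_eq0 -size_poly_eq0 sn.
have key w : normc w = 1 -> c * w ^+ n.+1 = (normc c)%:C%C -> Re w = 0.
  move=> w1 cw; pose q : {poly R} := \poly_(j < n.+2)
    (Re (p`_j * w ^+ j) - Re (p`_j * ('i * (Im w)%:C)%C ^+ j)).
  have Re_line z (r : R) : Re p.[r%:C%C * z] = \sum_(j < n.+2) Re (p`_j * z ^+ j) * r ^+ j.
    rewrite horner_coef sn; elim: n.+2 => [|N IH]; first by rewrite !big_ord0.
    rewrite !big_ord_recr ReD IH; congr (_ + _).
    by rewrite exprMn -rmorphXn mulrCA ReM /= mul0r subr0 mulrC.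
  have : q`_n.+1 <= 0.
    apply: coef_le0_of_nonpos => [|r r1]; first exact: size_poly.
    have := ridge (r%:C%C * w).
    have -> : ('i * (Im (r%:C%C * w))%:C)%C = r%:C%C * ('i * (Im w)%:C)%C.
      by apply: complex_ext; case: (w) => x y /=; ring.
    rewrite !Re_line -subr_le0 -sumrB horner_poly; apply: le_trans.
    rewrite le_eqVlt; apply/orP; left; apply/eqP.
    by apply: eq_bigr => j _; rewrite mulrBl.
  rewrite coef_poly ltnSn -/c cw /= subr_le0 => h.
  have : normc c <= normc c * `|Im w| ^+ n.+1.
    apply: le_trans h _; apply: le_trans (ler_norm _) _; apply: le_trans (normc_Re _) _.
    rewrite ComplexField.Normc.normcM normcX ComplexField.Normc.normcM normcC.
    by rewrite /= expr0n expr1n add0r sqrtr1 mul1r.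
  have nc0 : 0 < normc c by rewrite lt_neqAle normc_ge0 eq_sym normc_eq0 c0.
  rewrite ler_pMr // => Imw.
  have Im1 : 1 <= `|Im w|.
    rewrite leNgt; apply/negP => Im1.
    by move: Imw; rewrite leNgt exprn_ilt1.
  have : Re w ^+ 2 + Im w ^+ 2 = 1.
    have := add_Re2_Im2 w; rewrite normr_normc w1 expr1n => -[].
    by [].
  have Im2 : 1 <= Im w ^+ 2.
    rewrite -[leRHS]real_normK ?num_real //; exact: exprn_ege1.
  move=> e.
  apply/eqP; rewrite -sqrf_eq0 eq_le sqr_ge0 andbT; lra.
have [w w1 cw] := ex_unimodular_root n c0.
(* The angle [2 pi / deg p] lies strictly between [0] and [pi]. *)
pose b : R := pi / n.+1%:R *+ 2.
pose rot : R[i] := cexp ('i * b%:C)%C.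
have rotn : rot ^+ n.+1 = 1.
  have -> : rot ^+ n.+1 = cexp ('i * (b * n.+1%:R)%:C)%C.
    rewrite /rot; elim: (n.+1) => [|N IH]; first by rewrite expr0 mulr0 mulr0 cexp0.
    rewrite exprS IH -cexpD; congr cexp; rewrite -mulrDr -rmorphD; congr (_ * _%:C)%C.
    by rewrite -natr1; ring.
  have -> : b * n.+1%:R = pi *+ 2 by rewrite /b mulrnAl divfK // pnatr_eq0.
  by rewrite cexp_i cos2pi sin2pi.
have r0 := key w w1 cw.
have := key (w * rot); rewrite ComplexField.Normc.normcM w1 normc_cexp_i mulr1.
rewrite exprMn mulrA rotn mulr1 => /(_ erefl cw).
rewrite ReM r0 mul0r sub0r /rot cexp_i /= => /eqP; rewrite oppr_eq0 mulf_eq0.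
have Im0 : Im w != 0.
  apply/eqP => Imw; move: w1; rewrite (@complex_ext _ w 0 r0 Imw).
  by rewrite ComplexField.Normc.normc0 => /eqP; rewrite eq_sym oner_eq0.
rewrite (negbTE Im0) /= => sb; suff : 0 < sin b by rewrite (eqP sb) ltxx.
apply: sin_gt0_pi; rewrite /b -mulrnAr mulr_gt0 ?pi_gt0 ?mulrn_wgt0 ?invr_gt0 //=.
rewrite gtr_pMr ?pi_gt0 // -mulr_natl ltr_pdivrMr // mul1r ltr_nat.
by [].
Qed.

End ridge_polynomials.

Section marcinkiewicz.
Context d (T : measurableType d) {R : realType} (P : probability T R).
Variable Y : T -> R.
Hypothesis mY : measurable_fun [set: T] Y.

Lemma charfunN t :
  cexpectation P (fun w => cexp ('i * (- t * Y w)%:C)%C) =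
  (cexpectation P (fun w => cexp ('i * (t * Y w)%:C)%C))^*%C.
Proof.
have ReJ (z : R[i]) : Re z^*%C = Re z by case: z.
have ImJ (z : R[i]) : Im z^*%C = - Im z by case: z.
apply: complex_ext; rewrite ?ReJ ?ImJ ?Re_cexpectation ?Im_cexpectation.
  by apply: eq_Rintegral => w _; rewrite !cexp_i /= mulNr cosN.
transitivity (\int[P]_w (-1 * Im (cexp ('i * (t * Y w)%:C)%C))).
  by apply: eq_Rintegral => w _; rewrite !cexp_i /= mulNr sinN mulN1r.
rewrite RintegralZl ?mulN1r //.
have mt : measurable_fun [set: T] (fun w => t * Y w) by exact: measurable_funM.
by have [] := cintble_cexp_i P mt.
Qed.

Lemma quadratic_nonpos (x y : R) : (forall t, x * t + y * t ^+ 2 <= 0) ->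
  x = 0 /\ y <= 0.
Proof.
move=> h; have y0 : y <= 0 by have := h 1; have := h (-1); rewrite sqrrN expr1n; lra.
split=> //; apply/eqP; apply/negP => /negP x0.
have := h (x / (1 - y)); have D0 : 0 < 1 - y by lra.
have -> : x * (x / (1 - y)) + y * (x / (1 - y)) ^+ 2 = x ^+ 2 / (1 - y) ^+ 2.
  by field; rewrite gt_eqF.
have x2 : 0 < x ^+ 2 by rewrite exprn_even_gt0 //= x0.
by rewrite leNgt (divr_gt0 x2 (exprn_gt0 2 D0)).
Qed.

(** Once the degree is at most two, [|u| <= 1] removes the real part of the linear
    coefficient and gives the sign of the quadratic one, and the Hermitian symmetry
    of [u] makes the quadratic coefficient real. *)
Lemma marcinkiewicz (P1 P2 : {poly R}) :
  (forall t : R, cexpectation P (fun w => cexp ('i * (t * Y w)%:C)%C) =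
     cexp (P1.[t] +i* P2.[t])%C) ->
  gaussian_real P Y.
Proof.
move=> hP; pose toC := real_complex R.
pose p : {poly R[i]} := map_poly toC P1 + 'i%C *: map_poly toC P2.
have pE (t : R) : p.[t%:C%C] = (P1.[t] +i* P2.[t])%C.
  rewrite hornerD hornerZ !horner_map /=.
  by apply: complex_ext => /=; ring.
have [a ea] := entire_cexp_poly p.
have FE (t : R) : cexp p.[t%:C%C] =
  cexpectation P (fun w => cexp ('i * (t * Y w)%:C)%C) by rewrite hP pE.
have sp : (size p <= 3)%N.
  apply: ridge_size_le3 => z.
  by have := normc_ridge mY ea FE z; rewrite !normc_cexp ler_expR.
have pq t : p.[t%:C%C] = p`_0 + p`_1 * t%:C%C + p`_2 * (t ^+ 2)%:C%C.
  rewrite (horner_coef_wide _ sp) !big_ord_recr big_ord0 /= add0r expr0 mulr1 expr1.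
  by rewrite rmorphXn.
have u0 : cexp p`_0 = 1.
  have := FE 0; rewrite pq expr0n !rmorph0 !mulr0 !addr0 => ->.
  rewrite -(cexpectation_cst P 1); apply: eq_cexpectation => w.
  by rewrite mul0r mulr0 cexp0.
pose u t := cexp (p`_1 * t%:C%C + p`_2 * (t ^+ 2)%:C%C).
have uE t : cexpectation P (fun w => cexp ('i * (t * Y w)%:C)%C) = u t.
  by rewrite -FE pq -addrA cexpD u0 mul1r.
have mt t : measurable_fun [set: T] (fun w => t * Y w) by exact: measurable_funM.
have [r1 r2] : Re p`_1 = 0 /\ Re p`_2 <= 0.
  apply: quadratic_nonpos => t.
  have : normc (u t) <= 1.
    rewrite -uE -(Rintegral_prob_cst P 1); apply: normc_cexpectation_le.
    - exact: cintble_cexp_i.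
    - exact: intble_cst.
    - by move=> w; rewrite normc_cexp_i.
  rewrite normc_cexp -expR0 ler_expR ReD !ReM /=; lra.
have i2 : Im p`_2 = 0.
  apply/eqP/negP => /negP i0.
  (* At this [t] the product [u t * u (- t)], a squared modulus, would have argument
   [1] or [-1]. *)
pose t : R := Num.sqrt (`|Im p`_2 *+ 2|^-1).
  have t2 : t ^+ 2 = `|Im p`_2 *+ 2|^-1 by rewrite sqr_sqrtr // invr_ge0.
  have uJ : u (- t) = (u t)^*%C.
    exact: etrans (esym (uE (- t))) (etrans (charfunN t) (congr1 _ (uE t))).
  have mulJ (z : R[i]) : Im (z * z^*%C) = 0 by case: z => x y /=; ring.
  have : Im (u t * u (- t)) = 0.
    exact: etrans (congr1 (fun z => Im (u t * z)) uJ) (mulJ (u t)).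
  rewrite /u -cexpD cexpE /= => /eqP; rewrite mulf_eq0 gt_eqF ?expR_gt0 //=.
  set X := Im (_ + _); have -> : X = Im p`_2 *+ 2 / `|Im p`_2 *+ 2|.
    rewrite /X sqrrN t2; case: (p`_1) => x1 y1; case: (p`_2) => x2 y2 /=; ring.
  have n0 : 0 < `|Im p`_2 *+ 2| by rewrite normr_gt0 mulrn_eq0.
  have s1 : sin 1 != 0 :> R by rewrite gt_eqF // sin2_gt0 // ltr01 ltr1n.
  have [x0|x0] := leP 0 (Im p`_2 *+ 2).
    by rewrite ger0_norm // divff ?(negbTE s1) // mulrn_eq0.
  by rewrite ltr0_norm // invrN mulrN divff ?mulrn_eq0 // sinN oppr_eq0 (negbTE s1).
exists (Im p`_1), (- Re p`_2 *+ 2); split; first by rewrite mulrn_wge0 // oppr_ge0.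
move=> t; rewrite uE /u; congr cexp.
move: r1 i2; case: (p`_1) => x1 y1; case: (p`_2) => x2 y2 /= -> ->.
by apply: complex_ext => /=; field.
Qed.

End marcinkiewicz.

(** * Gaussian distributions *)

Section one_dimensional_marginals.
Context (R : realType) (X : completeNormedModType R).
Context d (T : measurableType d) (P : probability T R).
Variable xi : {RV P >-> borel X}.

Lemma mdiff_charfun_line (f : dual X) M (h t : R) :
  mdiff (nseq M h) (fun s => charfun P xi (s *: f)) t =
  mdiff (nseq M (h *: f)) (charfun P xi) (t *: f).
Proof. by elim: M t => [//|M IH] t /=; rewrite !IH scalerDl. Qed.

Lemma charfun_line_continuous (f : dual X) :
  continuous (fun t : R => Re (charfun P xi (t *: f))) /\
  continuous (fun t : R => Im (charfun P xi (t *: f))).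
Proof.
have h (t e : R) : 0 < e -> \forall s \near t,
    normc (charfun P xi (t *: f) - charfun P xi (s *: f)) <= e.
  move=> e0; have [del d0 hd] := covariance_charfun xi e0.
  have f1 : 0 < `|f| ^+ 2 + 1 by rewrite ltr_wpDl // sqr_ge0.
  pose r := Num.min 1 (del / (`|f| ^+ 2 + 1)).
  have r0 : 0 < r by rewrite lt_min ltr01 divr_gt0.
  have rd : r * (`|f| ^+ 2 + 1) <= del by rewrite -ler_pdivlMr // ge_min lexx orbT.
  apply/nbhs_ballP; exists r => //= s; rewrite -ball_normE /= => ts.
  have ft : t *: f - s *: f = (t - s) *: f by rewrite scalerBl.
  suff : covariance xi ((t - s) *: f) ((t - s) *: f) < del.
    by have := hd (t *: f) (s *: f); rewrite ft.
  apply: (le_lt_trans (covariance_le xi ((t - s) *: f))).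
  have -> : `|(t - s) *: f| = `|t - s| * `|f| by rewrite normrZ.
  have t1 : `|t - s| < 1 by apply: lt_le_trans ts _; rewrite ge_min lexx.
  have n0 := normr_ge0 (t - s); have q0 := sqr_ge0 `|f|.
  move: ts t1 n0 q0 rd f1; rewrite exprMn.
  move: (`|t - s|) (`|f| ^+ 2) => x q xr x1 x0 q0 rd q1.
  have : x ^+ 2 <= x by rewrite expr2 ler_piMr // ltW.
  nra.
split=> t; apply/cvgrPdist_le => e e0; near=> s.
  have -> : Re (charfun P xi (t *: f)) - Re (charfun P xi (s *: f)) =
      Re (charfun P xi (t *: f) - charfun P xi (s *: f)).
    by case: (charfun _ _ _) => ? ?; case: (charfun _ _ _).
  by apply: le_trans (normc_Re _) _; near: s; exact: h.
have -> : Im (charfun P xi (t *: f)) - Im (charfun P xi (s *: f)) =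
    Im (charfun P xi (t *: f) - charfun P xi (s *: f)).
  by case: (charfun _ _ _) => ? ?; case: (charfun _ _ _).
by apply: le_trans (normc_Im _) _; near: s; exact: h.
Unshelve. all: by end_near. Qed.

Lemma gaussian_of_mdiff M :
  (forall H : seq (dual X), size H = M -> forall g, mdiff H (charfun P xi) g = 1) ->
  gaussian P xi.
Proof.
move=> hM f; have [cR cI] := charfun_line_continuous f.
have [|h t|P1 [P2 hP]] := @mdiff_eq1_exp_poly R M (fun t => charfun P xi (t *: f)) _ cR cI.
- rewrite scale0r -[RHS](cexpectation_cst P); apply: eq_cexpectation => w.
  by rewrite -[X in X%:C%C]/(0 : R) mulr0 cexp0.
- by rewrite mdiff_charfun_line hM // size_nseq.
apply: (@marcinkiewicz _ _ _ _ _ (measurable_RV_dual xi f) P1 P2) => t.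
by rewrite -hP.
Qed.

End one_dimensional_marginals.

Theorem theorem2p4 (R : realType) (X : completeNormedModType R)
  (X_separable : separable X) (X_quasireflexive : quasireflexive X)
  (n m : nat) (n_ge1 : (1 <= n)%N) (m_ge2 : (2 <= m)%N)
  (A : 'I_m -> 'I_n -> {linear X -> X})
  (A_continuous : forall p j, continuous (A p j))
  (A_ker : forall p j, A p j @^-1` [set 0] = [set 0])
  (G_closure : forall i j : 'I_n, i != j ->
    closure [set (\row_p A p i x : 'rV[X]_m) | x in [set: X]] `&`
    closure [set (\row_p A p j x : 'rV[X]_m) | x in [set: X]] = [set 0])
  (d : measure_display) (T : measurableType d) (P : probability T R)
  (xi : 'I_n -> {RV P >-> borel X})
  (xi_independent : mutually_independent xi)
  (xi_charfun_neq0 : forall (i : 'I_n) (f : dual X), charfun P (xi i) f != 0)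
  (L_class_D : class_D P m.-1
    (fun w => \row_(p < m) \sum_(j < n) A p j (xi j w))) :
  forall i : 'I_n, gaussian P (xi i).
Proof.
move=> i.
have [M hM] := mdiff_charfun A_continuous X_separable A_ker m_ge2 G_closure
  xi_independent xi_charfun_neq0 L_class_D i.
exact: gaussian_of_mdiff hM.
Qed.
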